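(* For all $1<p_1<p<p_2<\infty$ there exists an $\alpha>0$ (independent of $d$) such that $C_d(p_1,p,p_2)=e^{(\alpha+o(1))d}$ as $d\to\infty$.
   Context: For a positive integer $d$, $\mathbb{T}^d$ is the $d$-dimensional torus with its normalized Haar measure, and for $1\leq p\leq\infty$, $H^p(\mathbb{T}^d)$ is the Hardy space of all $f\in L^p(\mathbb{T}^d)$ whose Fourier coefficients $\widehat f(k)$, $k\in\mathbb{Z}^d$, vanish unless all coordinates of $k$ are nonnegative, with the $L^p$ norm. For $1\leq p_1<p<p_2\leq\infty$ define $$C_d(p_1,p,p_2)=\sup\{\|T\|_{p\to p}: T\text{ is linear and bounded on }H^{p_j}(\mathbb{T}^d)\text{ with }\|T\|_{p_j\to p_j}\leq1\text{ for }j=1,2\},$$ where $\|T\|_{q\to q}$ denotes the operator norm of $T$ on $H^q(\mathbb{T}^d)$. Here $T$ is a linear operator on $H^{p_1}(\mathbb{T}^d)\supseteq H^p(\mathbb{T}^d)\supseteq H^{p_2}(\mathbb{T}^d)$ whose restriction to $H^{p_2}(\mathbb{T}^d)$ is a bounded operator on $H^{p_2}(\mathbb{T}^d)$. *)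

(* Defs.v *)
From HB Require Import structures.
From mathcomp Require Import all_boot all_order all_algebra.
From mathcomp Require Import complex.
From mathcomp Require Import all_classical all_reals all_analysis.

Set Implicit Arguments.
Unset Strict Implicit.
Unset Printing Implicit Defensive.

Import Order.TTheory GRing.Theory Num.Theory.
Import numFieldNormedType.Exports.

Local Open Scope classical_set_scope.
Local Open Scope ring_scope.
Local Open Scope complex_scope.

Section haar_measure.
Context {R : realType}.

(* The point x : d.-tuple R stands for (e^{2 i pi x_1}, ..., e^{2 i pi x_d});
   under this map the normalized Haar measure of the torus corresponds to the
   d-fold product of the uniform distribution on [0, 1]. *)
Local Notation torus d := (d.-tuple (measurableTypeR R)).

Definition circle_haar : probability (measurableTypeR R) R :=
  uniform_prob (@ltr01 R).

Definition torus_cons d (z : measurableTypeR R * torus d) : torus d.+1 := [tuple of z.1 :: z.2].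

Lemma measurable_torus_cons d : measurable_fun setT (@torus_cons d).
Proof.
exact: (@measurable_cons _ _ _ _ fst d snd measurable_fst measurable_snd).
Qed.

HB.instance Definition _ d :=
  isMeasurableFun.Build _ _ _ _ (@torus_cons d) (@measurable_torus_cons d).

Fixpoint haar (d : nat) : probability (torus d) R :=
  match d with
  | 0 => dirac ([tuple] : torus 0)
  | n.+1 => distribution (circle_haar \x haar n)%E (@torus_cons n)
  end.

End haar_measure.
Notation torus R d := (d.-tuple (measurableTypeR R)).
Arguments haar R d : clear implicits.

Section hardy_space.
Context {R : realType} (d : nat).
Implicit Types (f g : torus R d -> R[i]) (p : \bar R) (k : 'I_d -> int).

(* e^{2 i pi <k, x>} *)
Definition character k (x : torus R d) : R[i] :=
  let t := 2 * pi * \sum_(j < d) (k j)%:~R * tnth x j in cos t +i* sin t.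

Definition Cmeasurable f :=
  measurable_fun setT (@complex.Re R \o f) /\
  measurable_fun setT (@complex.Im R \o f).

Definition Cintegral f : R[i] :=
  (\int[haar R d]_x complex.Re (f x))%R +i* (\int[haar R d]_x complex.Im (f x))%R.

Definition fourier f k : R[i] := Cintegral (fun x => f x * (character k x)^*).

Definition CLnorm p f : \bar R :=
  Lnorm (haar R d) p (fun x => (ComplexField.Normc.normc (f x))%:E).

(* The functions whose almost everywhere classes form H^p(T^d). *)
Definition hardy p : set (torus R d -> R[i]) :=
  [set f | [/\ Cmeasurable f, (CLnorm p f < +oo)%E &
    forall k, (exists j, k j < 0) -> fourier f k = 0]].

(* T acts on representatives and induces a C-linear map on the almost everywhere
   classes of elements of H^p. *)
Definition hardy_linear p (T : (torus R d -> R[i]) -> torus R d -> R[i]) :=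
  [/\ forall f, hardy p f -> hardy p (T f),
      forall f g, hardy p f -> hardy p g ->
        f = g %[ae haar R d] -> T f = T g %[ae haar R d],
      forall f g, hardy p f -> hardy p g ->
        T (fun x => f x + g x) = (fun x => T f x + T g x) %[ae haar R d] &
      forall (a : R[i]) f, hardy p f ->
        T (fun x => a * f x) = (fun x => a * T f x) %[ae haar R d]].

Definition opnorm p (T : (torus R d -> R[i]) -> torus R d -> R[i]) : \bar R :=
  ereal_sup [set CLnorm p (T f) | f in [set f | hardy p f /\ (CLnorm p f <= 1)%E]].

Definition hardy_contraction p (T : (torus R d -> R[i]) -> torus R d -> R[i]) :=
  (forall f, hardy p f -> hardy p (T f)) /\ (opnorm p T <= 1)%E.

Definition interp_const (p1 p p2 : \bar R) : \bar R :=
  ereal_sup [set opnorm p T | T in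
    [set T | [/\ hardy_linear p1 T, hardy_contraction p1 T & hardy_contraction p2 T]]].

End hardy_space.
Arguments interp_const R d p1 p p2 : clear implicits.

(* Main.v *)
From HB Require Import structures.
Require Import Defs.
From mathcomp Require Import all_boot all_order all_algebra.
From mathcomp Require Import complex ring lra.
From mathcomp Require Import all_classical all_reals all_analysis measurable_realfun.
Set Implicit Arguments.
Unset Strict Implicit.
Unset Printing Implicit Defensive.
Import Order.TTheory GRing.Theory Num.Theory.
Import numFieldNormedType.Exports.
Local Open Scope classical_set_scope.
Local Open Scope ring_scope.
Local Open Scope complex_scope.
Local Notation "z ^*" := (conjc z) : ring_scope.

Notation cRe := (@complex.Re _).
Notation cIm := (@complex.Im _).
Notation normc := ComplexField.Normc.normc.

(** Write [I_q f] for the integral of [|f|^q], and call [A] a witness in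
    dimension [d] if some finite-rank operator [T] on the Hardy spaces of the
    [d]-dimensional torus satisfies [I_q (T f) <= I_q f] for [q = p1, p2], while
    [I_p (T f) >= A] for some [f] in [H^p] with [I_p f <= 1].  Let [s_d] be the
    supremum of the witnesses in dimension [d].  Four facts give the theorem.

    - [C_d ^ p = s_d].  Composing an admissible [T] with a Fejer mean makes it
      finite-rank and keeps it contractive, because the Fejer kernel is doubly
      stochastic; the Fejer means converge in [L^p1], and a ball of [L^p] is
      closed under convergence in [L^p1] ([fejer_cvgP], [Iq_closed],
      [interp_const_witnesses]).
    - [s_(d + e) >= s_d * s_e].  Finite-rank operators are given by kernels, so
      they can be tensored.  The tensor product acts on one group of variables
      after the other, and almost every section of a Hardy function is a Hardy
      function ([tensor_bound], [ae_hardyI_section], [witness_tensor]).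
    - [s_d <= C * K ^ d].  By the theorem of M. Riesz, the projection to
      nonnegative frequencies is bounded by [K] on [L^q] of the circle, for
      [1 < q < oo], hence by [K ^ d] on the torus.  An operator on Hardy spaces
      composed with it acts on all of [L^q], where the Marcinkiewicz theorem
      interpolates ([riesz_bound], [analytic_bound], [marcinkiewicz],
      [witness_bound]).
    - [s_1 > 1].  This is the operator [T f = gam * (f^(0) + f^(1) / 4) * G] of
      rank one.  The norm of the functional on [H^q] is [exp (nu (1 / q))], where
      [nu (1 / q)] is a value of [ln (1 + al / (2 q)) - ln (1 + al ^ 2) / q]: a
      modulus [|1 + al * e|^(2 / q)] is extremal, both in the Hoelder inequality
      from above and as a test function from below ([two_coef_upper],
      [two_coef_lower]).  With the best parameters [al] at the two ends, and
      their weighted mean in between, the exponent lies strictly above the chord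
      ([exponent_gap]).  A polynomial [G] whose modulus is close to the
      indicator of a set of measure [m] has [I_q G] close to [m] for all [q]
      simultaneously ([plateau_poly]), which leaves two free parameters, [gam]
      and [m], to make [T] almost isometric at both ends ([witness_gt1]).

    So [ln s_d] is superadditive and at most linear in [d]; by Fekete's lemma
    [ln s_d / d] converges to its supremum, which is positive because [s_1 > 1],
    and [alpha] is this supremum divided by [p].

    The uniform approximations of moduli by moduli of analytic polynomials all
    come from [(1 + w / N) ^ N], whose modulus is close to [exp (Re w)]: one only
    has to approximate the logarithm of the modulus by the real part of an
    analytic polynomial. *)

(** * Elementary inequalities and complex numbers *)

Section powers.
Variable R : realType.
Implicit Types (x y l q : R).

(** Convexity of the power function, kept with the weight [l] free: letting [l] tend to [1]
    makes the factor of the first term as close to [1] as desired. *)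
Lemma powR_addD_le l q x y : 0 < l < 1 -> 1 <= q -> 0 <= x -> 0 <= y ->
  (x + y) `^ q <= l `^ (1 - q) * x `^ q + (1 - l) `^ (1 - q) * y `^ q.
Proof.
move=> /andP[l0 l1] q1 x0 y0; have l1' : 0 < 1 - l by rewrite subr_gt0.
have H a z : 0 < a -> 0 <= z -> a * (a^-1 * z) `^ q = a `^ (1 - q) * z `^ q.
  move=> a0 z0; rewrite powRM ?invr_ge0 ?(ltW a0)// mulrA; congr (_ * _).
  rewrite -(@powR_inv1 _ a) ?(ltW a0)// -powRrM -{1}[a](@powRr1 _ a) ?(ltW a0)//.
  by rewrite -powRD ?mulN1r//; apply/implyP => _; rewrite gt_eqF.
have l01 : 0 <= l <= 1 by rewrite !ltW.
have hx : l^-1 * x \in (`[0, +oo[%classic : set R).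
  by rewrite inE /= in_itv /= andbT mulr_ge0 ?invr_ge0// ltW.
have hy : (1 - l)^-1 * y \in (`[0, +oo[%classic : set R).
  by rewrite inE /= in_itv /= andbT mulr_ge0 ?invr_ge0// ltW.
have := @convex_powR R q q1 (Itv01 (ltW l0) (ltW l1)) _ _ hx hy.
by rewrite convRE [X in X `^ _ <= _ -> _]convRE /= /unstable.onem !mulrA !divff ?gt_eqF// !mul1r !H.
Qed.

(** The convex function [x `^ q] lies above its tangent line at [y]. *)
Lemma powR_tangent q x y : 1 < q -> 0 <= x -> 0 <= y ->
  q * (y `^ (q - 1) * x) <= x `^ q + (q - 1) * y `^ q.
Proof.
move=> q1 x0 y0; have q0 : 0 < q by lra.
have r0 : 0 < q / (q - 1) by rewrite divr_gt0 // subr_gt0.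
have := @conjugate_powR _ x (y `^ (q - 1)) q (q / (q - 1)) x0 (powR_ge0 _ _) q0 r0.
have -> : q^-1 + (q / (q - 1))^-1 = 1.
  by rewrite invf_div -{1}[q^-1]mul1r -mulrDl addrC subrK divff ?gt_eqF.
rewrite -powRrM mulrCA divff ?mulr1 ?gt_eqF ?subr_gt0// => /(_ erefl).
rewrite -(ler_pM2l q0) mulrDr (mulrCA q (x `^ q)) divff ?gt_eqF// mulr1.
rewrite (mulrC x) => /le_trans; apply; rewrite lerD2l invf_div.
by rewrite mulrCA [q * _]mulrCA divff ?gt_eqF// mulr1 mulrC.
Qed.

(** The parameter [dl] carries the scaling that turns Young's inequality into Hoelder's. *)
Lemma young_powR q dl a b : 1 < q -> 0 <= dl -> 0 <= a -> 0 <= b ->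
  q * (dl * (a * b)) <= a `^ q + (q - 1) * (dl `^ (q / (q - 1)) * b `^ (q / (q - 1))).
Proof.
move=> q1 d0 a0 b0; have q10 : q - 1 != 0 by rewrite gt_eqF // subr_gt0.
have := powR_tangent q1 a0 (powR_ge0 (dl * b) (q - 1)^-1).
rewrite -!powRrM mulVf // powRr1 ?mulr_ge0 // [(q - 1)^-1 * q]mulrC powRM //.
by congr (_ * _ <= _); ring.
Qed.

End powers.

Section complex_facts.
Variable R : realType.
Implicit Types (z w : R[i]) (t s : R).

Lemma normc_sqrtE z : normc z = Num.sqrt (cRe z ^+ 2 + cIm z ^+ 2).
Proof. by case: z. Qed.

Lemma normc_sqr z : normc z ^+ 2 = cRe z ^+ 2 + cIm z ^+ 2.
Proof. by rewrite normc_sqrtE sqr_sqrtr // addr_ge0 // sqr_ge0. Qed.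

Lemma normc_ge0 z : 0 <= normc z.
Proof. by rewrite normc_sqrtE sqrtr_ge0. Qed.

Lemma normc_gt0 z : z != 0 -> 0 < normc z.
Proof.
move=> z0; rewrite lt_neqAle normc_ge0 andbT eq_sym; apply: contra_neq z0.
exact: ComplexField.Normc.eq0_normc.
Qed.

Lemma normc_conj z : normc z^* = normc z.
Proof. by case: z => a b; rewrite !normc_sqrtE /= sqrrN. Qed.

Lemma normc_real t : normc t%:C = `|t|.
Proof. by rewrite normc_sqrtE /= expr0n addr0 sqrtr_sqr. Qed.

Lemma Re_le_normc z : `|cRe z| <= normc z.
Proof. by rewrite normc_sqrtE -sqrtr_sqr ler_wsqrtr // lerDl sqr_ge0. Qed.

Lemma Im_le_normc z : `|cIm z| <= normc z.
Proof. by rewrite normc_sqrtE -sqrtr_sqr ler_wsqrtr // lerDr sqr_ge0. Qed.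

Lemma normcX z n : normc (z ^+ n) = normc z ^+ n.
Proof.
elim: n => [|n IH]; first by rewrite !expr0 ComplexField.Normc.normc1.
by rewrite !exprS ComplexField.Normc.normcM IH.
Qed.

Lemma normc_sum (I : Type) (r : seq I) (P : pred I) (F : I -> R[i]) :
  normc (\sum_(i <- r | P i) F i) <= \sum_(i <- r | P i) normc (F i).
Proof.
elim/big_rec2: _ => [|i x y _ h]; first by rewrite ComplexField.Normc.normc0.
by apply: le_trans (le_normcD _ _) _; rewrite lerD2l.
Qed.

Lemma normcB_le z w : normc z - normc w <= normc (z - w).
Proof. by rewrite lerBlDr; have := le_normcD (z - w) w; rewrite subrK. Qed.

Lemma mulCJ z : z * z^* = (normc z ^+ 2)%:C.
Proof.
by case: z => a b; rewrite normc_sqr /=; simpc; rewrite !expr2; congr (_ +i* _); ring.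
Qed.

Lemma Re_add z w : cRe (z + w) = cRe z + cRe w. Proof. by case: z; case: w. Qed.
Lemma Im_add z w : cIm (z + w) = cIm z + cIm w. Proof. by case: z; case: w. Qed.
Lemma Re_opp z : cRe (- z) = - cRe z. Proof. by case: z. Qed.
Lemma Im_opp z : cIm (- z) = - cIm z. Proof. by case: z. Qed.
Lemma Re_mul z w : cRe (z * w) = cRe z * cRe w - cIm z * cIm w.
Proof. by case: z; case: w. Qed.
Lemma Im_mul z w : cIm (z * w) = cRe z * cIm w + cIm z * cRe w.
Proof. by case: z => a b; case: w => c d /=. Qed.
Lemma Re_conj z : cRe z^* = cRe z. Proof. by case: z. Qed.
Lemma Im_conj z : cIm z^* = - cIm z. Proof. by case: z. Qed.
Definition ReImE := (Re_add, Im_add, Re_opp, Im_opp, Re_mul, Im_mul, Re_conj, Im_conj).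

Lemma complex_eqP z w : cRe z = cRe w -> cIm z = cIm w -> z = w.
Proof. by case: z => a b; case: w => c d /= -> ->. Qed.

Lemma Re_sum (I : Type) (r : seq I) (P : pred I) (F : I -> R[i]) :
  cRe (\sum_(i <- r | P i) F i) = \sum_(i <- r | P i) cRe (F i).
Proof. by elim/big_rec2: _ => // i x y _ <-; rewrite Re_add. Qed.

Lemma Im_sum (I : Type) (r : seq I) (P : pred I) (F : I -> R[i]) :
  cIm (\sum_(i <- r | P i) F i) = \sum_(i <- r | P i) cIm (F i).
Proof. by elim/big_rec2: _ => // i x y _ <-; rewrite Im_add. Qed.

Definition circ t : R[i] := cos (2 * pi * t) +i* sin (2 * pi * t).

Lemma circD t s : circ (t + s) = circ t * circ s.
Proof.
by rewrite /circ mulrDr cosD sinD; apply: complex_eqP; rewrite /= ?ReImE //= addrC.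
Qed.

Lemma circN t : circ (- t) = (circ t)^*.
Proof. by rewrite /circ mulrN cosN sinN. Qed.

Lemma circ0 : circ 0 = 1.
Proof. by rewrite /circ mulr0 cos0 sin0. Qed.

Lemma normc_circ t : normc (circ t) = 1.
Proof. by rewrite normc_sqrtE /= cos2Dsin2 sqrtr1. Qed.

Lemma circM_natl n t : circ (n%:R * t) = circ t ^+ n.
Proof.
elim: n => [|n IH]; first by rewrite mul0r circ0.
by rewrite -natr1 mulrDl mul1r circD IH exprSr.
Qed.

Lemma circ_sum (I : Type) (r : seq I) (P : pred I) (F : I -> R) :
  circ (\sum_(i <- r | P i) F i) = \prod_(i <- r | P i) circ (F i).
Proof. by elim/big_rec2: _ => [|i x y _ <-]; rewrite ?circ0 ?circD. Qed.

Lemma conjM (z w : R[i]) : conjc (z * w) = conjc z * conjc w.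
Proof. exact: (rmorphM (@conjc R)). Qed.

Lemma normc_iM (z : R[i]) : normc ('i%C * z) = normc z.
Proof. by case: z => a b; simpc; rewrite /= sqrrN addrC. Qed.

Lemma cReZ t z : cRe (t%:C * z) = t * cRe z.
Proof. by rewrite Re_mul /= mul0r subr0. Qed.

End complex_facts.

(** * Complex-valued functions on a probability space *)

Section measurability.
Context d (X : measurableType d) (R : realType).
Implicit Types (f g : X -> R[i]) (q : R).

Definition cmeas f :=
  measurable_fun setT (@complex.Re R \o f) /\ measurable_fun setT (@complex.Im R \o f).

Lemma cmeas_cst (a : R[i]) : cmeas (fun=> a).
Proof. by split; apply: measurable_cst. Qed.

Lemma cmeasD f g : cmeas f -> cmeas g -> cmeas (fun x => f x + g x).
Proof.
move=> [f1 f2] [g1 g2]; split.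
  by rewrite (_ : _ \o _ = (cRe \o f) \+ (cRe \o g)); [exact: measurable_funD|
    apply/funext => x /=; rewrite ReImE].
by rewrite (_ : _ \o _ = (cIm \o f) \+ (cIm \o g)); [exact: measurable_funD|
  apply/funext => x /=; rewrite ReImE].
Qed.

Lemma cmeasM f g : cmeas f -> cmeas g -> cmeas (fun x => f x * g x).
Proof.
move=> [f1 f2] [g1 g2]; split.
  rewrite (_ : _ \o _ = ((cRe \o f) \* (cRe \o g)) \- ((cIm \o f) \* (cIm \o g))).
    by apply: measurable_funB; apply: measurable_funM.
  by apply/funext => x /=; rewrite ReImE.
rewrite (_ : _ \o _ = ((cRe \o f) \* (cIm \o g)) \+ ((cIm \o f) \* (cRe \o g))).
  by apply: measurable_funD; apply: measurable_funM.
by apply/funext => x /=; rewrite ReImE.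
Qed.

Lemma cmeasZ (a : R[i]) f : cmeas f -> cmeas (fun x => a * f x).
Proof. by apply: cmeasM; exact: cmeas_cst. Qed.

Lemma cmeasN f : cmeas f -> cmeas (fun x => - f x).
Proof.
by move=> /(cmeasZ (-1)); under eq_fun do rewrite mulN1r.
Qed.

Lemma cmeasB f g : cmeas f -> cmeas g -> cmeas (fun x => f x - g x).
Proof. by move=> mf mg; apply: cmeasD => //; exact: cmeasN. Qed.

Lemma cmeasJ f : cmeas f -> cmeas (fun x => (f x)^*).
Proof.
move=> [f1 f2]; split.
  by rewrite (_ : _ \o _ = cRe \o f) //; apply/funext => x /=; rewrite ReImE.
rewrite (_ : _ \o _ = \- (cIm \o f)); first exact: measurable_funN.
by apply/funext => x /=; rewrite ReImE.
Qed.

Lemma cmeas_sum (I : Type) (r : seq I) (P : pred I) (F : I -> X -> R[i]) :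
  (forall i, P i -> cmeas (F i)) -> cmeas (fun x => \sum_(i <- r | P i) F i x).
Proof.
move=> mF; elim: r => [|i r IH].
  by under eq_fun do rewrite big_nil; exact: cmeas_cst.
case: (boolP (P i)) => Pi; last by under eq_fun do rewrite big_cons (negbTE Pi).
by under eq_fun do rewrite big_cons Pi; apply: cmeasD => //; exact: mF.
Qed.

Lemma cmeas_real (g : X -> R) : measurable_fun setT g -> cmeas (fun x => (g x)%:C).
Proof. by move=> mg; split => //; exact: measurable_cst. Qed.

Lemma measurable_normc f : cmeas f -> measurable_fun setT (fun x => normc (f x)).
Proof.
move=> [f1 f2]; under eq_fun do rewrite normc_sqrtE.
apply: (@measurableT_comp _ _ _ _ _ _ (@Num.sqrt R)).
  by apply: continuous_measurable_fun; exact: sqrt_continuous.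
by apply: measurable_funD; apply: measurable_funX.
Qed.

Lemma measurable_normc_powR q f : cmeas f ->
  measurable_fun setT (fun x => normc (f x) `^ q).
Proof.
move=> mf; apply: (measurableT_comp (measurable_powR q)).
exact: measurable_normc.
Qed.

End measurability.

Lemma cmeas_comp d (X : measurableType d) d' (Y : measurableType d') (R : realType)
    (f : Y -> R[i]) (h : X -> Y) :
  measurable_fun setT h -> cmeas f -> cmeas (f \o h).
Proof. by move=> mh [f1 f2]; split; [apply: measurableT_comp f1 mh|apply: measurableT_comp f2 mh]. Qed.

(** The [q]-th power of the [L^q] norm, in the extended reals: sums and integrals of it
    need no roots. Locked so that conversion never unfolds it down to the measure. *)
HB.lock Definition Iq {d} {X : measurableType d} {R : realType} (mu : probability X R)
  (q : R) (f : X -> R[i]) : \bar R := (\int[mu]_x (normc (f x) `^ q)%:E)%E.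
Canonical Iq_unlockable := Unlockable Iq.unlock.

Section power_integrals.
Context d (X : measurableType d) (R : realType) (mu : probability X R).
Implicit Types (f g : X -> R[i]) (q r : R) (h k : X -> R).
Local Notation Iq := (Iq mu).

Lemma IqE q f : Iq q f = (\int[mu]_x (normc (f x) `^ q)%:E)%E.
Proof. by rewrite unlock. Qed.

Lemma le_pint h k : measurable_fun setT h -> measurable_fun setT k ->
  (forall x, 0 <= h x) -> (forall x, h x <= k x) ->
  (\int[mu]_x (h x)%:E <= \int[mu]_x (k x)%:E)%E.
Proof.
move=> mh mk h0 hk; apply: ge0_le_integral => //=.
- by move=> x _; rewrite lee_fin.
- exact/measurable_EFinP.
- exact/measurable_EFinP.
- by move=> x _; rewrite lee_fin.
Qed.

Lemma pintD h k : measurable_fun setT h -> measurable_fun setT k ->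
  (forall x, 0 <= h x) -> (forall x, 0 <= k x) ->
  (\int[mu]_x (h x + k x)%:E = \int[mu]_x (h x)%:E + \int[mu]_x (k x)%:E)%E.
Proof.
move=> mh mk h0 k0; under eq_integral do rewrite EFinD.
apply: ge0_integralD => //=.
- by move=> x _; rewrite lee_fin.
- exact/measurable_EFinP.
- by move=> x _; rewrite lee_fin.
- exact/measurable_EFinP.
Qed.

Lemma pintZ (a : R) h : measurable_fun setT h -> 0 <= a ->
  (forall x, 0 <= h x) ->
  (\int[mu]_x (a * h x)%:E = a%:E * \int[mu]_x (h x)%:E)%E.
Proof.
move=> mh a0 h0; under eq_integral do rewrite EFinM.
apply: ge0_integralZl_EFin => //=.
- by move=> x _; rewrite lee_fin.
- exact/measurable_EFinP.
Qed.

Lemma pint_cst (a : R) : (\int[mu]_x (a%:E) = a%:E)%E.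
Proof. by rewrite integral_cst//= probability_setT mule1. Qed.

Lemma Iq_ge0 q f : (0 <= Iq q f)%E.
Proof. by rewrite IqE; apply: integral_ge0 => x _; rewrite lee_fin powR_ge0. Qed.

Lemma Iq_fineK q f : (Iq q f < +oo)%E -> (fine (Iq q f))%:E = Iq q f.
Proof. by move=> h; rewrite fineK // ge0_fin_numE // Iq_ge0. Qed.

Lemma le_Iq q f g : 0 <= q -> cmeas f -> cmeas g ->
  (forall x, normc (f x) <= normc (g x)) -> (Iq q f <= Iq q g)%E.
Proof.
move=> q0 mf mg fg; rewrite !IqE; apply: le_pint.
- exact: measurable_normc_powR.
- exact: measurable_normc_powR.
- by move=> x; exact: powR_ge0.
- by move=> x; apply: ge0_ler_powR => //; rewrite nnegrE normc_ge0.
Qed.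

Lemma Iq_cst q (a : R[i]) : Iq q (fun=> a) = (normc a `^ q)%:E.
Proof. by rewrite IqE pint_cst. Qed.

Lemma IqZ q a f : cmeas f -> (Iq q (fun x => a * f x)%R) = ((normc a `^ q)%:E * Iq q f)%E.
Proof.
move=> mf; rewrite !IqE -pintZ ?powR_ge0//.
- by apply: eq_integral => x _; rewrite ComplexField.Normc.normcM powRM ?normc_ge0.
- exact: measurable_normc_powR.
- by move=> x; exact: powR_ge0.
Qed.

Lemma IqN q f : Iq q (fun x => - f x) = Iq q f.
Proof. by rewrite !IqE; apply: eq_integral => x _; rewrite normcN. Qed.

Lemma eq_Iq q f g : (forall x, normc (f x) = normc (g x)) -> Iq q f = Iq q g.
Proof. by move=> fg; rewrite !IqE; apply: eq_integral => x _; rewrite fg. Qed.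

Lemma Iq_ae q f g : cmeas f -> cmeas g -> f = g %[ae mu] -> Iq q f = Iq q g.
Proof.
move=> mf mg fg; rewrite !IqE; apply: ge0_ae_eq_integral => //.
- by apply/measurable_EFinP; exact: measurable_normc_powR.
- by apply/measurable_EFinP; exact: measurable_normc_powR.
- by move=> x _; rewrite lee_fin powR_ge0.
- by move=> x _; rewrite lee_fin powR_ge0.
- by move: fg; apply: filterS => x /= h _; rewrite h.
Qed.

Lemma IqD_le q l f g : 1 <= q -> 0 < l < 1 -> cmeas f -> cmeas g ->
  (Iq q (fun x => f x + g x)%R
    <= (l `^ (1 - q))%:E * Iq q f + ((1 - l) `^ (1 - q))%:E * Iq q g)%E.
Proof.
move=> q1 l01 mf mg; have q0 : 0 <= q by lra.
have mfq := measurable_normc_powR q mf; have mgq := measurable_normc_powR q mg.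
rewrite !IqE -!pintZ ?powR_ge0// -?pintD.
- apply: le_pint.
  + by apply: measurable_normc_powR; exact: cmeasD.
  + by apply: measurable_funD; apply: measurable_funM.
  + by move=> x; exact: powR_ge0.
  + move=> x; apply: le_trans (powR_addD_le l01 q1 _ _); rewrite ?normc_ge0//.
    by apply: ge0_ler_powR; rewrite ?nnegrE ?addr_ge0 ?normc_ge0 ?le_normcD.
- by apply: measurable_funM.
- by apply: measurable_funM.
- by move=> x; rewrite mulr_ge0 ?powR_ge0.
- by move=> x; rewrite mulr_ge0 ?powR_ge0.
- by move=> x; exact: powR_ge0.
- by move=> x; exact: powR_ge0.
Qed.

Lemma IqD_le2 q f g : 1 <= q -> cmeas f -> cmeas g ->
  (Iq q (fun x => f x + g x)%R <= (2 `^ (q - 1))%:E * (Iq q f + Iq q g))%E.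
Proof.
move=> q1 mf mg; have h : 0 < (2^-1 : R) < 1 by lra.
apply: le_trans (IqD_le q1 h mf mg) _.
have -> : 1 - 2^-1 = 2^-1 :> R by lra.
rewrite -[2^-1]powR_inv1// -powRrM mulN1r opprB.
by rewrite ge0_muleDr //; apply: Iq_ge0.
Qed.

Lemma IqD_lty q f g : 1 <= q -> cmeas f -> cmeas g ->
  (Iq q f < +oo -> Iq q g < +oo -> Iq q (fun x => f x + g x)%R < +oo)%E.
Proof.
move=> q1 mf mg f1 g1; apply: le_lt_trans (IqD_le2 q1 mf mg) _.
by rewrite -(Iq_fineK f1) -(Iq_fineK g1) -EFinD -EFinM ltry.
Qed.

Lemma IqZ_lty q a f : cmeas f -> (Iq q f < +oo -> Iq q (fun x => a * f x)%R < +oo)%E.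
Proof. by move=> mf f1; rewrite IqZ // -(Iq_fineK f1) -EFinM ltry. Qed.

Lemma Iq_sum_lty q (I : Type) (s : seq I) (P : pred I) (F : I -> X -> R[i]) :
  1 <= q -> (forall i, P i -> cmeas (F i)) -> (forall i, P i -> Iq q (F i) < +oo)%E ->
  (Iq q (fun x => \sum_(i <- s | P i) F i x)%R < +oo)%E.
Proof.
move=> q1 mF iF; elim: s => [|i s IH].
  under eq_fun do rewrite big_nil.
  by rewrite Iq_cst ltry.
case: (boolP (P i)) => Pi; last by under eq_fun do rewrite big_cons (negbTE Pi).
under eq_fun do rewrite big_cons Pi.
by apply: IqD_lty => //; [exact: mF|exact: cmeas_sum|exact: iF].
Qed.

Lemma Iq_mono_lty r q f : 0 <= r -> r <= q -> cmeas f -> (Iq q f < +oo -> Iq r f < +oo)%E.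
Proof.
move=> r0 rq mf fq; have h : (Iq r f <= 1 + Iq q f)%E.
  rewrite !IqE -[1%E]pint_cst -pintD.
  - apply: le_pint; [exact: measurable_normc_powR| |by move=> x; exact: powR_ge0|].
      by apply: measurable_funD => //; exact: measurable_normc_powR.
    move=> x; have [fx|fx] := leP (normc (f x)) 1.
      apply: (@le_trans _ _ 1); last by rewrite lerDl powR_ge0.
      have h1 : 1 `^ r = 1 :> R by rewrite powR1.
      by rewrite -[leRHS]h1; apply: ge0_ler_powR; rewrite ?nnegrE ?normc_ge0.
    by apply: le_trans (ler_powR (ltW fx) rq) _; rewrite lerDr.
  - exact: measurable_cst.
  - exact: measurable_normc_powR.
  - by move=> x.
  - by move=> x; exact: powR_ge0.
by apply: le_lt_trans h _; rewrite -(Iq_fineK fq) -EFinD ltry.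
Qed.

Lemma Iq_bounded q f (M : R) : 0 <= q -> cmeas f -> (forall x, normc (f x) <= M) ->
  (Iq q f <= (M `^ q)%:E)%E.
Proof.
move=> q0 mf fM; rewrite IqE -[leRHS]pint_cst; apply: le_pint => //.
- exact: measurable_normc_powR.
- by move=> x; exact: powR_ge0.
- move=> x; apply: ge0_ler_powR; rewrite ?nnegrE ?normc_ge0 //.
  exact: le_trans (normc_ge0 _) (fM x).
Qed.

End power_integrals.

(** The complex integral over an arbitrary probability space; on the torus it is the
    integral that defines the Fourier coefficients. *)
HB.lock Definition cint {d} {X : measurableType d} {R : realType} (mu : probability X R)
  (f : X -> R[i]) : R[i] :=
  (\int[mu]_x complex.Re (f x))%R +i* (\int[mu]_x complex.Im (f x))%R.
Canonical cint_unlockable := Unlockable cint.unlock.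

Section complex_integral.
Context d (X : measurableType d) (R : realType) (mu : probability X R).
Implicit Types (f g : X -> R[i]) (q r : R).
Local Notation Iq := (Iq mu).
Local Notation cint := (cint mu).

Definition cintegrable f := cmeas f /\ (Iq 1 f < +oo)%E.

Lemma cintE f : cint f = (\int[mu]_x cRe (f x))%R +i* (\int[mu]_x cIm (f x))%R.
Proof. by rewrite unlock. Qed.

Lemma Iq1E f : Iq 1 f = (\int[mu]_x (normc (f x))%:E)%E.
Proof. by rewrite IqE; apply: eq_integral => x _; rewrite powRr1 // normc_ge0. Qed.

Lemma cintegrable_Re f : cintegrable f -> mu.-integrable setT (EFin \o (fun x => cRe (f x))).
Proof.
move=> [mf f1]; apply/integrableP; split; first by apply/measurable_EFinP; exact: mf.1.
apply: le_lt_trans f1; rewrite Iq1E; apply: ge0_le_integral => //=.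
- by apply/measurable_EFinP/measurableT_comp => //; exact: mf.1.
- by apply/measurable_EFinP; exact: measurable_normc.
- by move=> x _; rewrite lee_fin Re_le_normc.
Qed.

Lemma cintegrable_Im f : cintegrable f -> mu.-integrable setT (EFin \o (fun x => cIm (f x))).
Proof.
move=> [mf f1]; apply/integrableP; split; first by apply/measurable_EFinP; exact: mf.2.
apply: le_lt_trans f1; rewrite Iq1E; apply: ge0_le_integral => //=.
- by apply/measurable_EFinP/measurableT_comp => //; exact: mf.2.
- by apply/measurable_EFinP; exact: measurable_normc.
- by move=> x _; rewrite lee_fin Im_le_normc.
Qed.

Lemma cintegrableD f g : cintegrable f -> cintegrable g -> cintegrable (fun x => f x + g x).
Proof. by move=> [mf f1] [mg g1]; split; [exact: cmeasD|exact: IqD_lty]. Qed.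

Lemma cintegrableZ a f : cintegrable f -> cintegrable (fun x => a * f x).
Proof. by move=> [mf f1]; split; [exact: cmeasZ|exact: IqZ_lty]. Qed.

Lemma cintegrableJ f : cintegrable f -> cintegrable (fun x => (f x)^*).
Proof.
move=> [mf f1]; split; first exact: cmeasJ.
by rewrite (@eq_Iq _ _ _ _ _ _ f) // => x; rewrite normc_conj.
Qed.

Lemma cintegrable_sum (I : Type) (s : seq I) (P : pred I) (F : I -> X -> R[i]) :
  (forall i, P i -> cintegrable (F i)) ->
  cintegrable (fun x => \sum_(i <- s | P i) F i x).
Proof.
move=> H; split; first by apply: cmeas_sum => i /H[].
by apply: Iq_sum_lty => // i /H[].
Qed.

Lemma Iq_lty_cintegrable q f : 1 <= q -> cmeas f -> (Iq q f < +oo)%E -> cintegrable f.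
Proof. by move=> q1 mf fq; split => //; apply: Iq_mono_lty fq. Qed.

Definition cbounded f := cmeas f /\ exists M, forall x, normc (f x) <= M.

Lemma cbounded_cintegrable f : cbounded f -> cintegrable f.
Proof.
move=> [mf [M fM]]; split => //.
by apply: le_lt_trans (Iq_bounded _ _ mf fM) _ => //; rewrite ltry.
Qed.

Lemma cbounded_Iq_lty q f : 0 <= q -> cbounded f -> (Iq q f < +oo)%E.
Proof.
by move=> q0 [mf [M fM]]; apply: le_lt_trans (Iq_bounded _ q0 mf fM) _; rewrite ltry.
Qed.

Lemma IqMb_lty q f g : 0 <= q -> cbounded f -> cmeas g ->
  (Iq q g < +oo -> Iq q (fun x => f x * g x)%R < +oo)%E.
Proof.
move=> q0 [mf [M fM]] mg g1.
have M0 : 0 <= M by apply: le_trans (fM point); exact: normc_ge0.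
apply: le_lt_trans (IqZ_lty M%:C mg g1).
apply: le_Iq => //; [exact: cmeasM|exact: cmeasZ|move=> x].
rewrite !ComplexField.Normc.normcM normc_real ger0_norm //.
by rewrite ler_wpM2r // normc_ge0.
Qed.

Lemma cintegrableM f g : cbounded f -> cintegrable g -> cintegrable (fun x => f x * g x).
Proof.
by move=> bf [mg g1]; split; [apply: cmeasM => //; exact: bf.1|exact: IqMb_lty].
Qed.

Lemma cboundedM f g : cbounded f -> cbounded g -> cbounded (fun x => f x * g x).
Proof.
move=> [mf [M fM]] [mg [N gN]]; split; first exact: cmeasM.
by exists (M * N) => x; rewrite ComplexField.Normc.normcM ler_pM // normc_ge0.
Qed.

Lemma cboundedD f g : cbounded f -> cbounded g -> cbounded (fun x => f x + g x).
Proof.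
move=> [mf [M fM]] [mg [N gN]]; split; first exact: cmeasD.
by exists (M + N) => x; apply: le_trans (le_normcD _ _) _; rewrite lerD.
Qed.

Lemma cbounded_cst (a : R[i]) : cbounded (fun=> a).
Proof. by split; [exact: cmeas_cst|exists (normc a)]. Qed.

Lemma cboundedZ a f : cbounded f -> cbounded (fun x => a * f x).
Proof. exact: (cboundedM (cbounded_cst a)). Qed.

Lemma cboundedJ f : cbounded f -> cbounded (fun x => (f x)^*).
Proof.
move=> [mf [M fM]]; split; first exact: cmeasJ.
by exists M => x; rewrite normc_conj.
Qed.

Lemma cbounded_sum (I : Type) (s : seq I) (P : pred I) (F : I -> X -> R[i]) :
  (forall i, P i -> cbounded (F i)) ->
  cbounded (fun x => \sum_(i <- s | P i) F i x).
Proof.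
move=> H; elim: s => [|i s IH]; first by under eq_fun do rewrite big_nil; exact: cbounded_cst.
case: (boolP (P i)) => Pi; last by under eq_fun do rewrite big_cons (negbTE Pi).
by under eq_fun do rewrite big_cons Pi; apply: cboundedD => //; exact: H.
Qed.

Lemma cbounded_prod (I : Type) (s : seq I) (P : pred I) (F : I -> X -> R[i]) :
  (forall i, P i -> cbounded (F i)) ->
  cbounded (fun x => \prod_(i <- s | P i) F i x).
Proof.
move=> H; elim: s => [|i s IH]; first by under eq_fun do rewrite big_nil; exact: cbounded_cst.
case: (boolP (P i)) => Pi; last by under eq_fun do rewrite big_cons (negbTE Pi).
by under eq_fun do rewrite big_cons Pi; apply: cboundedM => //; exact: H.
Qed.

Lemma cintD f g : cintegrable f -> cintegrable g ->
  cint (fun x => f x + g x) = cint f + cint g.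
Proof.
move=> cf cg; rewrite !cintE; apply: complex_eqP => /=.
  rewrite -RintegralD //; [|exact: cintegrable_Re|exact: cintegrable_Re].
  by apply: eq_Rintegral => x _; rewrite ReImE.
rewrite -RintegralD //; [|exact: cintegrable_Im|exact: cintegrable_Im].
by apply: eq_Rintegral => x _; rewrite ReImE.
Qed.

Lemma cintZ a f : cintegrable f -> cint (fun x => a * f x) = a * cint f.
Proof.
move=> cf; have rf := cintegrable_Re cf; have jf := cintegrable_Im cf.
have sc (b : R) (h : X -> R) : mu.-integrable setT (EFin \o h) ->
    mu.-integrable setT (EFin \o (fun x => b * h x)).
  move=> ih; rewrite (_ : _ \o _ = (fun x => b%:E * (EFin \o h) x)%E) //.
  exact: integrableZl.
rewrite !cintE; apply: complex_eqP; rewrite ?ReImE /=.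
  rewrite -!RintegralZl // -RintegralB //; [|exact: sc|exact: sc].
  by apply: eq_Rintegral => x _; rewrite ReImE.
rewrite -!RintegralZl // -RintegralD //; [|exact: sc|exact: sc].
by apply: eq_Rintegral => x _; rewrite ReImE.
Qed.

Lemma eq_cint f g : (forall x, f x = g x) -> cint f = cint g.
Proof. by move=> fg; congr cint; exact/funext. Qed.

Lemma cint_cst (a : R[i]) : cint (fun=> a) = a.
Proof.
rewrite cintE /= !Rintegral_cst //= probability_setT /= !mulr1.
by case: a.
Qed.

Lemma cint_sum (I : Type) (s : seq I) (P : pred I) (F : I -> X -> R[i]) :
  (forall i, P i -> cintegrable (F i)) ->
  cint (fun x => \sum_(i <- s | P i) F i x) = \sum_(i <- s | P i) cint (F i).
Proof.
move=> H; elim: s => [|i s IH].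
  by rewrite big_nil; under eq_cint do rewrite big_nil; rewrite cint_cst.
rewrite big_cons; case: (boolP (P i)) => Pi.
  under eq_cint do rewrite big_cons Pi.
  by rewrite cintD ?IH //; [exact: H|exact: cintegrable_sum].
by under eq_cint do rewrite big_cons (negbTE Pi).
Qed.

Lemma cintJ f : cintegrable f -> cint (fun x => (f x)^*) = (cint f)^*.
Proof.
move=> cf; rewrite !cintE; apply: complex_eqP; rewrite ?ReImE /=.
  by apply: eq_Rintegral => x _; rewrite ReImE.
rewrite -[RHS]mulN1r -RintegralZl //; last exact: cintegrable_Im.
by apply: eq_Rintegral => x _; rewrite ReImE mulN1r.
Qed.

Lemma cint_ae f g : cmeas f -> cmeas g -> f = g %[ae mu] -> cint f = cint g.
Proof.
move=> [f1 f2] [g1 g2] fg; rewrite !cintE; congr (_ +i* _); congr fine;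
  apply: ae_eq_integral => //; try exact/measurable_EFinP;
  by move: fg; apply: filterS => x /= h _; rewrite h.
Qed.

(** The modulus of the integral is attained after a rotation: integrate [f] times the
    unimodular constant that makes the integral real and nonnegative. *)
Lemma normc_cint_le f : cintegrable f -> ((normc (cint f))%:E <= Iq 1 f)%E.
Proof.
move=> cf; set w := cint f; have [w0|w0] := eqVneq w 0.
  by rewrite w0 ComplexField.Normc.normc0 Iq_ge0.
have nw := normc_gt0 w0.
set u := w^* * ((normc w)^-1)%:C.
have nu : normc u = 1.
  rewrite ComplexField.Normc.normcM normc_conj normc_real gtr0_norm ?invr_gt0 //.
  by rewrite divff // gt_eqF.
have uw : u * w = (normc w)%:C.
  rewrite /u mulrAC [_^* * w]mulrC mulCJ -rmorphM /= expr2 -mulrA divff ?mulr1 //.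
  by rewrite gt_eqF.
have cuf := cintegrableZ u cf.
have : cRe (cint (fun x => u * f x)) = normc w by rewrite cintZ // -/w uw.
rewrite {1}cintE /= => <-; rewrite Iq1E.
rewrite /Rintegral fineK; last by apply: integrable_fin_num => //; exact: cintegrable_Re.
apply: le_trans (le_trans _ (le_abse_integral mu measurableT _)) _.
- by rewrite [leRHS]/=; exact: lee_abs.
- by have /integrableP[] := cintegrable_Re cuf.
- apply: ge0_le_integral => //=.
  + by apply/measurable_EFinP/measurableT_comp => //; exact: cuf.1.1.
  + by apply/measurable_EFinP/measurable_normc; exact: cf.1.
  + move=> x _; rewrite lee_fin (le_trans (Re_le_normc _)) //.
    by rewrite ComplexField.Normc.normcM nu mul1r.
Qed.

End complex_integral.

Section product.
Context d (X : measurableType d) d' (Y : measurableType d') (R : realType).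
Context (mu : probability X R) (nu : probability Y R).
Implicit Types (f : X * Y -> R[i]) (q : R).

Lemma cmeas_pairl f x : cmeas f -> cmeas (fun y => f (x, y)).
Proof. by move=> mf; apply: (cmeas_comp (h := pair x)) mf; exact: measurable_pair1. Qed.

Lemma cmeas_fst (g : X -> R[i]) : cmeas g -> cmeas (fun z : X * Y => g z.1).
Proof. by move=> mg; apply: (cmeas_comp (h := fst)) mg; exact: measurable_fst. Qed.

Lemma cmeas_snd (g : Y -> R[i]) : cmeas g -> cmeas (fun z : X * Y => g z.2).
Proof. by move=> mg; apply: (cmeas_comp (h := snd)) mg; exact: measurable_snd. Qed.

Lemma Iq_prod1 q f : cmeas f ->
  Iq (mu \x nu)%E q f = (\int[mu]_x Iq nu q (fun y => f (x, y)))%E.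
Proof.
move=> mf; rewrite IqE fubini_tonelli1 //=.
- by apply: eq_integral => x _; rewrite IqE.
- by apply/measurable_EFinP; exact: measurable_normc_powR.
- by move=> x; rewrite lee_fin powR_ge0.
Qed.

Lemma Iq_prod2 q f : cmeas f ->
  Iq (mu \x nu)%E q f = (\int[nu]_y Iq mu q (fun x => f (x, y)))%E.
Proof.
move=> mf; rewrite IqE fubini_tonelli2 //=.
- by apply: eq_integral => x _; rewrite IqE.
- by apply/measurable_EFinP; exact: measurable_normc_powR.
- by move=> x; rewrite lee_fin powR_ge0.
Qed.

Lemma measurable_Iq_pair1 q f : cmeas f ->
  measurable_fun setT (fun x => Iq nu q (fun y => f (x, y))).
Proof.
move=> mf; rewrite (_ : (fun x => _) = fubini_F nu (fun z => (normc (f z) `^ q)%:E)).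
  apply: measurable_fun_fubini_tonelli_F.
  - by apply/measurable_EFinP; exact: measurable_normc_powR.
  - by move=> x; rewrite lee_fin powR_ge0.
by apply/funext => x; rewrite IqE.
Qed.

Lemma measurable_Iq_pair2 q f : cmeas f ->
  measurable_fun setT (fun y => Iq mu q (fun x => f (x, y))).
Proof.
move=> mf; rewrite (_ : (fun x => _) = fubini_G mu (fun z => (normc (f z) `^ q)%:E)).
  apply: measurable_fun_fubini_tonelli_G.
  - by apply/measurable_EFinP; exact: measurable_normc_powR.
  - by move=> x; rewrite lee_fin powR_ge0.
by apply/funext => x; rewrite IqE.
Qed.

(** Part of Fubini's theorem, for a slice integral that is set to a default value where
    the slice is not integrable. *)
Lemma cint_pair_meas f : cintegrable (mu \x nu)%E f ->
  cmeas (fun x => cint nu (fun y => f (x, y))).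
Proof.
move=> cf; have mfine : measurable_fun setT (@fine R) by exact: fine_measurable.
split.
  rewrite (_ : _ \o _ = fine \o fubini_F nu (EFin \o (fun z => cRe (f z)))).
    apply: (measurableT_comp mfine).
    exact: (measurable_fubini_F (cintegrable_Re cf)).
  by apply/funext => x /=; rewrite cintE.
rewrite (_ : _ \o _ = fine \o fubini_F nu (EFin \o (fun z => cIm (f z)))).
  apply: (measurableT_comp mfine).
  exact: (measurable_fubini_F (cintegrable_Im cf)).
by apply/funext => x /=; rewrite cintE.
Qed.

Lemma cint_prod f : cintegrable (mu \x nu)%E f ->
  cint (mu \x nu)%E f = cint mu (fun x => cint nu (fun y => f (x, y))).
Proof.
have RF (g : X * Y -> R) : (mu \x nu)%E.-integrable setT (EFin \o g) ->
    (\int[(mu \x nu)%E]_z g z)%R = (\int[mu]_x (\int[nu]_y g (x, y)))%R.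
  move=> ig; have mfine : measurable_fun setT (@fine R) by exact: fine_measurable.
  rewrite {1}/Rintegral -(integral12_prod_meas1 ig) /Rintegral; congr fine.
  apply: ae_eq_integral => //.
  - exact: (measurable_fubini_F ig).
  - apply/measurable_EFinP; apply: (measurableT_comp mfine).
    exact: (measurable_fubini_F ig).
  - have := ae_integrable1 ig; apply: filterS => x ix _.
    by rewrite /fubini_F fineK //; exact: integrable_fin_num.
move=> cf; rewrite !cintE !RF; [|exact: cintegrable_Im|exact: cintegrable_Re].
by congr (_ +i* _); apply: eq_Rintegral => x _; rewrite cintE.
Qed.

Lemma cintegrable_prodM (f : X -> R[i]) (g : Y -> R[i]) :
  cintegrable mu f -> cintegrable nu g ->
  cintegrable (mu \x nu)%E (fun z => f z.1 * g z.2).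
Proof.
move=> [mf f1] [mg g1].
have m : cmeas (fun z : X * Y => f z.1 * g z.2).
  by apply: cmeasM; [exact: cmeas_fst|exact: cmeas_snd].
split => //; rewrite Iq_prod1 //.
under eq_integral do rewrite /= IqZ // powRr1 ?normc_ge0 //.
rewrite ge0_integralZr //.
- rewrite -Iq1E -(Iq_fineK f1) -(Iq_fineK g1) -EFinM; exact: ltry.
- by apply/measurable_EFinP; exact: measurable_normc.
- by move=> x _; rewrite lee_fin normc_ge0.
- exact: Iq_ge0.
Qed.

Lemma cint_prodM (f : X -> R[i]) (g : Y -> R[i]) :
  cintegrable mu f -> cintegrable nu g ->
  cint (mu \x nu)%E (fun z => f z.1 * g z.2) = cint mu f * cint nu g.
Proof.
move=> cf cg; rewrite cint_prod; last exact: cintegrable_prodM.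
under eq_cint do rewrite /= cintZ // mulrC.
by rewrite cintZ // mulrC.
Qed.

Lemma Iq_prodM q (f : X -> R[i]) (g : Y -> R[i]) : cmeas f -> cmeas g ->
  Iq (mu \x nu)%E q (fun z => f z.1 * g z.2) = (Iq mu q f * Iq nu q g)%E.
Proof.
move=> mf mg; rewrite Iq_prod1; last by apply: cmeasM; [exact: cmeas_fst|exact: cmeas_snd].
under eq_integral do rewrite /= IqZ //.
rewrite ge0_integralZr //.
- by rewrite [in RHS]IqE.
- by apply/measurable_EFinP; exact: measurable_normc_powR.
- by move=> x _; rewrite lee_fin powR_ge0.
- exact: Iq_ge0.
Qed.

Lemma ae_Iq_lty q f : cmeas f -> (Iq (mu \x nu)%E q f < +oo)%E ->
  {ae mu, forall x, (Iq nu q (fun y => f (x, y)) < +oo)%E}.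
Proof.
move=> mf; rewrite Iq_prod1 // => h.
have : mu.-integrable setT (fun x => Iq nu q (fun y => f (x, y))).
  apply/integrableP; split; first exact: measurable_Iq_pair1.
  by under eq_integral do rewrite gee0_abs ?Iq_ge0 //.
move=> /(integrable_ae measurableT); apply: filterS => x /(_ I).
by rewrite ge0_fin_numE // Iq_ge0.
Qed.

End product.

Section hoelder.
Context d (X : measurableType d) (R : realType) (mu : probability X R).
Implicit Types (f g : X -> R[i]) (q : R).

Lemma young_Iq q dl f g : 1 < q -> 0 <= dl -> cmeas f -> cmeas g ->
  ((q * dl)%:E * Iq mu 1 (fun x => f x * g x)%R <=
   Iq mu q f + ((q - 1) * dl `^ (q / (q - 1)))%:E * Iq mu (q / (q - 1)) g)%E.
Proof.
move=> q1 d0 mf mg; set r := q / (q - 1).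
have q10 : 0 < q - 1 by rewrite subr_gt0.
have q00 : 0 < q by exact: lt_trans q1.
have mN := measurable_normc_powR r mg; have mF := measurable_normc_powR q mf.
have k0 : 0 <= (q - 1) * dl `^ r by rewrite mulr_ge0 ?powR_ge0 // ltW.
have e1 := pintZ mu mN k0 (fun x => powR_ge0 _ _).
have e2 := pintZ mu (measurable_normc (cmeasM mf mg)) (mulr_ge0 (ltW q00) d0) (fun x => normc_ge0 _).
have mkN : measurable_fun setT (fun x => (q - 1) * dl `^ r * normc (g x) `^ r).
  exact: measurable_funM.
have kN0 x : 0 <= (q - 1) * dl `^ r * normc (g x) `^ r by rewrite mulr_ge0 ?powR_ge0.
have kF0 x : 0 <= normc (f x) `^ q := powR_ge0 _ _.
rewrite Iq1E (IqE _ _ f) (IqE _ _ g) -e1 -e2 -pintD //.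
apply: le_pint => [|||x].
- by apply: measurable_funM => //; exact: measurable_normc (cmeasM mf mg).
- exact: measurable_funD.
- by move=> x; rewrite !mulr_ge0 ?normc_ge0 // ltW.
- by rewrite ComplexField.Normc.normcM -!mulrA; apply: young_powR => //; rewrite normc_ge0.
Qed.

(** Hoelder's inequality, from the integrated Young inequality at the scaling [dl] that
    makes both of its terms comparable. *)
Lemma hoelder_cint q P f g : 1 < q -> 0 < P -> cintegrable mu (fun x => f x * g x) ->
  cmeas f -> cmeas g -> (Iq mu (q / (q - 1)) g <= P%:E)%E ->
  ((normc (cint mu (fun x => f x * g x)) `^ q)%:E <= (P `^ (q - 1))%:E * Iq mu q f)%E.
Proof.
move=> q1 P0 cfg mf mg hP; set S := normc _.
have q10 : 0 < q - 1 by rewrite subr_gt0.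
have q00 : 0 < q by exact: lt_trans q1.
have [S0|S0] := eqVneq S 0.
  by rewrite S0 powR0 ?gt_eqF // mule_ge0 ?Iq_ge0 // lee_fin powR_ge0.
have {}S0 : 0 < S by rewrite lt_neqAle eq_sym S0 normc_ge0.
have [If|] := ltP (Iq mu q f) +oo%E; last first.
  by rewrite leye_eq => /eqP ->; rewrite mulry gtr0_sg ?powR_gt0 // mul1e leey.
set dl := (S / P) `^ (q - 1).
have SP0 : 0 < S / P by rewrite divr_gt0.
have dl0 : 0 <= dl by exact: powR_ge0.
have := young_Iq q1 dl0 mf mg; rewrite -(Iq_fineK If); set F := fine _ => h.
(* the two terms balance when the integral is [S] and the dual integral is [P] *)
have dlr : dl `^ (q / (q - 1)) = (S / P) `^ q.
  by rewrite /dl -powRrM; congr (_ `^ _); field; rewrite gt_eqF.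
have h2 : ((q * dl * S)%:E <= (F + (q - 1) * (S / P) `^ q * P)%:E)%E.
  rewrite EFinM; apply: (@le_trans _ _ ((q * dl)%:E * Iq mu 1 (fun x => f x * g x)%R)%E).
    apply: lee_wpmul2l; last exact: normc_cint_le.
    by rewrite lee_fin mulr_ge0 // ltW.
  apply: (le_trans h); rewrite EFinD; apply: leeD => //; rewrite dlr [leRHS]EFinM.
  by apply: lee_wpmul2l => //; rewrite lee_fin mulr_ge0 ?powR_ge0 // ltW.
move: h2; rewrite -EFinM !lee_fin.
have SPE : (S / P) `^ q = dl * (S / P).
  rewrite /dl -{3}(powRr1 (ltW SP0)) -powRD ?subrK //.
  by rewrite (gt_eqF SP0) implybT.
have -> : (q - 1) * (S / P) `^ q * P = (q - 1) * dl * S.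
  by rewrite SPE; field; rewrite gt_eqF.
move=> h2; have h3 : dl * S <= F by lra.
have -> : S `^ q = P `^ (q - 1) * (dl * S).
  rewrite /dl mulrA -powRM ?(ltW P0) ?(ltW SP0) // [P * _]mulrC divfK ?gt_eqF //.
  rewrite -{3}(powRr1 (ltW S0)) -powRD ?subrK //.
  by rewrite (gt_eqF S0) implybT.
by apply: ler_wpM2l => //; exact: powR_ge0.
Qed.
End hoelder.

(** * Truncation, closedness of balls, and real interpolation *)

Section truncation.
Context d (X : measurableType d) (R : realType) (mu : probability X R).
Implicit Types (f g : X -> R[i]) (q r : R).
Local Notation Iq := (Iq mu).

Lemma measurable_trunc q g (M : R) : cmeas g ->
  measurable_fun setT (fun x => Num.min (normc (g x)) M `^ q).
Proof.
move=> mg; apply: (measurableT_comp (measurable_powR q)).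
by apply: measurable_minr; [exact: measurable_normc|exact: measurable_cst].
Qed.

(** Monotone convergence in the truncation height. *)
Lemma Iq_le_trunc q g (B : R) : 0 <= q -> cmeas g ->
  (forall M : R, 0 < M -> (\int[mu]_x (Num.min (normc (g x)) M `^ q)%:E <= B%:E)%E) ->
  (Iq q g <= B%:E)%E.
Proof.
move=> q0 mg H; rewrite IqE.
pose G n x := (Num.min (normc (g x)) n.+1%:R `^ q)%:E.
have G0 n x : setT x -> (0 <= G n x)%E by move=> _; rewrite lee_fin powR_ge0.
have mG n : measurable_fun setT (G n).
  by apply/measurable_EFinP; exact: measurable_trunc.
have ndG x : setT x -> nondecreasing_seq (G^~ x).
  move=> _ m n mn; rewrite lee_fin; apply: ge0_ler_powR => //.
  - by rewrite nnegrE le_min normc_ge0 ler0n.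
  - by rewrite nnegrE le_min normc_ge0 ler0n.
  - by rewrite le_min ge_min lexx /= ge_min ler_nat ltnS mn orbT.
rewrite (_ : (\int[mu]_x _)%E = (\int[mu]_x limn (G^~ x))%E); last first.
  apply: eq_integral => x _; apply/esym/cvg_lim => //.
  apply: cvg_near_cst; near=> n; rewrite /G min_l //.
  apply: (@le_trans _ _ n%:R); last by rewrite ler_nat.
  by near: n; exact: nbhs_infty_ger.
rewrite (monotone_convergence mu measurableT mG G0 ndG).
apply: lime_le; last by apply: nearW => n; exact: H.
apply: ereal_nondecreasing_is_cvgn => m n mn.
apply: ge0_le_integral; [exact: measurableT|exact: G0|exact: mG|exact: mG|].
by move=> x h; exact: (ndG x h _ _ mn).
Unshelve. all: by end_near.
Qed.

(** An almost sharp triangle inequality: the constant [1 + del] on the main term is paid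
    by a large constant on the error term. *)
Lemma IqD_eps q (del : R) : 1 <= q -> 0 < del ->
  exists2 c : R, 0 < c & (forall x y : R, 0 <= x -> 0 <= y ->
    (x + y) `^ q <= (1 + del) * x `^ q + c * y `^ q).
Proof.
move=> q1 d0; have [->|qn1] := eqVneq q 1.
  exists 1 => // x y x0 y0; rewrite !powRr1 ?addr_ge0 // mulrDl !mul1r lerD2r.
  by rewrite lerDl mulr_ge0 // ltW.
have q1' : 0 < q - 1 by rewrite subr_gt0 lt_neqAle eq_sym qn1.
set l := (1 + del) `^ (- (q - 1)^-1).
have l0 : 0 < l by rewrite powR_gt0 //; lra.
have l1 : l < 1.
  rewrite /l powRN invf_lt1 ?powR_gt0 //; [|lra].
  have h1 : 1 `^ (q - 1)^-1 = 1 :> R by rewrite powR1.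
  by rewrite -[ltLHS]h1; apply: gt0_ltr_powR; rewrite ?invr_gt0 // ?nnegrE; lra.
have ll : l `^ (1 - q) = 1 + del.
  by rewrite /l -powRrM mulNr -mulrN opprB mulVf ?gt_eqF // powRr1 //; lra.
exists ((1 - l) `^ (1 - q)); first by rewrite powR_gt0 // subr_gt0.
move=> x y x0 y0; rewrite -ll; apply: powR_addD_le => //.
by rewrite l0.
Qed.

(** Closed balls of [L^q] are closed in [L^r]: truncating the limit at height
    [M] costs only [M `^ (q - r)] times the [L^r] distance. *)
Lemma Iq_closed r q g (B : R) : 1 <= r -> r <= q -> 0 <= B -> cmeas g ->
  (forall e : R, 0 < e -> exists2 h, cmeas h &
    (Iq r (fun x => g x - h x)%R <= e%:E /\ Iq q h <= B%:E)%E) ->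
  (Iq q g <= B%:E)%E.
Proof.
move=> r1 rq B0 mg H; have q1 : 1 <= q by lra.
apply: Iq_le_trunc => // [|M M0]; first lra.
apply/lee_addgt0Pr => e e0.
pose del := e / (2 * (B + 1)).
have del0 : 0 < del by rewrite divr_gt0 //; lra.
have [c c0 Hc] := IqD_eps q1 del0.
pose k := c * M `^ (q - r).
have k0 : 0 < k by rewrite mulr_gt0 // powR_gt0.
have [|h mh [h1 h2]] := H (e / (2 * k)); first by rewrite divr_gt0 // mulr_gt0.
have mgh := cmeasB mg mh.
apply: (@le_trans _ _ ((1 + del)%:E * Iq q h + k%:E * Iq r (fun x => g x - h x)%R)%E).
  rewrite !IqE -!pintZ //; [|exact: measurable_normc_powR|exact: ltW|
    by move=> x; exact: powR_ge0|exact: measurable_normc_powR|lra|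
    by move=> x; exact: powR_ge0].
  rewrite -pintD.
  - apply: le_pint.
    + exact: measurable_trunc.
    + by apply: measurable_funD; apply: measurable_funM => //; exact: measurable_normc_powR.
    + by move=> x; exact: powR_ge0.
    + move=> x; set a := normc (g x); set b := normc (h x); set s := normc (g x - h x).
      have ab : a <= b + s by rewrite addrC -lerBlDr; exact: normcB_le.
      have [a0 b0 s0] : [/\ 0 <= a, 0 <= b & 0 <= s] by rewrite !normc_ge0.
      have mM : Num.min a M <= b + Num.min s M.
        rewrite addr_minr le_min; apply/andP; split; first by rewrite ge_min ab.
        by rewrite ge_min [X in _ || X](_ : _ = true) ?orbT // lerDr.
      have ms0 : 0 <= Num.min s M by rewrite le_min s0 ltW.
      apply: (@le_trans _ _ ((b + Num.min s M) `^ q)).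
        apply: ge0_ler_powR; rewrite ?nnegrE //; first lra.
        - by rewrite le_min a0 ltW.
        - by rewrite addr_ge0.
      apply: le_trans (Hc _ _ b0 ms0) _; rewrite lerD2l /k -mulrA ler_pM2l //.
      have -> : Num.min s M `^ q = Num.min s M `^ (q - r) * Num.min s M `^ r.
        by rewrite -powRD ?subrK //; apply/implyP => /eqP; lra.
      apply: ler_pM; rewrite ?powR_ge0 //; apply: ge0_ler_powR; rewrite ?nnegrE ?ge_min ?lexx ?orbT //; lra.
  - by apply: measurable_funM => //; exact: measurable_normc_powR.
  - by apply: measurable_funM => //; exact: measurable_normc_powR.
  - by move=> x; rewrite mulr_ge0 ?powR_ge0 //; lra.
  - by move=> x; rewrite mulr_ge0 ?powR_ge0 // ltW.
apply: (@le_trans _ _ ((1 + del)%:E * B%:E + k%:E * (e / (2 * k))%:E)%E).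
  by apply: leeD; apply: lee_wpmul2l => //; rewrite lee_fin; lra.
rewrite -!EFinM -EFinD lee_fin mulrDl mul1r -addrA lerD2l.
have -> : k * (e / (2 * k)) = e / 2 by field; rewrite gt_eqF.
have : del * B <= e / 2.
  rewrite /del mulrAC ler_pdivrMr ?mulr_gt0 //; last lra.
  by rewrite (_ : e / 2 * _ = e * (B + 1)) ?ler_pM2l //; [lra|field].
lra.
Qed.

End truncation.

Section interpolation.
Variable R : realType.
Implicit Types (a b c s y : R).

Let geom_ratio a : 0 < a -> 0 < (2 : R) `^ (- a) < 1.
Proof.
move=> a0; rewrite powR_gt0 //= powRN invf_lt1 ?powR_gt0 //.
have h1 : 1 `^ a = 1 :> R by rewrite powR1.
by rewrite -[ltLHS]h1; apply: gt0_ltr_powR; rewrite ?nnegrE //; lra.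
Qed.

(** Up to a constant, a geometric sum is its largest term; this is what makes
    the sums over dyadic levels below harmless. *)
Lemma geom_sum_up a c n : 0 < a -> 0 < c ->
  \sum_(i < n.+1) (c * 2 ^+ i) `^ a <= (c * 2 ^+ n) `^ a * (1 - 2 `^ (- a))^-1.
Proof.
move=> a0 c0; have /andP[r0 r1] := geom_ratio a0; set r := 2 `^ (- a) in r0 r1 *.
have r1' : 0 < 1 - r by rewrite subr_gt0.
elim: n => [|n IH].
  rewrite big_ord1 /= ler_peMr ?powR_ge0 //.
  by rewrite invf_ge1 // gerBl ltW.
rewrite big_ord_recr /=; set t := (c * 2 ^+ n.+1) `^ a.
have ht : (c * 2 ^+ n) `^ a = r * t.
  rewrite /t (_ : c * 2 ^+ n.+1 = 2 * (c * 2 ^+ n)); last by rewrite exprS; ring.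
  rewrite [in RHS]powRM ?mulr_ge0 ?exprn_ge0 // ?ltW // mulrA.
  by rewrite /r powRN mulVf ?mul1r // gt_eqF // powR_gt0.
apply: le_trans (lerD IH (lexx _)) _; rewrite ht.
suff -> : r * t / (1 - r) + t = t / (1 - r) by [].
by field; rewrite gt_eqF.
Qed.

Lemma geom_sum_down b c n : 0 < b -> 0 < c ->
  \sum_(i < n) (c * 2 ^+ i) `^ (- b) <= c `^ (- b) * (1 - 2 `^ (- b))^-1.
Proof.
move=> b0; have /andP[r0 r1] := geom_ratio b0; set r := 2 `^ (- b) in r0 r1 *.
have r1' : 0 < 1 - r by rewrite subr_gt0.
elim: n c => [|n IH] c c0; first by rewrite big_ord0 mulr_ge0 ?powR_ge0 // invr_ge0 ltW.
rewrite big_ord_recl /= expr0 mulr1.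
under eq_bigr do rewrite /bump /= add1n exprS mulrA.
apply: le_trans (lerD (lexx _) (IH (c * 2) _)) _; first by rewrite mulr_gt0.
rewrite powRM ?ler0n //; last exact: ltW.
rewrite -/r; set t := c `^ (- b).
suff -> : t + t * r / (1 - r) = t / (1 - r) by [].
by field; rewrite gt_eqF.
Qed.

(** The levels below [y] sum up to a multiple of the top one. *)
Lemma level_sum_up a c y n : 0 < a -> 0 < c -> 0 <= y ->
  \sum_(i < n) (c * 2 ^+ i < y)%R%:R * (c * 2 ^+ i) `^ a
    <= y `^ a * (1 - 2 `^ (- a))^-1.
Proof.
move=> a0 c0 y0; have /andP[r0 r1] := geom_ratio a0.
have r1' : 0 < (1 - 2 `^ (- a))^-1 :> R by rewrite invr_gt0 subr_gt0.
elim: n => [|n IH]; first by rewrite big_ord0 mulr_ge0 ?powR_ge0 // ltW.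
have [h|h] := ltP (c * 2 ^+ n) y.
  apply: le_trans (le_trans _ (geom_sum_up n a0 c0)) _.
    by apply: ler_sum => i _; rewrite ler_piMl ?powR_ge0 // lern1 leq_b1.
  rewrite ler_pM2r //; apply: ge0_ler_powR; rewrite ?nnegrE //; try exact: ltW.
  by rewrite mulr_ge0 ?exprn_ge0 // ltW.
by rewrite big_ord_recr /= (ltNge _ y) h /= mul0r addr0.
Qed.

Lemma level_sum_down b c y n : 0 < b -> 0 < c -> 0 < y ->
  \sum_(i < n) (y <= c * 2 ^+ i)%R%:R * (c * 2 ^+ i) `^ (- b)
    <= y `^ (- b) * (1 - 2 `^ (- b))^-1.
Proof.
move=> b0 + y0; have /andP[r0 r1] := geom_ratio b0.
have r1' : 0 < (1 - 2 `^ (- b))^-1 :> R by rewrite invr_gt0 subr_gt0.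
elim: n c => [|n IH] c c0; first by rewrite big_ord0 mulr_ge0 ?powR_ge0 // ltW.
have [h|h] := leP y c.
  apply: le_trans (le_trans _ (geom_sum_down n.+1 b0 c0)) _.
    by apply: ler_sum => i _; rewrite ler_piMl ?powR_ge0 // lern1 leq_b1.
  rewrite ler_pM2r // !powRN lef_pV2 ?posrE ?powR_gt0 //.
  by apply: ge0_ler_powR; rewrite ?nnegrE //; exact: ltW.
rewrite big_ord_recl /= expr0 mulr1 (leNgt y c) h /= mul0r add0r.
under eq_bigr do rewrite /bump /= add1n exprS mulrA.
by apply: IH; rewrite mulr_gt0.
Qed.

(** A value [s] above the lowest level is, up to the factor [4] and the cut-off at the
    top, one of the dyadic levels, and a factor [2] above it. *)
Lemma top_level c s n : 0 < c -> 2 * c < s ->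
  exists2 i : 'I_n.+1, 2 * (c * 2 ^+ i) < s &
    Num.min s (4 * (c * 2 ^+ n)) <= 4 * (c * 2 ^+ i).
Proof.
move=> c0 cs; elim: n => [|n [i i1 i2]].
  by exists ord0 => //=; rewrite ?expr0 ?mulr1 // ge_min lexx orbT.
have [h|h] := ltP (2 * (c * 2 ^+ n.+1)) s.
  by exists ord_max => //=; rewrite ge_min lexx orbT.
exists (widen_ord (leqnSn _) i) => //=; apply: le_trans i2.
rewrite ge_min (_ : s <= _) // le_min lexx /=; apply: le_trans h _.
by rewrite exprS; lra.
Qed.

End interpolation.

Section real_interpolation.
Context d (X : measurableType d) d' (Y : measurableType d') (R : realType).
Context (mu : probability X R) (nu : probability Y R).
Implicit Types (f g : X -> R[i]) (A : (X -> R[i]) -> Y -> R[i]).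

Definition high (l : R) f x := (\1_[set x | l < normc (f x)] x)%:C * f x.
Definition low (l : R) f x := (\1_[set x | normc (f x) <= l] x)%:C * f x.

Lemma high_low l f x : f x = high l f x + low l f x.
Proof.
rewrite /high /low !indicE -mulrDl -rmorphD /=.
have [h|h] := ltP l (normc (f x)).
  rewrite mem_set //= memNset /=; last by rewrite leNgt h.
  by rewrite addr0 mul1r.
rewrite memNset /=; last by rewrite ltNge h.
by rewrite mem_set //= add0r mul1r.
Qed.

Lemma normc_high l f x : normc (high l f x) = (l < normc (f x))%R%:R * normc (f x).
Proof.
rewrite /high ComplexField.Normc.normcM normc_real indicE ger0_norm //; congr (_ * _).
by congr (nat_of_bool _)%:R; apply/idP/idP => [/set_mem|h]; [|exact/mem_set].
Qed.

Lemma normc_low l f x : normc (low l f x) = (normc (f x) <= l)%R%:R * normc (f x).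
Proof.
rewrite /low ComplexField.Normc.normcM normc_real indicE ger0_norm //; congr (_ * _).
by congr (nat_of_bool _)%:R; apply/idP/idP => [/set_mem|h]; [|exact/mem_set].
Qed.

Lemma cmeas_high l f : cmeas f -> cmeas (high l f).
Proof.
move=> mf; apply: cmeasM => //; apply: cmeas_real; apply: measurable_indic.
rewrite (_ : [set x | _] = setT `&` (fun x => normc (f x)) @^-1` `]l, +oo[).
  by apply: measurable_normc mf measurableT _ _; exact: measurable_itv.
by apply/seteqP; split => x /=; rewrite in_itv /= andbT; tauto.
Qed.

Lemma cmeas_low l f : cmeas f -> cmeas (low l f).
Proof.
move=> mf; apply: cmeasM => //; apply: cmeas_real; apply: measurable_indic.
rewrite (_ : [set x | _] = setT `&` (fun x => normc (f x)) @^-1` `]-oo, l]).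
  by apply: measurable_normc mf measurableT _ _; exact: measurable_itv.
by apply/seteqP; split => x /=; rewrite in_itv /=; tauto.
Qed.

(** If [s] exceeds twice the level then [u] or [v] exceeds the level. *)
Lemma split_level (p p1 p2 l s u v : R) : 0 < l -> 0 <= u -> 0 <= v ->
  0 <= p1 -> 0 <= p2 -> s <= u + v -> 2 * l < s ->
  l `^ p <= l `^ (p - p1) * u `^ p1 + l `^ (p - p2) * v `^ p2.
Proof.
move=> l0 u0 v0 p10 p20 suv ls.
have H (q w : R) : 0 <= q -> l <= w -> l `^ p <= l `^ (p - q) * w `^ q.
  move=> q0 lw; rewrite -[leLHS](_ : l `^ (p - q) * l `^ q = _); last first.
    by rewrite -powRD ?subrK //; apply/implyP => _; rewrite gt_eqF.
  rewrite ler_pM2l ?powR_gt0 //; apply: ge0_ler_powR; rewrite ?nnegrE //; lra.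
have [lu|ul] := leP l u.
  by apply: le_trans (H p1 u p10 lu) _; rewrite lerDl mulr_ge0 ?powR_ge0.
have lv : l <= v by lra.
by apply: le_trans (H p2 v p20 lv) _; rewrite lerDr mulr_ge0 ?powR_ge0.
Qed.

(** The constant depends on the three exponents only, and not on the spaces; this is
    what makes it the same in all dimensions. *)
Definition interp_bound (p1 p p2 : R) : R :=
  4 `^ p * ((1 - 2 `^ (- (p - p1)))^-1 + (1 - 2 `^ (- (p2 - p)))^-1).

Lemma geom_ratio_gt0 (a : R) : 0 < a -> 0 < (1 - 2 `^ (- a))^-1 :> R.
Proof.
move=> a0; rewrite invr_gt0 subr_gt0 powRN invf_lt1 ?powR_gt0 //.
have h1 : 1 `^ a = 1 :> R by rewrite powR1.
by rewrite -[ltLHS]h1; apply: gt0_ltr_powR; rewrite ?nnegrE //; lra.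
Qed.

Lemma interp_bound_gt0 (p1 p p2 : R) : p1 < p -> p < p2 -> 0 < interp_bound p1 p p2.
Proof.
by move=> p1p pp2; rewrite mulr_gt0 ?powR_gt0 ?addr_gt0 ?geom_ratio_gt0 ?subr_gt0.
Qed.

(** At each dyadic level [l i], the function is cut into its part above and its part below
    that level; the first is estimated at [p1] and the second at [p2]. Summed over the
    levels, both estimates are geometric series dominated by the level of [f]. Finitely many
    levels suffice: values below the lowest cost at most [e], and the image is truncated. *)
Lemma marcinkiewicz (p1 p p2 : R) A (K1 K2 : R) : 1 <= p1 -> p1 < p -> p < p2 ->
  0 <= K1 -> 0 <= K2 ->
  (forall f, cmeas f -> (Iq mu p1 f < +oo)%E ->
     cmeas (A f) /\ (Iq nu p1 (A f) <= K1%:E * Iq mu p1 f)%E) ->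
  (forall f, cmeas f -> (Iq mu p2 f < +oo)%E ->
     (Iq nu p2 (A f) <= K2%:E * Iq mu p2 f)%E) ->
  (forall f g, cmeas f -> cmeas g -> (Iq mu p1 f < +oo)%E -> (Iq mu p1 g < +oo)%E ->
     A (fun x => f x + g x) = (fun x => A f x + A g x) %[ae nu]) ->
  forall f, cmeas f -> (Iq mu p f < +oo)%E ->
    (Iq nu p (A f) <= (interp_bound p1 p p2 * (K1 + K2))%:E * Iq mu p f)%E.
Proof.
move=> p1_ge1 p1p pp2 K10 K20 H1 H2 Hadd f mf fp; rewrite /interp_bound.
have p10 : 0 <= p1 by lra. have p20 : 0 <= p2 by lra. have p0 : 0 < p by lra.
set C1 : R := (1 - 2 `^ (- (p - p1)))^-1; set C2 : R := (1 - 2 `^ (- (p2 - p)))^-1.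
have C10 : 0 < C1 by apply: geom_ratio_gt0; lra.
have C20 : 0 < C2 by apply: geom_ratio_gt0; lra.
have f1 := Iq_mono_lty p10 (ltW p1p) mf fp.
have mhi l := cmeas_high l mf; have mlo l := cmeas_low l mf.
have hi_le l : (Iq mu p1 (high l f) < +oo)%E.
  apply: le_lt_trans f1; apply: le_Iq => // x.
  by rewrite normc_high ler_piMl ?normc_ge0 // lern1 leq_b1.
have lo_bd l : 0 < l -> cbounded (low l f).
  move=> l0; split => //; exists l => x; rewrite normc_low.
  by have [h|h] := leP (normc (f x)) l; rewrite ?mul1r ?mul0r //; exact: ltW.
have lo_le1 l : 0 < l -> (Iq mu p1 (low l f) < +oo)%E.
  by move=> l0; apply: cbounded_Iq_lty => //; exact: lo_bd.
have lo_le2 l : 0 < l -> (Iq mu p2 (low l f) < +oo)%E.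
  by move=> l0; apply: cbounded_Iq_lty => //; exact: lo_bd.
have mAf : cmeas (A f) by case: (H1 f mf f1).
have mAh l : cmeas (A (high l f)) by case: (H1 _ (mhi l) (hi_le l)).
have mAl l : 0 < l -> cmeas (A (low l f)) by move=> l0; case: (H1 _ (mlo l) (lo_le1 l l0)).
have Asplit l : 0 < l -> A f = (fun x => A (high l f) x + A (low l f) x) %[ae nu].
  move=> l0; have Ef : (fun x => high l f x + low l f x) = f.
    by apply/funext => x; rewrite -high_low.
  by have := Hadd _ _ (mhi l) (mlo l) (hi_le l) (lo_le1 l l0); rewrite Ef.
pose B := fine (Iq mu p f); have EB : Iq mu p f = B%:E by rewrite /B Iq_fineK.
have B0 : 0 <= B by rewrite fine_ge0 // Iq_ge0.
rewrite EB -EFinM; apply: Iq_le_trunc => //; first exact: ltW.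
move=> M M0; apply/lee_addgt0Pr => e e0.
pose c := Num.min 1 (e `^ p^-1) / 2.
have c0 : 0 < c by rewrite divr_gt0 // lt_min ltr01 powR_gt0.
have ce : (2 * c) `^ p <= e.
  rewrite -[leRHS](_ : (e `^ p^-1) `^ p = e); last first.
    by rewrite -powRrM mulVf ?powRr1 ?gt_eqF // ltW.
  apply: ge0_ler_powR; rewrite ?nnegrE ?powR_ge0 ?(ltW p0) //.
    by rewrite mulr_ge0 // ltW.
  by rewrite /c mulrC divfK // ge_min lexx orbT.
have [n Mn] : exists n : nat, M <= 4 * (c * 2 ^+ n).
  exists (Num.bound (M / c)); have := upper_nthrootP (leqnn (Num.bound (M / c))).
  rewrite ltr_pdivrMr // mulrC => /ltW /le_trans; apply.
  by rewrite ler_peMl ?ler1n // mulr_ge0 ?exprn_ge0 // ltW.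
pose l i := c * 2 ^+ i.
have l0 i : 0 < l i by rewrite mulr_gt0 // exprn_gt0.
pose U i y := l i `^ (p - p1) * normc (A (high (l i) f) y) `^ p1
   + l i `^ (p - p2) * normc (A (low (l i) f) y) `^ p2.
have U0 i y : 0 <= U i y by rewrite addr_ge0 // mulr_ge0 ?powR_ge0.
have mU1 i : measurable_fun setT (fun y => l i `^ (p - p1) * normc (A (high (l i) f) y) `^ p1).
  by apply: measurable_funM => //; exact: measurable_normc_powR.
have mU2 i : measurable_fun setT (fun y => l i `^ (p - p2) * normc (A (low (l i) f) y) `^ p2).
  by apply: measurable_funM => //; apply: measurable_normc_powR; exact: mAl.
have mU i : measurable_fun setT (U i) by exact: measurable_funD.
have mS : measurable_fun setT (fun y => \sum_(i < n.+1) U i y).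
  by apply: measurable_sum.
have key : (\int[nu]_y (Num.min (normc (A f y)) M `^ p)%:E
    <= \int[nu]_y (e + 4 `^ p * \sum_(i < n.+1) U i y)%:E)%E.
  apply: ae_ge0_le_integral => //=.
  - by move=> y _; rewrite lee_fin powR_ge0.
  - by apply/measurable_EFinP; exact: measurable_trunc.
  - by move=> y _; rewrite lee_fin addr_ge0 ?(ltW e0) // mulr_ge0 ?powR_ge0 ?sumr_ge0.
  - by apply/measurable_EFinP; apply: measurable_funD => //; exact: measurable_funM.
  have : {ae nu, forall y, forall i, A f y = A (high (l i) f) y + A (low (l i) f) y}.
    by apply: ae_foralln => i; have := Asplit _ (l0 i); apply: filterS => y; apply.
  apply: filterS => y Hy _; rewrite lee_fin.
  set s := normc (A f y); have s0 : 0 <= s by exact: normc_ge0.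
  have [cs|sc] := ltP (2 * c) s; last first.
    apply: (@le_trans _ _ e); last by rewrite lerDl mulr_ge0 ?powR_ge0 ?sumr_ge0.
    apply: le_trans ce; apply: ge0_ler_powR; rewrite ?nnegrE ?(ltW p0) //.
    - by rewrite le_min s0 ltW.
    - by rewrite mulr_ge0 // ltW.
    - by rewrite ge_min sc.
  have [i i1 i2] := top_level n c0 cs.
  apply: (@le_trans _ _ (4 `^ p * l i `^ p)).
    rewrite -powRM //; last exact: ltW.
    apply: ge0_ler_powR; rewrite ?nnegrE ?(ltW p0) //.
    - by rewrite le_min s0 ltW.
    - by rewrite mulr_ge0 // ltW.
    - by apply: le_trans i2; rewrite le_min !ge_min lexx /= Mn orbT.
  rewrite -[leLHS]add0r; apply: lerD; first exact: ltW.
  rewrite ler_pM2l ?powR_gt0 // (bigD1 i) //=.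
  apply: le_trans (_ : U i y <= _); last by rewrite lerDl sumr_ge0.
  apply: (@split_level p p1 p2 (l i) s) => //; try exact: normc_ge0.
  by rewrite /s (Hy i); exact: le_normcD.
apply: le_trans key _; rewrite pintD //; last first.
  by move=> y; rewrite mulr_ge0 ?powR_ge0 ?sumr_ge0.
- by move=> y; rewrite ltW.
- exact: measurable_funM.
rewrite pint_cst addeC leeD2r // pintZ ?powR_ge0 //; last by move=> y; exact: sumr_ge0.
under eq_integral do rewrite -sumEFin.
rewrite ge0_integral_sum //; last 2 first.
- by move=> i; exact/measurable_EFinP.
- by move=> i y _; rewrite lee_fin.
pose V i x := K1 * (l i `^ (p - p1) * normc (high (l i) f x) `^ p1)
  + K2 * (l i `^ (p - p2) * normc (low (l i) f x) `^ p2).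
have mV1 i : measurable_fun setT (fun x => l i `^ (p - p1) * normc (high (l i) f x) `^ p1).
  by apply: measurable_funM => //; exact: measurable_normc_powR.
have mV2 i : measurable_fun setT (fun x => l i `^ (p - p2) * normc (low (l i) f x) `^ p2).
  by apply: measurable_funM => //; exact: measurable_normc_powR.
have V10 i x : 0 <= K1 * (l i `^ (p - p1) * normc (high (l i) f x) `^ p1).
  by rewrite mulr_ge0 // mulr_ge0 // powR_ge0.
have V20 i x : 0 <= K2 * (l i `^ (p - p2) * normc (low (l i) f x) `^ p2).
  by rewrite mulr_ge0 // mulr_ge0 // powR_ge0.
have mV i : measurable_fun setT (V i).
  by apply: measurable_funD; apply: measurable_funM.
have UV i : (\int[nu]_y (U i y)%:E <= \int[mu]_x (V i x)%:E)%E.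
  rewrite !pintD //; try by move=> x; rewrite mulr_ge0 ?powR_ge0.
  - rewrite !pintZ ?powR_ge0 //; try by move=> x; rewrite ?mulr_ge0 ?powR_ge0.
    + rewrite -!IqE; apply: leeD.
        rewrite muleCA; apply: lee_wpmul2l; first by rewrite lee_fin powR_ge0.
        by case: (H1 _ (mhi (l i)) (hi_le (l i))).
      rewrite muleCA; apply: lee_wpmul2l; first by rewrite lee_fin powR_ge0.
      by apply: H2 => //; exact: lo_le2.
    + exact: measurable_normc_powR.
    + exact: measurable_normc_powR.
    + by apply: measurable_normc_powR; exact: mAl.
    + exact: measurable_normc_powR.
  - exact: measurable_funM.
  - exact: measurable_funM.
apply: (@le_trans _ _ ((4 `^ p)%:E * ((K1 * C1 + K2 * C2) * B)%:E)%E); last first.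
  rewrite -EFinM lee_fin mulrA ler_wpM2r // -mulrA ler_pM2l ?powR_gt0 //.
  rewrite mulrDl !mulrDr [C1 * K1]mulrC [C2 * K2]mulrC.
  have := mulr_ge0 (ltW C10) K20; have := mulr_ge0 (ltW C20) K10; lra.
apply: lee_wpmul2l; first by rewrite lee_fin powR_ge0.
apply: (@le_trans _ _ (\sum_(i < n.+1) \int[mu]_x (V i x)%:E)%E).
  by apply: lee_sum => i _; exact: UV.
rewrite -ge0_integral_sum //; last 2 first.
- by move=> i; exact/measurable_EFinP.
- by move=> i x _; rewrite lee_fin addr_ge0.
under eq_integral do rewrite sumEFin.
rewrite EFinM -EB IqE -pintZ ?addr_ge0 ?mulr_ge0 ?(ltW C10) ?(ltW C20) //; last 2 first.
- exact: measurable_normc_powR.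
- by move=> x; exact: powR_ge0.
apply: le_pint.
- exact: measurable_sum.
- by apply: measurable_funM => //; exact: measurable_normc_powR.
- by move=> x; apply: sumr_ge0 => i _; rewrite addr_ge0.
move=> x; rewrite /V big_split /= -!mulr_sumr mulrDl -!mulrA.
set y := normc (f x); have y0 : 0 <= y by exact: normc_ge0.
apply: lerD; apply: ler_wpM2l => //.
  apply: (@le_trans _ _ (\sum_(i < n.+1) (l i < y)%R%:R * l i `^ (p - p1) * y `^ p1)).
    apply: ler_sum => i _; rewrite normc_high -/y mulrC.
    have [_|_] := ltP (l i) y; first by rewrite !mul1r mulrC.
    by rewrite !mul0r powR0 ?mul0r //; lra.
  rewrite -mulr_suml (_ : C1 * y `^ p = y `^ (p - p1) * C1 * y `^ p1); last first.
    by rewrite mulrAC -powRD ?subrK 1?mulrC //; apply/implyP => /eqP; lra.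
  by apply: ler_wpM2r; [exact: powR_ge0|apply: level_sum_up => //; lra].
have [y00|yN0] := eqVneq y 0.
  rewrite big1 ?mulr_ge0 ?powR_ge0 ?(ltW C20) // => i _.
  by rewrite normc_low -/y y00 mulr0 powR0 ?mulr0 //; lra.
have {}y0 : 0 < y by rewrite lt_neqAle eq_sym yN0.
apply: (@le_trans _ _ (\sum_(i < n.+1) (y <= l i)%R%:R * l i `^ (- (p2 - p)) * y `^ p2)).
  apply: ler_sum => i _; rewrite normc_low -/y opprB mulrC.
  have [_|_] := leP y (l i); first by rewrite !mul1r mulrC.
  by rewrite !mul0r powR0 ?mul0r //; lra.
rewrite -mulr_suml (_ : C2 * y `^ p = y `^ (- (p2 - p)) * C2 * y `^ p2); last first.
  by rewrite mulrAC -powRD ?opprB ?subrK 1?mulrC //; apply/implyP => /eqP; lra.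
by apply: ler_wpM2r; [exact: powR_ge0|apply: level_sum_down => //; lra].
Qed.

End real_interpolation.

(** * Integration over the torus *)

Section torus_integral.
Variable R : realType.
Local Notation torus d := (torus R d).

Lemma ge0_integral_tcons n (f : torus n.+1 -> \bar R) : measurable_fun setT f ->
  (forall x, 0 <= f x)%E ->
  (\int[haar R n.+1]_x f x =
   \int[circle_haar]_t \int[haar R n]_x f (torus_cons (t, x)))%E.
Proof.
move=> mf f0; have mc := @measurable_torus_cons R n.
rewrite /= ge0_integral_distribution // fubini_tonelli1 //.
- by apply: measurableT_comp mf mc.
- by move=> x; exact: f0.
Qed.

Definition tcat d e (z : torus d * torus e) : torus (d + e) := [tuple of z.1 ++ z.2].

Lemma tnth_tcatl d e (z : torus d * torus e) i : tnth (tcat z) (lshift e i) = tnth z.1 i.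
Proof. by rewrite /tcat tnth_lshift. Qed.

Lemma tnth_tcatr d e (z : torus d * torus e) i : tnth (tcat z) (rshift d i) = tnth z.2 i.
Proof. by rewrite /tcat tnth_rshift. Qed.

Lemma measurable_tcat d e : measurable_fun setT (@tcat d e).
Proof.
apply/measurable_fun_tnthP => i; case: (split_ordP i) => j ->.
  rewrite (_ : _ \o _ = (fun x : torus d => tnth x j) \o fst).
    by apply: measurableT_comp; [exact: measurable_tnth|exact: measurable_fst].
  by apply/funext => z /=; rewrite tnth_tcatl.
rewrite (_ : _ \o _ = (fun x : torus e => tnth x j) \o snd).
  by apply: measurableT_comp; [exact: measurable_tnth|exact: measurable_snd].
by apply/funext => z /=; rewrite tnth_tcatr.
Qed.

Lemma ge0_integral_tcat d e (f : torus (d + e) -> \bar R) : measurable_fun setT f ->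
  (forall x, 0 <= f x)%E ->
  (\int[haar R (d + e)]_x f x = \int[haar R d \x haar R e]_z f (tcat z))%E.
Proof.
elim: d f => [|d IH] f mf f0.
  have f0' (z : torus 0 * torus e) : (0 <= f (tcat z))%E by [].
  rewrite fubini_tonelli1 //; last by apply: measurableT_comp mf (@measurable_tcat 0 e).
  rewrite /= integral_dirac //; last first.
    apply: measurable_fun_fubini_tonelli_F => //.
    by apply: measurableT_comp mf (@measurable_tcat 0 e).
  rewrite diracT mul1e; apply: eq_integral => y _; congr f.
  exact: val_inj.
rewrite (@ge0_integral_tcons (d + e)) // fubini_tonelli1 //; last first.
  by apply: measurableT_comp mf (@measurable_tcat d.+1 e).
rewrite ge0_integral_tcons.
- apply: eq_integral => t _; rewrite IH.
  + rewrite fubini_tonelli1; last by move=> z; exact: f0.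
    * apply: eq_integral => x _; apply: eq_integral => y _; congr f; exact: val_inj.
    * apply: (measurableT_comp (f := f \o (fun w => torus_cons (t, w)))); last exact: measurable_tcat.
      apply: measurableT_comp mf _; apply: measurableT_comp (@measurable_torus_cons R _) _.
      exact: measurable_pair1.
  + apply: measurableT_comp mf _; apply: measurableT_comp (@measurable_torus_cons R _) _.
    exact: measurable_pair1.
  + by move=> x; exact: f0.
- apply: measurable_fun_fubini_tonelli_F => //.
  by apply: measurableT_comp mf (@measurable_tcat d.+1 e).
- by move=> x; apply: integral_ge0 => y _; exact: f0.
Qed.

Lemma integral_tcat d e (f : torus (d + e) -> \bar R) : measurable_fun setT f ->
  (\int[haar R (d + e)]_x f x = \int[haar R d \x haar R e]_z f (tcat z))%E.
Proof.
move=> mf; rewrite integralE ge0_integral_tcat //; last exact: measurable_funepos.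
rewrite [X in (_ - X)%E]ge0_integral_tcat //; last exact: measurable_funeneg.
rewrite [RHS]integralE; congr (_ - _)%E; apply: eq_integral => z _.
  by rewrite [RHS]funeposE funeposE.
by rewrite [RHS]funenegE funenegE.
Qed.

Lemma integral_tcons n (f : torus n.+1 -> \bar R) : measurable_fun setT f ->
  (\int[haar R n.+1]_x f x = \int[circle_haar \x haar R n]_z f (torus_cons z))%E.
Proof.
have H (g : torus n.+1 -> \bar R) : measurable_fun setT g -> (forall x, 0 <= g x)%E ->
    (\int[haar R n.+1]_x g x = \int[circle_haar \x haar R n]_z g (torus_cons z))%E.
  by move=> mg g0; rewrite /= ge0_integral_distribution.
move=> mf; rewrite integralE H //; last exact: measurable_funepos.
rewrite [X in (_ - X)%E]H //; last exact: measurable_funeneg.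
rewrite [RHS]integralE; congr (_ - _)%E; apply: eq_integral => z _.
  by rewrite [RHS]funeposE funeposE.
by rewrite [RHS]funenegE funenegE.
Qed.

Section tcat.
Variables (d e : nat).
Local Notation mu := (haar R d \x haar R e)%E.
Implicit Types f : torus (d + e) -> R[i].

Lemma cmeas_tcat f : cmeas f -> cmeas (f \o @tcat d e).
Proof. by apply: cmeas_comp; exact: measurable_tcat. Qed.

Lemma Iq_tcat q f : cmeas f -> Iq (haar R (d + e)) q f = Iq mu q (f \o @tcat d e).
Proof.
move=> mf; rewrite !IqE integral_tcat //.
by apply/measurable_EFinP; exact: measurable_normc_powR.
Qed.

Lemma cint_tcat f : cmeas f -> cint (haar R (d + e)) f = cint mu (f \o @tcat d e).
Proof.
move=> [f1 f2]; rewrite !cintE; congr (_ +i* _); congr fine.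
  by rewrite integral_tcat //; exact/measurable_EFinP.
by rewrite integral_tcat //; exact/measurable_EFinP.
Qed.

Lemma cintegrable_tcat f : cintegrable (haar R (d + e)) f ->
  cintegrable mu (f \o @tcat d e).
Proof. by move=> [mf f1]; split; [exact: cmeas_tcat|rewrite -Iq_tcat]. Qed.

End tcat.

Lemma cint_tcons n (f : torus n.+1 -> R[i]) : cmeas f ->
  cint (haar R n.+1) f = cint (circle_haar \x haar R n)%E (f \o @torus_cons R n).
Proof.
move=> [f1 f2]; rewrite !cintE; congr (_ +i* _); congr fine.
  by rewrite integral_tcons //; exact/measurable_EFinP.
by rewrite integral_tcons //; exact/measurable_EFinP.
Qed.

Lemma cmeas_tnth d (f : R -> R[i]) (i : 'I_d) : @cmeas _ (measurableTypeR R) _ f ->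
  cmeas (fun x : torus d => f (tnth x i)).
Proof. by apply: (cmeas_comp (h := fun x : torus d => tnth x i)); exact: measurable_tnth. Qed.

Lemma cbounded_tnth d (f : R -> R[i]) (i : 'I_d) : @cbounded _ (measurableTypeR R) _ f ->
  cbounded (fun x : torus d => f (tnth x i)).
Proof. by move=> [mf [M fM]]; split; [exact: cmeas_tnth|exists M => x]. Qed.

(** Haar measure of the torus is a product measure. *)
Lemma cint_prod_tnth d (f : 'I_d -> R -> R[i]) :
  (forall i, @cbounded _ (measurableTypeR R) _ (f i)) ->
  cint (haar R d) (fun x => \prod_(i < d) f i (tnth x i)) =
  \prod_(i < d) cint circle_haar (f i).
Proof.
elim: d f => [|d IH] f bf.
  rewrite big_ord0; under eq_cint do rewrite big_ord0.
  by rewrite cint_cst.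
have bP : cbounded (fun x : torus d.+1 => \prod_(i < d.+1) f i (tnth x i)).
  by apply: cbounded_prod => i _; exact: cbounded_tnth.
rewrite cint_tcons; last exact: bP.1.
under eq_cint do rewrite /= big_ord_recl /=.
rewrite big_ord_recl -IH //.
rewrite -cint_prodM; [|exact: cbounded_cintegrable|].
  apply: eq_cint => -[t x] /=; rewrite tnth0; congr (_ * _).
  by apply: eq_bigr => i _; congr (f _ _); rewrite tnthS.
by apply: cbounded_cintegrable; apply: cbounded_prod => i _; exact: cbounded_tnth.
Qed.

End torus_integral.

Section circle.
Variable R : realType.
Local Notation circle := (@circle_haar R).

Lemma is_derive_sinM (c t : R) : is_derive t 1 (fun t : R => sin (c * t)) (c * cos (c * t)).
Proof.
have h : is_derive t 1 (fun t : R => c * t) c.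
  by have := is_deriveZ c (is_derive_id t (1 : R)); rewrite /GRing.scale /= mulr1.
have := @is_derive1_comp R (@sin R) (fun t : R => c * t) t _ _ (is_derive_sin (c * t)) h.
by rewrite mulrC.
Qed.

Lemma is_derive_cosM (c t : R) : is_derive t 1 (fun t : R => cos (c * t)) (- (c * sin (c * t))).
Proof.
have h : is_derive t 1 (fun t : R => c * t) c.
  by have := is_deriveZ c (is_derive_id t (1 : R)); rewrite /GRing.scale /= mulr1.
have := @is_derive1_comp R (@cos R) (fun t : R => c * t) t _ _ (is_derive_cos (c * t)) h.
by rewrite mulNr mulrC.
Qed.

(** Integrals over the circle of a nonnegative function with a known primitive. *)
Lemma circle_FTC (f F : R -> R) : continuous f -> (forall t, 0 <= f t) ->
  (forall t : R, is_derive t 1 F (f t)) ->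
  (\int[circle]_t (f t)%:E = (F 1 - F 0)%:E)%E.
Proof.
move=> cf f0 dF.
have mf : measurable_fun [set: R] f by exact: continuous_measurable_fun.
have dF1 (t : R) : derivable F t 1 by have [] := dF t.
have cF : continuous F.
  by move=> t; apply: differentiable_continuous; exact/derivable1_diffP.
rewrite integral_uniform; [|exact/measurable_EFinP|by move=> x; rewrite lee_fin].
rewrite subr0 invr1 mul1e (@continuous_FTC2 R f F) //.
- by apply: continuous_subspaceT => x; exact: cf.
- split.
  + by move=> x _; exact: dF1.
  + exact: (cvg_at_right_filter (cF 0)).
  + exact: (cvg_at_left_filter (cF 1)).
- by move=> x _; rewrite derive1E; have [_ ->] := dF x.
Qed.

Lemma continuous_cosM (c : R) : continuous (fun t : R => cos (c * t)).
Proof.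
move=> t; apply: differentiable_continuous; apply/derivable1_diffP.
by have [] := is_derive_cosM c t.
Qed.

Lemma continuous_sinM (c : R) : continuous (fun t : R => sin (c * t)).
Proof.
move=> t; apply: differentiable_continuous; apply/derivable1_diffP.
by have [] := is_derive_sinM c t.
Qed.

Lemma cbounded_circM (a : R) : @cbounded _ (measurableTypeR R) _ (fun t => circ (a * t)).
Proof.
split; last by exists 1 => t; rewrite normc_circ.
split.
  have := continuous_measurable_fun (@continuous_cosM (2 * pi * a)).
  by congr (measurable_fun _ _); apply/funext => t; rewrite /= mulrA.
have := continuous_measurable_fun (@continuous_sinM (2 * pi * a)).
by congr (measurable_fun _ _); apply/funext => t; rewrite /= mulrA.
Qed.

Lemma circ_int (k : int) : circ (k%:~R : R) = 1.
Proof.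
have h : circ (1 : R) = 1.
  rewrite /circ mulr1 mulrC mulr_natr cos2pi sin2pi; exact: complex_eqP.
have hn (n : nat) : circ (n%:R : R) = 1 by rewrite -[n%:R]mulr1 circM_natl h expr1n.
case: k => n; first by rewrite -pmulrn hn.
by rewrite NegzE mulrNz circN -pmulrn hn conjc1.
Qed.

Lemma cint_circ (k : int) : cint circle (fun t => circ (k%:~R * t)) = (k == 0)%:R.
Proof.
have [->|k0] := eqVneq k 0.
  by under eq_cint do rewrite mul0r circ0; rewrite cint_cst.
pose c : R := 2 * pi * k%:~R.
have c0 : c != 0 by rewrite !mulf_neq0 ?intr_eq0 // gt_eqF // pi_gt0.
have [cc sc] : cos c = 1 /\ sin c = 0.
  by have := circ_int k; rewrite /circ -/c => -[].
have cb := cbounded_circM (k%:~R); have ci := cbounded_cintegrable circle cb.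
have co : (\int[circle]_t (1 + cos (c * t))%:E = 1)%E.
  have cont : continuous (fun t : R => 1 + cos (c * t)).
    by move=> t; apply: cvgD; [exact: cvg_cst|exact: continuous_cosM].
  have nn (t : R) : 0 <= 1 + cos (c * t) by have := cos_geN1 (c * t); lra.
  have der (t : R) : is_derive t 1 (fun t : R => t + c^-1 * sin (c * t)) (1 + cos (c * t)).
    apply: is_deriveD; have := is_deriveZ c^-1 (is_derive_sinM c t).
    by rewrite /GRing.scale /= mulrA mulVf // mul1r.
  by rewrite (circle_FTC cont nn der) !mulr1 sc !mulr0 sin0 !mulr0; congr EFin; lra.
have si : (\int[circle]_t (1 + sin (c * t))%:E = 1)%E.
  have cont : continuous (fun t : R => 1 + sin (c * t)).
    by move=> t; apply: cvgD; [exact: cvg_cst|exact: continuous_sinM].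
  have nn (t : R) : 0 <= 1 + sin (c * t) by have := sin_geN1 (c * t); lra.
  (* [1] is added to make the integrands nonnegative *)
  have der (t : R) : is_derive t 1 (fun t : R => t + - c^-1 * cos (c * t)) (1 + sin (c * t)).
    apply: is_deriveD; have := is_deriveZ (- c^-1) (is_derive_cosM c t).
    by rewrite /GRing.scale /= mulrNN mulrA mulVf // mul1r.
  rewrite (circle_FTC cont nn der) !mulr1 cc mulr0 cos0; congr EFin; lra.
have Ec t : cRe (circ (k%:~R * t)) = cos (c * t) by rewrite /= mulrA.
have Es t : cIm (circ (k%:~R * t)) = sin (c * t) by rewrite /= mulrA.
have H (g : R -> R) : circle.-integrable setT (EFin \o g) ->
    (\int[circle]_t (1 + g t)%:E = 1)%E -> (\int[circle]_t g t)%R = 0.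
  move=> ig; have i1 : circle.-integrable setT (EFin \o fun=> 1).
    exact: finite_measure_integrable_cst.
  rewrite integralD_EFin // pint_cst -[X in (_ + X)%E]fineK; last exact: integrable_fin_num.
  rewrite -EFinD => -[]; rewrite /Rintegral => h.
  by apply: (@addrI _ 1); rewrite addr0.
rewrite cintE; apply: complex_eqP => /=.
  apply: H; first exact: (cintegrable_Re ci).
  by rewrite -[RHS]co; apply: eq_integral => t _; rewrite mulrA.
apply: H; first exact: (cintegrable_Im ci).
by rewrite -[RHS]si; apply: eq_integral => t _; rewrite mulrA.
Qed.

Lemma ae_circle_itv : {ae circle, forall t, 0 <= t <= 1}.
Proof.
exists (~` `[0, 1]%classic); split.
- by apply: measurableC; exact: measurable_itv.
- rewrite /circle_haar /uniform_prob; apply: integral0_eq => x /=.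
  by rewrite in_itv /= /uniform_pdf => /negP/negbTE ->.
- by move=> t /=; rewrite in_itv.
Qed.

Lemma ae_circle_neq (a : R) : {ae circle, forall t, t != a}.
Proof.
exists [set a]; split => //.
  apply: (null_content_dominatesP _ _).1 (dominates_uniform_prob (@ltr01 R)) _ _ _ => //.
  exact: lebesgue_measure_set1.
by move=> t /= /negP; rewrite negbK => /eqP.
Qed.

End circle.

(** * Characters and convolution kernels *)

Lemma conjc_prod (R : realType) (I : Type) (r : seq I) (P : pred I) (F : I -> R[i]) :
  conjc (\prod_(i <- r | P i) F i) = \prod_(i <- r | P i) conjc (F i).
Proof.
elim/big_rec2: _ => [|i x y _ <-]; first exact: conjc1.
exact: (rmorphM (@conjc R)).
Qed.

Lemma realc_prod (R : realType) (I : Type) (r : seq I) (P : pred I) (F : I -> R) :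
  (\prod_(i <- r | P i) F i)%:C = \prod_(i <- r | P i) (F i)%:C.
Proof. exact: rmorph_prod. Qed.

Section characters.
Variables (R : realType) (d : nat).
Local Notation torus := (torus R d).
Implicit Types (k l : 'I_d -> int) (x y : torus) (f g : torus -> R[i]).

Lemma characterE k x : character k x = \prod_(j < d) circ ((k j)%:~R * tnth x j).
Proof. by rewrite -circ_sum. Qed.

Lemma normc_character k x : normc (character k x) = 1.
Proof. exact: normc_circ. Qed.

Lemma cbounded_character k : cbounded (character k : torus -> R[i]).
Proof.
rewrite (_ : character k = fun x => \prod_(j < d) circ ((k j)%:~R * tnth x j)); last first.
  by apply/funext => x; exact: characterE.
apply: cbounded_prod => j _.
exact: (cbounded_tnth (f := fun t => circ ((k j)%:~R * t)) j (cbounded_circM _)).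
Qed.

Lemma cmeas_character k : cmeas (character k : torus -> R[i]).
Proof. exact: (cbounded_character k).1. Qed.

Lemma cint_character k : cint (haar R d) (character k) = [forall j, k j == 0]%:R.
Proof.
rewrite (eq_cint _ (characterE k)) (@cint_prod_tnth _ d (fun j t => circ ((k j)%:~R * t))); last first.
  by move=> j; exact: cbounded_circM.
under eq_bigr do rewrite cint_circ.
have [/forallP h|] := boolP [forall j, k j == 0].
  by rewrite big1 // => j _; rewrite (h j).
by rewrite negb_forall => /existsP[j kj]; rewrite (bigD1 j) //= (negbTE kj) mul0r.
Qed.

Lemma characterM k l x : character k x * character l x = character (fun j => k j + l j) x.
Proof.
rewrite !characterE -big_split /=; apply: eq_bigr => j _.
by rewrite -circD -mulrDl -rmorphD.
Qed.

Lemma characterJ k x : (character k x)^* = character (fun j => - k j) x.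
Proof.
rewrite !characterE conjc_prod; apply: eq_bigr => j _.
by rewrite -circN mulrNz mulNr.
Qed.

Lemma fourierE f k : fourier f k = cint (haar R d) (fun x => f x * (character k x)^*).
Proof. by rewrite cintE. Qed.

Lemma cintegrable_fourier f k : cintegrable (haar R d) f ->
  cintegrable (haar R d) (fun x => f x * (character k x)^*).
Proof.
move=> cf; under eq_fun do rewrite mulrC; apply: cintegrableM cf.
by apply: cboundedJ; exact: cbounded_character.
Qed.

Lemma fourierD f g k : cintegrable (haar R d) f -> cintegrable (haar R d) g ->
  fourier (fun x => f x + g x) k = fourier f k + fourier g k.
Proof.
move=> cf cg; rewrite !fourierE -cintD; try exact: cintegrable_fourier.
by apply: eq_cint => x; rewrite mulrDl.
Qed.

Lemma fourierZ a f k : cintegrable (haar R d) f ->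
  fourier (fun x => a * f x) k = a * fourier f k.
Proof.
move=> cf; rewrite !fourierE -cintZ; last exact: cintegrable_fourier.
by apply: eq_cint => x; rewrite mulrA.
Qed.

Lemma fourier_sum (I : Type) (s : seq I) (P : pred I) (F : I -> torus -> R[i]) k :
  (forall i, P i -> cintegrable (haar R d) (F i)) ->
  fourier (fun x => \sum_(i <- s | P i) F i x) k = \sum_(i <- s | P i) fourier (F i) k.
Proof.
move=> cF; rewrite fourierE; under eq_cint do rewrite mulr_suml.
rewrite cint_sum; first by apply: eq_bigr => i _; rewrite fourierE.
by move=> i Pi; apply: cintegrable_fourier; exact: cF.
Qed.

Lemma fourier_ae f g k : cmeas f -> cmeas g -> f = g %[ae haar R d] ->
  fourier f k = fourier g k.
Proof.
move=> mf mg fg; have mk := cmeasJ (cmeas_character k).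
rewrite !fourierE; apply: cint_ae; try exact: cmeasM.
by move: fg; apply: filterS => x /= h _; rewrite h.
Qed.

Lemma fourier_character k l :
  fourier (character k : torus -> R[i]) l = [forall j, k j == l j]%:R.
Proof.
rewrite fourierE; under eq_cint do rewrite characterJ characterM.
by rewrite cint_character; congr (_%:R); congr nat_of_bool; apply: eq_forallb => j; rewrite subr_eq0.
Qed.

End characters.

Section convolution.
Variables (R : realType) (d n : nat) (w : 'I_n * 'I_n -> R).
Local Notation torus := (torus R d).
Implicit Types (x y : torus) (f g : torus -> R[i]).

Definition trig_ker (t : R) : R[i] :=
  \sum_(s : 'I_n * 'I_n) (w s)%:C * circ ((s.1%:Z - s.2%:Z)%:~R * t).

(** All convolution kernels used below are tensor powers of one trigonometric polynomial
    in one variable. It is parametrized by weights on pairs [(i, l)] with frequency [i - l],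
    as the Fejer kernel is: the square of a Dirichlet kernel. *)
Definition torus_ker x y : R[i] := \prod_(j < d) trig_ker (tnth x j - tnth y j).

Definition tconv f x : R[i] := cint (haar R d) (fun y => torus_ker x y * f y).

Definition freq (s : {ffun 'I_d -> 'I_n * 'I_n}) (j : 'I_d) : int :=
  (s j).1%:Z - (s j).2%:Z.

Definition weight (s : {ffun 'I_d -> 'I_n * 'I_n}) : R[i] := (\prod_(j < d) w (s j))%:C.

Lemma torus_kerE x y : torus_ker x y =
  \sum_s weight s * (character (freq s) x * conjc (character (freq s) y)).
Proof.
rewrite /torus_ker /trig_ker bigA_distr_bigA; apply: eq_bigr => s _.
rewrite characterJ !characterE -!big_split /= /weight realc_prod -big_split /=.
apply: eq_bigr => j _; rewrite mulrBr circD -mulNr -mulrNz.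
by rewrite /freq.
Qed.

(** The kernel has finite rank, so that the convolution is a combination of characters
    whose coefficients are weighted Fourier coefficients. *)
Lemma tconvE f x : cintegrable (haar R d) f ->
  tconv f x = \sum_s weight s * fourier f (freq s) * character (freq s) x.
Proof.
move=> cf; rewrite /tconv.
under eq_cint do rewrite torus_kerE mulr_suml.
rewrite cint_sum => [|s _].
  apply: eq_bigr => s _; rewrite fourierE mulrAC -cintZ; last exact: cintegrable_fourier.
  by apply: eq_cint => y; ring.
apply: cintegrableM => //; apply: cboundedZ; apply: cboundedZ.
by apply: cboundedJ; exact: cbounded_character.
Qed.

Lemma cbounded_tconv f : cintegrable (haar R d) f -> cbounded (tconv f).
Proof.
move=> cf; rewrite (_ : tconv f = fun x =>
  \sum_s weight s * fourier f (freq s) * character (freq s) x).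
  by apply: cbounded_sum => s _; apply: cboundedZ; exact: cbounded_character.
by apply/funext => x; rewrite tconvE.
Qed.

Lemma fourier_tconv f k : cintegrable (haar R d) f ->
  fourier (tconv f) k =
  \sum_s weight s * fourier f (freq s) * [forall j, freq s j == k j]%:R.
Proof.
move=> cf; rewrite (_ : tconv f = fun x =>
  \sum_s weight s * fourier f (freq s) * character (freq s) x); last first.
  by apply/funext => x; rewrite tconvE.
have cb k' := cbounded_cintegrable (haar R d) (@cbounded_character R d k').
rewrite fourier_sum => [|s _]; last by apply: cintegrableZ.
by apply: eq_bigr => s _; rewrite fourierZ // fourier_character.
Qed.

Lemma tconvD f g x : cintegrable (haar R d) f -> cintegrable (haar R d) g ->
  tconv (fun y => f y + g y) x = tconv f x + tconv g x.
Proof.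
move=> cf cg; rewrite !tconvE //; last exact: cintegrableD.
rewrite -big_split /=.
by apply: eq_bigr => s _; rewrite fourierD // mulrDr mulrDl.
Qed.

Lemma tconvZ a f x : cintegrable (haar R d) f ->
  tconv (fun y => a * f y) x = a * tconv f x.
Proof.
move=> cf; rewrite !tconvE //; last exact: cintegrableZ.
rewrite mulr_sumr.
by apply: eq_bigr => s _; rewrite fourierZ //; ring.
Qed.

End convolution.

Lemma torus_ker_tcat (R : realType) d e n (w : 'I_n * 'I_n -> R)
    (x y : torus R d * torus R e) :
  torus_ker w (tcat x) (tcat y) = torus_ker w x.1 y.1 * torus_ker w x.2 y.2.
Proof.
rewrite /torus_ker big_split_ord /=; congr (_ * _); apply: eq_bigr => j _.
  by rewrite !tnth_tcatl.
by rewrite !tnth_tcatr.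
Qed.

Lemma character_tcat (R : realType) d e (k : 'I_(d + e) -> int) (x : torus R d * torus R e) :
  character k (tcat x) =
  character (fun i => k (lshift e i)) x.1 * character (fun i => k (rshift d i)) x.2.
Proof.
rewrite !characterE big_split_ord /=; congr (_ * _); apply: eq_bigr => j _.
  by rewrite !tnth_tcatl.
by rewrite !tnth_tcatr.
Qed.

(** * Fejer means *)

(** Averages against a doubly stochastic kernel contract every [L^q]: integrate the
    tangent-line form of Jensen's inequality and exchange the integrals. *)
Section averaging.
Context d (X : measurableType d) (R : realType) (mu : probability X R).
Variables (K : X -> X -> R) (M : R).
Hypothesis K0 : forall x y, 0 <= K x y.
Hypothesis KM : forall x y, K x y <= M.
Hypothesis mK : measurable_fun setT (fun z : X * X => K z.1 z.2).
Hypothesis K1 : forall x, (\int[mu]_y (K x y)%:E = 1)%E.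
Hypothesis K2 : forall y, (\int[mu]_x (K x y)%:E = 1)%E.

Let mK1 x : measurable_fun setT (K x).
Proof.
exact: (measurableT_comp mK (measurable_pair1 x)).
Qed.

Lemma averaging_pointwise q (f : X -> R[i]) x : 1 < q -> cintegrable mu f ->
  ((normc (cint mu (fun y => (K x y)%:C * f y)) `^ q)%:E
    <= \int[mu]_y (K x y * normc (f y) `^ q)%:E)%E.
Proof.
move=> q1 cf; have q0 : 0 <= q by lra.
have mf := measurable_normc cf.1; have mfq := measurable_normc_powR q cf.1.
have bK : cbounded (fun y => (K x y)%:C).
  split; first exact: cmeas_real.
  by exists M => y; rewrite normc_real ger0_norm.
have cKf := cintegrableM bK cf.
pose A := (\int[mu]_y (K x y * normc (f y))%:E)%E.
have EA : A = Iq mu 1 (fun y => (K x y)%:C * f y).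
  rewrite Iq1E; apply: eq_integral => y _.
  by rewrite ComplexField.Normc.normcM normc_real ger0_norm.
have Afin : A = (fine A)%:E by rewrite EA Iq_fineK //; exact: cKf.2.
set a := fine A in Afin; have a0 : 0 <= a by rewrite -lee_fin -Afin EA Iq_ge0.
set J := (\int[mu]_y _)%E.
have J0 : (0 <= J)%E by apply: integral_ge0 => y _; rewrite lee_fin mulr_ge0 // powR_ge0.
apply: (@le_trans _ _ (a `^ q)%:E).
  rewrite lee_fin; apply: ge0_ler_powR; rewrite ?nnegrE ?normc_ge0 //.
  by rewrite -lee_fin -Afin EA; exact: normc_cint_le.
have : ((q * a `^ (q - 1))%:E * A <= J + ((q - 1) * a `^ q)%:E * 1)%E.
  rewrite -(K1 x) /A /J -!pintZ //.
  - rewrite -pintD.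
    + apply: le_pint.
      * by apply: measurable_funM => //; apply: measurable_funM.
      * by apply: measurable_funD; apply: measurable_funM.
      * by move=> y; rewrite !mulr_ge0 ?powR_ge0 ?normc_ge0.
      * move=> y; rewrite mulrCA -[q * _ * _]mulrA [X in _ <= _ + X]mulrC -mulrDr.
        by apply: ler_wpM2l => //; apply: powR_tangent => //; exact: normc_ge0.
    + exact: measurable_funM.
    + exact: measurable_funM.
    + by move=> y; rewrite mulr_ge0 // powR_ge0.
    + by move=> y; rewrite mulr_ge0 // mulr_ge0 ?powR_ge0 //; lra.
  - by rewrite mulr_ge0 ?powR_ge0 //; lra.
  - exact: measurable_funM.
  - by rewrite mulr_ge0 ?powR_ge0.
  - by move=> y; rewrite mulr_ge0 ?normc_ge0.
rewrite Afin -EFinM mule1 -mulrA [_ `^ _ * a]mulrC mulr_powRB1 //; last lra.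
case: J J0 => [j _|_ _|//]; last by rewrite leey.
by rewrite -EFinD !lee_fin mulrBl mul1r; lra.
Qed.

Lemma averaging_contraction q (f : X -> R[i]) : 1 < q -> cmeas f ->
  (Iq mu q f < +oo)%E -> cmeas (fun x => cint mu (fun y => (K x y)%:C * f y)) ->
  (Iq mu q (fun x => cint mu (fun y => (K x y)%:C * f y))%R <= Iq mu q f)%E.
Proof.
move=> q1 mf fq mKf; have cf := Iq_lty_cintegrable (ltW q1) mf fq.
have mfq := measurable_normc_powR q mf.
pose G (z : X * X) := (K z.1 z.2 * normc (f z.2) `^ q)%:E.
have mG : measurable_fun setT G.
  apply/measurable_EFinP; apply: measurable_funM => //.
  exact: (measurableT_comp mfq measurable_snd).
have G0 z : (0 <= G z)%E by rewrite lee_fin mulr_ge0 // powR_ge0.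
rewrite [leLHS]IqE; apply: (@le_trans _ _ (\int[mu]_x \int[mu]_y G (x, y))%E).
  apply: ge0_le_integral => //=.
  - by move=> x _; rewrite lee_fin powR_ge0.
  - by apply/measurable_EFinP; exact: measurable_normc_powR.
  - exact: (measurable_fun_fubini_tonelli_F G mG G0).
  - by move=> x _; exact: averaging_pointwise.
rewrite (fubini_tonelli G mG G0) [leRHS]IqE le_eqVlt; apply/orP; left; apply/eqP.
apply: eq_integral => y _; rewrite /G /=.
under eq_integral do rewrite mulrC.
rewrite pintZ ?powR_ge0 ?K2 ?mule1 //.
exact: (measurableT_comp mK (measurable_pair2 y)).
Qed.

End averaging.

Lemma normc_cint_powR_le d (X : measurableType d) (R : realType) (nu : probability X R) q (f : X -> R[i]) :
  1 < q -> cintegrable nu f -> ((normc (cint nu f) `^ q)%:E <= Iq nu q f)%E.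
Proof.
move=> q1 cf.
have K1 (x : X) : (\int[nu]_y (1 : R)%:E = 1)%E by rewrite pint_cst.
have := @averaging_pointwise _ _ _ nu (fun _ _ => 1) 1 (fun _ _ => ler01) (fun _ _ => lexx _)
  (measurable_cst _) K1 q f point q1 cf.
under eq_cint do rewrite mul1r; under eq_integral do rewrite mul1r.
by rewrite -IqE.
Qed.

Section fejer.
Variable R : realType.
Local Notation circle := (@circle_haar R).

Definition fejer_weight n (s : 'I_n.+1 * 'I_n.+1) : R := n.+1%:R^-1.

(** The pairs [(i, l)] with [l <= i] are those of frequency [i - l >= 0]: these weights
    give the part of the Fejer mean with nonnegative frequencies. *)
Definition analytic_weight n (s : 'I_n.+1 * 'I_n.+1) : R :=
  (s.2 <= s.1)%N%:R / n.+1%:R.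

Definition fejer_ker n (t : R) : R :=
  n.+1%:R^-1 * normc (\sum_(i < n.+1) circ t ^+ i) ^+ 2.

Lemma fejer_ker_ge0 n t : 0 <= fejer_ker n t.
Proof. by rewrite mulr_ge0 ?invr_ge0 // sqr_ge0. Qed.

Lemma trig_ker_fejer n t : trig_ker (@fejer_weight n) t = (fejer_ker n t)%:C.
Proof.
rewrite /fejer_ker rmorphM /= -mulCJ (rmorph_sum (@conjc R)) mulr_suml.
rewrite /trig_ker; under eq_bigr do rewrite /fejer_weight.
rewrite -(pair_bigA _ (fun i l : 'I_n.+1 => n.+1%:R^-1%:C * circ ((i%:Z - l%:Z)%:~R * t))) /=.
rewrite mulr_sumr; apply: eq_bigr => i _; rewrite !mulr_sumr; apply: eq_bigr => l _.
by rewrite rmorphB /= mulrBl circD circN -!circM_natl -!pmulrn.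
Qed.

Lemma fejer_ker_sym n t : fejer_ker n (- t) = fejer_ker n t.
Proof.
rewrite /fejer_ker circN; congr (_ * _ ^+ 2).
rewrite -[RHS]normc_conj (rmorph_sum (@conjc R)); congr normc.
by apply: eq_bigr => i _; rewrite -(rmorphXn (@conjc R)).
Qed.

Lemma fejer_ker_le n t : fejer_ker n t <= n.+1%:R.
Proof.
rewrite ler_pdivrMl // -expr2; apply: lerXn2r; rewrite ?nnegrE ?normc_ge0 //.
apply: le_trans (normc_sum _ _ _) _.
under eq_bigr do rewrite normcX normc_circ expr1n.
by rewrite sumr_const card_ord.
Qed.

(** The Dirichlet sum is geometric, with numerator of modulus at most [2]. *)
Lemma fejer_ker_bound n t : fejer_ker n t * normc (1 - circ t) ^+ 2 <= 4 / n.+1%:R.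
Proof.
rewrite /fejer_ker -mulrA -exprMn -ComplexField.Normc.normcM.
rewrite [X in normc X](_ : _ = 1 - circ t ^+ n.+1); last first.
  by rewrite mulrC -[1 - circ t]opprB mulNr -subrX1 opprB.
rewrite mulrC ler_pM2r ?invr_gt0 //.
rewrite (_ : 4 = 2 ^+ 2); last by rewrite -natrX.
apply: lerXn2r; rewrite ?nnegrE ?normc_ge0 //.
apply: le_trans (le_normcD _ _) _.
by rewrite normcN normcX normc_circ expr1n ComplexField.Normc.normc1.
Qed.

Lemma cbounded_trig_ker n (w : 'I_n * 'I_n -> R) x :
  @cbounded _ (measurableTypeR R) _ (fun t => trig_ker w (x - t)).
Proof.
apply: cbounded_sum => s _; apply: cboundedZ.
rewrite (_ : (fun t => _) = fun t =>
  circ ((s.1%:Z - s.2%:Z)%:~R * x) * circ (- (s.1%:Z - s.2%:Z)%:~R * t)).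
  by apply: cboundedZ; exact: cbounded_circM.
by apply/funext => t; rewrite mulrBr circD mulNr.
Qed.

Lemma cint_trig_ker n (w : 'I_n * 'I_n -> R) x :
  cint circle (fun t => trig_ker w (x - t)) = \sum_(i < n) (w (i, i))%:C.
Proof.
have E t : trig_ker w (x - t) = \sum_(s : 'I_n * 'I_n)
    ((w s)%:C * circ ((s.1%:Z - s.2%:Z)%:~R * x)) * circ ((s.2%:Z - s.1%:Z)%:~R * t).
  apply: eq_bigr => s _; rewrite mulrBr circD mulrA -mulNr -mulrNz opprB //.
under eq_cint do rewrite E.
rewrite cint_sum; last first.
  by move=> s _; apply: cintegrableZ; apply: cbounded_cintegrable; exact: cbounded_circM.
under eq_bigr => s _.
  rewrite cintZ ?cint_circ; last by apply: cbounded_cintegrable; exact: cbounded_circM.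
  over.
pose F (i l : 'I_n) : R[i] :=
  (w (i, l))%:C * circ ((i%:Z - l%:Z)%:~R * x) * (l%:Z - i%:Z == 0)%:R.
rewrite (eq_bigr (fun s => F s.1 s.2)); last by case.
rewrite -(pair_bigA _ F) /F /=.
apply: eq_bigr => i _; rewrite (bigD1 i) //= !subrr eqxx mul0r circ0 !mulr1.
rewrite big1 ?addr0 // => l li; rewrite subr_eq0 eqz_nat -(inj_eq val_inj) /= in li *.
by rewrite (negbTE li) mulr0.
Qed.

Lemma cint_fejer_ker n x : cint circle (fun t => trig_ker (@fejer_weight n) (x - t)) = 1.
Proof.
rewrite cint_trig_ker /fejer_weight sumr_const card_ord.
by rewrite -(rmorphMn (real_complex R)) /= -(mulr_natr n.+1%:R^-1) mulVf.
Qed.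

Section torus.
Variables (d n : nat).
Local Notation torus := (torus R d).
Implicit Types (x y : torus) (f g : torus -> R[i]).

Definition torus_fejer x y : R := \prod_(j < d) fejer_ker n (tnth x j - tnth y j).

Lemma torus_ker_fejer x y : torus_ker (@fejer_weight n) x y = (torus_fejer x y)%:C.
Proof. by rewrite realc_prod; apply: eq_bigr => j _; rewrite trig_ker_fejer. Qed.

Lemma torus_fejer_ge0 x y : 0 <= torus_fejer x y.
Proof. by apply: prodr_ge0 => j _; exact: fejer_ker_ge0. Qed.

Lemma torus_fejer_le x y : torus_fejer x y <= n.+1%:R ^+ d.
Proof.
rewrite -[X in _ ^+ X]card_ord -prodr_const; apply: ler_prod => j _.
by rewrite fejer_ker_ge0 fejer_ker_le.
Qed.

Lemma torus_fejer_sym x y : torus_fejer x y = torus_fejer y x.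
Proof. by apply: eq_bigr => j _; rewrite -fejer_ker_sym opprB. Qed.

Lemma measurable_torus_fejer :
  measurable_fun setT (fun z : torus * torus => torus_fejer z.1 z.2).
Proof.
have mk : measurable_fun setT (fejer_ker n).
  suff h : @cmeas _ (measurableTypeR R) _ (fun t => trig_ker (@fejer_weight n) t).
    by have := h.1; congr measurable_fun; apply/funext => t /=; rewrite trig_ker_fejer.
  by apply: cmeas_sum => s _; apply: cmeasZ; exact: (cbounded_circM _).1.
apply: measurable_prod => j _; apply: (measurableT_comp mk).
by apply: measurable_funB;
  [apply: measurableT_comp (measurable_tnth _) measurable_fst
  |apply: measurableT_comp (measurable_tnth _) measurable_snd].
Qed.

Lemma integral_torus_fejer x : (\int[haar R d]_y (torus_fejer x y)%:E = 1)%E.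
Proof.
have h : cint (haar R d) (fun y => torus_ker (@fejer_weight n) x y) = 1.
  rewrite /torus_ker (@cint_prod_tnth R d (fun j t => trig_ker (@fejer_weight n) (tnth x j - t))).
    by rewrite big1 // => j _; exact: cint_fejer_ker.
  by move=> j; exact: cbounded_trig_ker.
have ib : cintegrable (haar R d) (fun y => torus_ker (@fejer_weight n) x y).
  apply: cbounded_cintegrable; apply: cbounded_prod => j _.
  exact: (cbounded_tnth (f := fun t => trig_ker (@fejer_weight n) (tnth x j - t)) j (cbounded_trig_ker _ _)).
have := cintegrable_Re ib => i1.
move: (congr1 (@complex.Re R) h); rewrite cintE /= /Rintegral => h1.
transitivity (\int[haar R d]_y (cRe (torus_ker (@fejer_weight n) x y))%:E)%E.
  by apply: eq_integral => y _; rewrite torus_ker_fejer.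
by rewrite -[LHS]fineK ?h1 //; exact: integrable_fin_num.
Qed.

Definition fejer f := tconv (@fejer_weight n) f.

Lemma fejerE f x : fejer f x = cint (haar R d) (fun y => (torus_fejer x y)%:C * f y).
Proof. by apply: eq_cint => y; rewrite torus_ker_fejer. Qed.

(** The Fejer kernel is nonnegative and has integral [1] in either variable. *)
Lemma Iq_fejer_le q f : 1 < q -> cmeas f -> (Iq (haar R d) q f < +oo)%E ->
  (Iq (haar R d) q (fejer f) <= Iq (haar R d) q f)%E.
Proof.
move=> q1 mf fq; have cf := Iq_lty_cintegrable (ltW q1) mf fq.
have E : fejer f = (fun x => cint (haar R d) (fun y => (torus_fejer x y)%:C * f y)).
  by apply/funext => x; exact: fejerE.
rewrite E; apply: (averaging_contraction torus_fejer_ge0 torus_fejer_le) => //.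
- exact: measurable_torus_fejer.
- exact: integral_torus_fejer.
- by move=> y; under eq_integral do rewrite torus_fejer_sym; exact: integral_torus_fejer.
- by rewrite -E; exact: (cbounded_tconv _ cf).1.
Qed.

End torus.

End fejer.

(** * Convergence of Fejer means *)

Section fejer_convergence.
Variable R : realType.
Local Notation circle := (@circle_haar R).

(** Away from the integers, [e^{2 i pi t}] stays away from [1]. *)
Lemma circ_gap (del : R) : 0 < del -> exists2 c : R, 0 < c &
  forall t : R, del <= t <= 1 - del -> c <= normc (1 - circ t) ^+ 2.
Proof.
move=> d0.
have E (t : R) : normc (1 - circ t) ^+ 2 = 2 - 2 * cos (2 * pi * t).
  rewrite normc_sqr !ReImE /=; have := cos2Dsin2 (2 * pi * t).
  set C := cos _; set S := sin _ => h.
  have -> : (1 - C) ^+ 2 + (0 - S) ^+ 2 = (C ^+ 2 + S ^+ 2) + 1 - 2 * C by ring.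
  by rewrite h; ring.
have [dd|dd] := leP del (1 - del); last first.
  by exists 1 => // t /andP[/le_trans h /h]; rewrite leNgt dd.
have [|c] := @EVT_min R (fun t => 2 - 2 * cos (2 * pi * t)) del (1 - del) dd.
  apply: continuous_subspaceT => t; apply: cvgB; first exact: cvg_cst.
  by apply: cvgM; [exact: cvg_cst|exact: continuous_cosM].
rewrite in_itv /= => /andP[c0 c1] Hc; exists (2 - 2 * cos (2 * pi * c)).
  have -> : 2 * pi * c = (pi * c) *+ 2 :> R by ring.
  have s0 : 0 < sin (pi * c).
    apply: sin_gt0_pi; apply/andP; split; first by rewrite mulr_gt0 ?pi_gt0 //; lra.
    by rewrite gtr_pMr ?pi_gt0 //; lra.
  rewrite cos_mulr2n; have := cos2Dsin2 (pi * c); have := exprn_gt0 2 s0; lra.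
by move=> t td; rewrite E; apply: Hc; rewrite in_itv.
Qed.

(** Half-lines are the sets for which the Fejer means are computed by hand; products of
    them are boxes, which generate the sigma-algebra of the torus. *)
Definition halfline (a t : R) : R[i] := ((a <= t)%R%:R : R)%:C.

Lemma normc_half a t : normc (halfline a t) <= 1.
Proof. by rewrite normc_real ger0_norm // lern1 leq_b1. Qed.

Lemma cbounded_half a : @cbounded _ (measurableTypeR R) _ (halfline a).
Proof.
split; last by exists 1 => t; exact: normc_half.
apply: cmeas_real.
rewrite (_ : (fun t => _) = \1_(`[a, +oo[%classic : set (measurableTypeR R))).
  by apply: measurable_indic; exact: measurable_itv.
apply/funext => t; rewrite indicE; congr (_%:R); congr nat_of_bool.
by apply/idP/idP => [h|/set_mem /=]; [apply/mem_set => /=|]; rewrite in_itv /= andbT.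
Qed.

Definition fejer_half n a x :=
  cint circle (fun t => trig_ker (@fejer_weight R n) (x - t) * halfline a t).

Lemma cmeas_fejer_half n a : @cmeas _ (measurableTypeR R) _ (fejer_half n a).
Proof.
have ci (s : 'I_n.+1 * 'I_n.+1) : cintegrable circle (fun t =>
    circ (- (s.1%:Z - s.2%:Z)%:~R * t) * halfline a t).
  by apply: cbounded_cintegrable; apply: cboundedM; [exact: cbounded_circM|exact: cbounded_half].
rewrite (_ : fejer_half n a = fun x => \sum_(s : 'I_n.+1 * 'I_n.+1)
    ((@fejer_weight R n s)%:C * cint circle (fun t => circ (- (s.1%:Z - s.2%:Z)%:~R * t) * halfline a t)) *
     circ ((s.1%:Z - s.2%:Z)%:~R * x)).
  by apply: cmeas_sum => s _; apply: cmeasZ; exact: (cbounded_circM _).1.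
apply/funext => x; rewrite /fejer_half /trig_ker; under eq_cint do rewrite mulr_suml.
rewrite cint_sum; last first.
  move=> s _; under eq_fun do rewrite mulrBr circD -mulNr -!mulrA.
  by apply: cintegrableZ; exact: cintegrableZ.
apply: eq_bigr => s _; rewrite mulrAC -cintZ //; apply: eq_cint => t.
by rewrite mulrBr circD -mulNr; ring.
Qed.

Lemma fejer_half_diff n a x : fejer_half n a x - halfline a x =
  cint circle (fun t => trig_ker (@fejer_weight R n) (x - t) * (halfline a t - halfline a x)).
Proof.
have cK := @cbounded_trig_ker R _ (@fejer_weight R n) x.
transitivity (cint circle (fun t => trig_ker (@fejer_weight R n) (x - t) * halfline a t
    + - halfline a x * trig_ker (@fejer_weight R n) (x - t))); last by apply: eq_cint => t; ring.
rewrite cintD.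
- rewrite cintZ; last exact: cbounded_cintegrable.
  by rewrite cint_fejer_ker mulr1.
- by apply: cbounded_cintegrable; apply: cboundedM => //; exact: cbounded_half.
- by apply: cintegrableZ; exact: cbounded_cintegrable.
Qed.

Lemma integral_fejer_ker n (x : R) : (\int[circle]_t (fejer_ker n (x - t))%:E = 1)%E.
Proof.
have h := cint_fejer_ker n x.
have cK := cbounded_cintegrable circle (@cbounded_trig_ker R _ (@fejer_weight R n) x).
move: (congr1 (@complex.Re R) h); rewrite cintE /= /Rintegral => h1.
transitivity (\int[circle]_t (cRe (trig_ker (@fejer_weight R n) (x - t)))%:E)%E.
  by apply: eq_integral => t _; rewrite trig_ker_fejer.
by rewrite -[LHS]fineK ?h1 //; apply: integrable_fin_num => //; exact: (cintegrable_Re cK).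
Qed.

Lemma measurable_fejer_ker n x :
  measurable_fun setT (fun t : measurableTypeR R => fejer_ker n (x - t)).
Proof.
have := (@cbounded_trig_ker R _ (@fejer_weight R n) x).1.1.
by congr measurable_fun; apply/funext => t /=; rewrite trig_ker_fejer.
Qed.

Lemma fejer_half_diff_le n a x : ((normc (fejer_half n a x - halfline a x))%:E <=
  \int[circle]_t (fejer_ker n (x - t) * normc (halfline a t - halfline a x))%:E)%E.
Proof.
rewrite fejer_half_diff; apply: le_trans (normc_cint_le _) _.
  apply: cbounded_cintegrable; apply: cboundedM; first exact: cbounded_trig_ker.
  by apply: cboundedD; [exact: cbounded_half|exact: cbounded_cst].
rewrite Iq1E le_eqVlt; apply/orP; left; apply/eqP; apply: eq_integral => t _.
by rewrite ComplexField.Normc.normcM trig_ker_fejer normc_real ger0_norm // fejer_ker_ge0.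
Qed.

Let measurable_normc_halfB a x :
  measurable_fun setT (fun t : measurableTypeR R => normc (halfline a t - halfline a x)).
Proof.
apply: measurable_normc; apply: cmeasD; first exact: (cbounded_half a).1.
exact: cmeas_cst.
Qed.

Lemma fejer_half_diff_le1 n a x : normc (fejer_half n a x - halfline a x) <= 2.
Proof.
rewrite -lee_fin; apply: le_trans (fejer_half_diff_le n a x) _.
rewrite -[leRHS]mule1 -(integral_fejer_ker n x) -pintZ //; last 2 first.
- exact: measurable_fejer_ker.
- by move=> t; exact: fejer_ker_ge0.
apply: le_pint.
- by apply: measurable_funM => //; exact: measurable_fejer_ker.
- by apply: measurable_funM => //; exact: measurable_fejer_ker.
- by move=> t; rewrite mulr_ge0 ?fejer_ker_ge0 ?normc_ge0.
- move=> t; rewrite mulrC ler_wpM2r ?fejer_ker_ge0 //.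
  apply: le_trans (le_normcD _ _) _; rewrite normcN.
  by have := normc_half a t; have := normc_half a x; lra.
Qed.

(** At a point that is not a jump, a neighbourhood on which the indicator is constant
    contributes nothing, and the Fejer kernel is [O (1 / n)] on the rest. *)
Lemma fejer_half_pointwise a x : 0 < x < 1 -> x != a -> exists C : R,
  forall n, normc (fejer_half n a x - halfline a x) <= C * n.+1%:R^-1.
Proof.
move=> /andP[x0 x1] xa.
pose del := Num.min `|x - a| (Num.min x (1 - x)).
have d0 : 0 < del by rewrite !lt_min normr_gt0 subr_eq0 xa x0 /=; lra.
have [c c0 Hc] := circ_gap d0; exists (4 / c) => n.
rewrite -lee_fin; apply: le_trans (fejer_half_diff_le n a x) _.
rewrite -[leRHS](pint_cst circle).
apply: ae_ge0_le_integral => //.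
- by move=> t _; rewrite lee_fin mulr_ge0 ?fejer_ker_ge0 ?normc_ge0.
- by apply/measurable_EFinP; apply: measurable_funM => //; exact: measurable_fejer_ker.
- by move=> t _; rewrite lee_fin mulr_ge0 ?invr_ge0 // divr_ge0 // ltW.
have hae : {ae circle, forall t : measurableTypeR R, 0 <= (t : R) <= 1} := @ae_circle_itv R.
apply: filterS hae => t /andP[t0 t1] _; rewrite lee_fin.
have [E|E] := eqVneq (a <= t) (a <= x).
  rewrite /halfline E subrr ComplexField.Normc.normc0 mulr0 mulr_ge0 ?invr_ge0 //.
  by rewrite divr_ge0 // ltW.
have dt : del <= `|x - t|.
  rewrite ge_min; apply/orP; left; move: E.
  have [at_|ta] := leP a t; have [ax|xa'] := leP a x => // _.
    by rewrite !ltr0_norm; lra.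
  by rewrite !ger0_norm; lra.
have dt' : `|x - t| <= 1 - del.
  have : del <= Num.min x (1 - x) by rewrite ge_min lexx orbT.
  by rewrite le_min => /andP[? ?]; rewrite ler_norml; lra.
have fb : fejer_ker n (x - t) * c <= 4 / n.+1%:R.
  have -> : fejer_ker n (x - t) = fejer_ker n `|x - t|.
    by case: ger0P => // _; rewrite fejer_ker_sym.
  apply: le_trans (fejer_ker_bound n _); apply: ler_wpM2l; first exact: fejer_ker_ge0.
  by apply: Hc; rewrite dt.
apply: (@le_trans _ _ (fejer_ker n (x - t))).
  rewrite ler_piMr ?fejer_ker_ge0 // /halfline -rmorphB normc_real.
  by case: (a <= t); case: (a <= x); rewrite ?subrr ?subr0 ?sub0r ?normrN ?normr1 ?normr0.
by rewrite mulrAC ler_pdivlMr.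
Qed.

(** Dominated convergence, from the pointwise rate off the jump. *)
Lemma fejer_half_cvg a e : 0 < e -> exists N, forall n, (N <= n)%N ->
  (\int[circle]_x (normc (fejer_half n a x - halfline a x))%:E <= e%:E)%E.
Proof.
move=> e0; pose f n (x : measurableTypeR R) := (normc (fejer_half n a x - halfline a x))%:E.
have mf n : measurable_fun setT (f n).
  apply/measurable_EFinP; apply: measurable_normc; apply: cmeasB.
    exact: cmeas_fejer_half.
  exact: (cbounded_half a).1.
have f0 : {ae circle, forall x, setT x -> f ^~ x @ \oo --> (cst 0%E : _ -> \bar R) x}.
  have h0 := @ae_circle_neq R 0; have h1 := @ae_circle_neq R 1.
  have ha := @ae_circle_neq R a; have hi := @ae_circle_itv R.
  near=> x => _.
  have x01 : 0 < x < 1.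
    have /andP[x0 x1] : 0 <= x <= 1 by near: x.
    rewrite !lt_neqAle x0 x1 eq_sym !andbT; apply/andP; split; near: x => //.
  have xa : x != a by near: x.
  have [C HC] := fejer_half_pointwise x01 xa.
  apply: cvg_EFin; first exact: nearW.
  apply: (@squeeze_cvgr _ _ _ _ (cst 0) (fun n => C * n.+1%:R^-1)).
  - by apply: nearW => n /=; rewrite normc_ge0 HC.
  - exact: cvg_cst.
  - rewrite -[X in _ --> X](mulr0 C); apply: cvgM; first exact: cvg_cst.
    exact: cvg_harmonic.
have ig : circle.-integrable setT (cst 2%:E) by exact: finite_measure_integrable_cst.
have fg : {ae circle, forall x n, setT x -> (`|f n x| <= cst 2%:E x)%E}.
  apply: nearW => x n _; rewrite /f /= lee_fin ger0_norm ?normc_ge0 //.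
  exact: fejer_half_diff_le1.
have [_ _] := dominated_convergence measurableT mf (measurable_cst _) f0 ig fg.
rewrite /cst integral0 => /fine_cvgP[fin /cvgrPdist_le/(_ _ e0)][N1 _ H1].
case: fin => N2 _ H2; exists (maxn N1 N2) => n; rewrite geq_max => /andP[n1 n2].
have := H1 n n1; rewrite /= sub0r normrN => h.
rewrite -[leLHS]fineK; last exact: (H2 n n2).
by rewrite lee_fin; exact: le_trans (ler_norm _) h.
Unshelve. all: by end_near.
Qed.

End fejer_convergence.

Section fejer_convergence_torus.
Variables (R : realType) (d : nat) (q : R).
Hypothesis q1 : 1 < q.
Local Notation torus := (torus R d).
Local Notation mu := (haar R d).
Implicit Types (f g : torus -> R[i]) (E : set torus).

Let q_gt0 : 0 < q. Proof. exact: lt_trans ltr01 q1. Qed.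
Let q0 : 0 <= q. Proof. exact: ltW. Qed.
Let q1' : 1 <= q. Proof. exact: ltW. Qed.

Definition fejer_cvg f := forall e : R, 0 < e -> exists N, forall n, (N <= n)%N ->
  (Iq mu q (fun x => fejer n f x - f x)%R <= e%:E)%E.

Lemma cmeas_fejer n f : cmeas f -> (Iq mu q f < +oo)%E -> cmeas (fejer n f).
Proof.
by move=> mf fq; apply: (cbounded_tconv _ _).1; exact: Iq_lty_cintegrable mf fq.
Qed.

Lemma fejer_cvgD f g : cmeas f -> cmeas g -> (Iq mu q f < +oo)%E -> (Iq mu q g < +oo)%E ->
  fejer_cvg f -> fejer_cvg g -> fejer_cvg (fun x => f x + g x).
Proof.
move=> mf mg fq gq cf cg e e0; pose c : R := 2 `^ (q - 1).
have c0 : 0 < c by rewrite powR_gt0.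
have ec : 0 < e / (2 * c) by rewrite divr_gt0 // mulr_gt0.
have [N1 H1] := cf _ ec; have [N2 H2] := cg _ ec.
exists (maxn N1 N2) => n; rewrite geq_max => /andP[n1 n2].
have mf' := cmeas_fejer n mf fq; have mg' := cmeas_fejer n mg gq.
rewrite (@eq_Iq _ _ _ _ _ _ (fun x => (fejer n f x - f x) + (fejer n g x - g x))); last first.
  move=> x; rewrite /fejer tconvD; [|exact: Iq_lty_cintegrable mf fq|
    exact: Iq_lty_cintegrable mg gq].
  by congr normc; ring.
apply: le_trans (IqD_le2 _ q1' (cmeasB mf' mf) (cmeasB mg' mg)) _.
apply: (@le_trans _ _ (c%:E * ((e / (2 * c))%:E + (e / (2 * c))%:E))%E).
  by apply: lee_wpmul2l; [rewrite lee_fin ltW|apply: leeD; [exact: H1|exact: H2]].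
by rewrite -EFinD -EFinM lee_fin le_eqVlt; apply/orP; left; apply/eqP; field; rewrite gt_eqF.
Qed.

Lemma fejer_cvgZ a f : cmeas f -> (Iq mu q f < +oo)%E ->
  fejer_cvg f -> fejer_cvg (fun x => a * f x).
Proof.
move=> mf fq cf e e0; pose c : R := normc a `^ q + 1.
have c0 : 0 < c by rewrite ltr_wpDl // powR_ge0.
have [N H] := cf _ (divr_gt0 e0 c0); exists N => n nN.
have mf' := cmeas_fejer n mf fq.
rewrite (@eq_Iq _ _ _ _ _ _ (fun x => a * (fejer n f x - f x))); last first.
  by move=> x; rewrite /fejer tconvZ ?mulrBr //; exact: Iq_lty_cintegrable mf fq.
rewrite IqZ; last exact: cmeasB.
apply: (@le_trans _ _ (c%:E * (e / c)%:E)%E).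
  apply: lee_pmul; rewrite ?lee_fin ?powR_ge0 ?Iq_ge0 //; last exact: H.
  by rewrite lerDl.
by rewrite -EFinM mulrC divfK ?gt_eqF.
Qed.

(** The Fejer means are contractions, so the functions whose means converge form a closed
    set in [L^q]. *)
Lemma fejer_cvg_approx f : cmeas f -> (Iq mu q f < +oo)%E ->
  (forall e : R, 0 < e -> exists g, [/\ cmeas g, (Iq mu q g < +oo)%E, fejer_cvg g &
     (Iq mu q (fun x => f x - g x)%R <= e%:E)%E]) -> fejer_cvg f.
Proof.
move=> mf fq H e e0; pose c : R := 2 `^ (q - 1).
have c1 : 1 <= c by rewrite -(powRr0 2) ler_powR ?subr_ge0 // ler1n.
have c0 : 0 < c by lra.
have [|g [mg gq cg fg]] := H (e / (4 * (c * c))); first by rewrite divr_gt0 // !mulr_gt0.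
have [|N HN] := cg (e / (2 * c)); first by rewrite divr_gt0 // mulr_gt0.
exists N => n nN.
have mf' := cmeas_fejer n mf fq; have mg' := cmeas_fejer n mg gq.
have mh := cmeasB mf mg.
have hq : (Iq mu q (fun x => f x - g x)%R < +oo)%E by apply: le_lt_trans fg _; rewrite ltry.
have mh' := cmeas_fejer n mh hq.
have ig := Iq_lty_cintegrable q1' mg gq; have ih := Iq_lty_cintegrable q1' mh hq.
rewrite (@eq_Iq _ _ _ _ _ _ (fun x => (fejer n g x - g x) +
    (fejer n (fun y => f y - g y) x + - (f x - g x)))); last first.
  move=> x; rewrite (_ : fejer n f x = fejer n g x + fejer n (fun y => f y - g y) x).
    by congr normc; ring.
  rewrite /fejer -tconvD //; congr tconv; apply/funext => y; ring.
apply: le_trans (IqD_le2 _ q1' (cmeasB mg' mg) (cmeasB mh' mh)) _.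
apply: (@le_trans _ _ (c%:E * ((e / (2 * c))%:E + c%:E * ((e / (4 * (c * c)))%:E + (e / (4 * (c * c)))%:E)))%E).
  apply: lee_wpmul2l; first by rewrite lee_fin ltW.
  apply: leeD; first exact: HN.
  apply: le_trans (IqD_le2 _ q1' mh' (cmeasN mh)) _.
  apply: lee_wpmul2l; first by rewrite lee_fin ltW.
  rewrite IqN; apply: leeD => //; apply: le_trans fg.
  exact: Iq_fejer_le.
set z := e / (4 * (c * c)); set y := e / (2 * c).
have -> : (c%:E * (y%:E + c%:E * (z%:E + z%:E)) = (c * (y + c * (z + z)))%:E)%E by [].
rewrite lee_fin le_eqVlt; apply/orP; left; apply/eqP; rewrite /y /z.
by field; rewrite gt_eqF.
Qed.

Definition cind E (x : torus) : R[i] := (\1_E x : R)%:C.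

Lemma cbounded_cind E : measurable E -> cbounded (cind E).
Proof.
move=> mE; split; first by apply: cmeas_real; exact: measurable_indic.
by exists 1 => x; rewrite normc_real ger0_norm // indicE lern1 leq_b1.
Qed.

Lemma fejer_cst n (x : torus) : fejer n (fun=> 1) x = 1.
Proof.
rewrite /fejer /tconv; under eq_cint do rewrite mulr1.
rewrite /torus_ker (@cint_prod_tnth R d (fun j t => trig_ker (@fejer_weight R n) (tnth x j - t))).
  by rewrite big1 // => j _; exact: cint_fejer_ker.
by move=> j; exact: cbounded_trig_ker.
Qed.

Lemma fejer_cvg_cst : fejer_cvg (fun=> 1).
Proof.
move=> e e0; exists 0%N => n _.
rewrite (@eq_Iq _ _ _ _ _ _ (fun=> 0)); last by move=> x; rewrite fejer_cst subrr.
by rewrite Iq_cst ComplexField.Normc.normc0 powR0 ?lee_fin ?ltW // gt_eqF.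
Qed.

Definition box (a : 'I_d -> R) : set torus := [set x | forall j, a j <= tnth x j].

Lemma cind_box a x : cind (box a) x = \prod_(j < d) halfline (a j) (tnth x j).
Proof.
rewrite /cind indicE; have [/set_mem h|h] := boolP (x \in box a).
  by rewrite big1 // => j _; rewrite /halfline h.
have [j hj] : exists j, ~ (a j <= tnth x j).
  by apply/existsNP => h'; move/negP: h; apply; apply/mem_set.
by rewrite (bigD1 j) //= /halfline; move/negP/negbTE: hj => ->; rewrite mul0r.
Qed.

Lemma fejer_box n a x :
  fejer n (cind (box a)) x = \prod_(j < d) fejer_half n (a j) (tnth x j).
Proof.
rewrite /fejer /tconv /fejer_half -(@cint_prod_tnth R d
  (fun j t => trig_ker (@fejer_weight R n) (tnth x j - t) * halfline (a j) t)).
  by apply: eq_cint => y; rewrite cind_box /torus_ker big_split.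
by move=> j; apply: cboundedM; [exact: cbounded_trig_ker|exact: cbounded_half].
Qed.

Lemma normc_prod_le1 (I : Type) (r : seq I) (v : I -> R[i]) :
  (forall i, normc (v i) <= 1) -> normc (\prod_(i <- r) v i) <= 1.
Proof.
move=> v1; elim: r => [|j s IHs]; first by rewrite big_nil ComplexField.Normc.normc1.
by rewrite big_cons ComplexField.Normc.normcM mulr_ile1 ?normc_ge0.
Qed.

Lemma normc_prodB (I : Type) (r : seq I) (u v : I -> R[i]) :
  (forall i, normc (u i) <= 1) -> (forall i, normc (v i) <= 1) ->
  normc (\prod_(i <- r) u i - \prod_(i <- r) v i) <= \sum_(i <- r) normc (u i - v i).
Proof.
move=> u1 v1; elim: r => [|i r IH].
  by rewrite !big_nil subrr ComplexField.Normc.normc0.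
rewrite !big_cons; set a := \prod_(j <- r) _; set b := \prod_(j <- r) _.
have b1 : normc b <= 1 by exact: normc_prod_le1.
have -> : u i * a - v i * b = (u i - v i) * b + u i * (a - b) by ring.
apply: le_trans (le_normcD _ _) _; rewrite !ComplexField.Normc.normcM; apply: lerD.
  by rewrite ler_piMr ?normc_ge0.
by apply: le_trans IH; rewrite ler_piMl ?normc_ge0.
Qed.

Lemma normc_fejer_half n a x : normc (@fejer_half R n a x) <= 1.
Proof.
rewrite -lee_fin; apply: le_trans (normc_cint_le _) _.
  by apply: cbounded_cintegrable; apply: cboundedM; [exact: cbounded_trig_ker|exact: cbounded_half].
rewrite Iq1E -(integral_fejer_ker n x); apply: le_pint.
- apply: measurable_normc; apply: cmeasM; first exact: (cbounded_trig_ker _ _).1.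
  exact: (cbounded_half a).1.
- exact: measurable_fejer_ker.
- by move=> t; exact: normc_ge0.
- move=> t; rewrite ComplexField.Normc.normcM trig_ker_fejer normc_real.
  by rewrite ger0_norm ?fejer_ker_ge0 // ler_piMr ?fejer_ker_ge0 // normc_half.
Qed.

Lemma integral_tnth (g : measurableTypeR R -> R[i]) j : cbounded g ->
  (\int[mu]_x (normc (g (tnth x j)))%:E = \int[circle_haar]_t (normc (g t))%:E)%E.
Proof.
move=> bg; pose h t : R[i] := (normc (g t))%:C.
have bh : cbounded h.
  case: bg => mg [M gM]; split; first by apply: cmeas_real; exact: measurable_normc.
  by exists M => t; rewrite normc_real ger0_norm ?normc_ge0.
have bh' := cbounded_tnth j bh.
have E (T : measurableType _) (nu : probability T R) (k : T -> R[i]) : cintegrable nu k ->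
    (\int[nu]_x (cRe (k x))%:E = (cRe (cint nu k))%:E)%E.
  move=> ik; rewrite cintE /= /Rintegral fineK //; apply: integrable_fin_num => //.
  exact: (cintegrable_Re ik).
have -> : (\int[mu]_x (normc (g (tnth x j)))%:E = \int[mu]_x (cRe (h (tnth x j)))%:E)%E by [].
have -> : (\int[circle_haar]_t (normc (g t))%:E = \int[circle_haar]_t (cRe (h t))%:E)%E by [].
rewrite !E; try exact: cbounded_cintegrable.
congr (cRe _)%:E; pose F i t := if i == j then h t else 1.
have -> : cint mu (fun x => h (tnth x j)) = cint mu (fun x => \prod_(i < d) F i (tnth x i)).
  apply: eq_cint => x; rewrite (bigD1 j) //= /F eqxx big1 ?mulr1 // => i.
  by move=> /negbTE ->.
rewrite (@cint_prod_tnth R d F); last first.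
  by move=> i; rewrite /F; case: eqP => // _; exact: cbounded_cst.
rewrite (bigD1 j) //= {1}/F eqxx big1 ?mulr1 // => i /negbTE ij.
by rewrite /F ij cint_cst.
Qed.

Lemma fejer_half_cvg_all (a : 'I_d -> R) (e : R) : 0 < e -> exists N, forall n, (N <= n)%N ->
  forall j, (\int[circle_haar]_x (normc (fejer_half n (a j) x - halfline (a j) x))%:E <= e%:E)%E.
Proof.
move=> e0; have H j := fejer_half_cvg (a j) e0; pose N j := projT1 (cid (H j)).
exists (\max_j N j) => n Nn j; apply: (projT2 (cid (H j))).
by apply: leq_trans Nn; exact: leq_bigmax.
Qed.

Lemma measurable_box a : measurable (box a).
Proof.
rewrite (_ : box a = \bigcap_(j in [set` 'I_d]) ((fun x : torus => tnth x j) @^-1` `[a j, +oo[)).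
  apply: fin_bigcap_measurable => // j _; rewrite -[X in measurable X]setTI.
  by apply: measurable_tnth => //; exact: measurable_itv.
apply/seteqP; split => x /= h j; first by move=> _ /=; rewrite in_itv /= andbT.
by have := h j isT; rewrite /= in_itv /= andbT.
Qed.

(** Both the indicator and its Fejer mean are products over the coordinates of functions
    bounded by [1]; such products differ by at most the sum of the differences of the factors. *)
Lemma fejer_cvg_box a : fejer_cvg (cind (box a)).
Proof.
move=> e e0; pose c : R := 2 `^ (q - 1) * d.+1%:R.
have c0 : 0 < c by rewrite mulr_gt0 ?powR_gt0.
have [N HN] := fejer_half_cvg_all a (divr_gt0 e0 c0); exists N => n Nn.
pose g j (t : measurableTypeR R) := fejer_half n (a j) t - halfline (a j) t.
have bg j : cbounded (g j).
  split; last by exists 2 => t; exact: fejer_half_diff_le1.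
  apply: cmeasB; first exact: cmeas_fejer_half.
  exact: (cbounded_half _).1.
have mgj j : measurable_fun setT (fun x : torus => normc (g j (tnth x j))).
  by apply: measurable_normc; apply: cmeas_tnth; exact: (bg j).1.
have ms : measurable_fun setT (fun x : torus => \sum_(j < d) normc (g j (tnth x j))).
  by apply: measurable_sum.
have s0 x : 0 <= \sum_(j < d) normc (g j (tnth x j)).
  by apply: sumr_ge0 => j _; exact: normc_ge0.
have mb := cbounded_cind (measurable_box a).
have mfb : cmeas (fejer n (cind (box a))).
  by apply: (cbounded_tconv _ _).1; exact: cbounded_cintegrable.
apply: (@le_trans _ _ (\int[mu]_x (2 `^ (q - 1) * \sum_(j < d) normc (g j (tnth x j)))%:E)%E).
  rewrite IqE; apply: le_pint.
  - by apply: measurable_normc_powR; apply: cmeasB => //; exact: mb.1.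
  - exact: measurable_funM.
  - by move=> x; exact: powR_ge0.
  - move=> x; rewrite fejer_box cind_box; set b := normc _.
    have b2 : b <= 2.
      apply: le_trans (le_normcD _ _) _; rewrite normcN -cind_box -fejer_box.
      rewrite (_ : 2 = 1 + 1) //; apply: lerD.
        by rewrite fejer_box; apply: normc_prod_le1 => j; exact: normc_fejer_half.
      by rewrite /cind normc_real ger0_norm // indicE lern1 leq_b1.
    rewrite -(mulr_powRB1 (normc_ge0 _) q_gt0) mulrC; apply: ler_pM.
    + exact: powR_ge0.
    + exact: normc_ge0.
    + by apply: ge0_ler_powR; rewrite ?nnegrE ?subr_ge0 ?normc_ge0.
    + apply: normc_prodB => j; [exact: normc_fejer_half|exact: normc_half].
rewrite pintZ ?powR_ge0 //; under eq_integral do rewrite -sumEFin.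
rewrite ge0_integral_sum //; last 2 first.
- by move=> j; exact/measurable_EFinP.
- by move=> j x _; rewrite lee_fin normc_ge0.
apply: (@le_trans _ _ ((2 `^ (q - 1))%:E * \sum_(j < d) (e / c)%:E)%E).
  apply: lee_wpmul2l; first by rewrite lee_fin powR_ge0.
  by apply: lee_sum => j _; rewrite integral_tnth //; exact: HN.
rewrite sumEFin -EFinM lee_fin sumr_const card_ord.
rewrite -[_ *+ d]mulr_natr (_ : _ * (e / c * _) = e * ((2 `^ (q - 1) * d%:R) / c)); last by ring.
by rewrite ler_piMr ?(ltW e0) // ler_pdivrMr // mul1r /c ler_pM2l ?powR_gt0 // ler_nat.
Qed.

Let boxes : set (set torus) := [set E | exists a, E = box a].

(** A half-space is the increasing union of boxes whose other faces move to minus infinity. *)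
Lemma measurable_boxes : @measurable _ torus = <<s boxes >>.
Proof.
rewrite eqEsubset; split; last first.
  apply: smallest_sub; first exact: sigma_algebra_measurable.
  by move=> _ [a ->]; exact: measurable_box.
pose T' := g_sigma_algebraType boxes.
have mcoord j : measurable_fun setT (fun x : T' => tnth (x : torus) j : measurableTypeR R).
  apply: (measurability _ (RGenCInfty.measurableE R)) => _ [_ [a ->] <-].
  rewrite setTI (_ : _ @^-1` _ = \bigcup_m box (fun i => if i == j then a else - m%:R)).
    by apply: bigcupT_measurable => m; apply: sub_sigma_algebra; eexists.
  apply/seteqP; split => x /=; rewrite in_itv /= andbT.
    move=> ax; pose M := \sum_(i < d) `|tnth x i|.
    exists (Num.bound M) => // i /=; case: eqP => [->//|_].
    rewrite lerNl; apply: (@le_trans _ _ M).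
      rewrite /M (bigD1 i) //= -[leLHS]addr0; apply: lerD.
        by rewrite -normrN ler_norm.
      by apply: sumr_ge0.
    by apply/ltW/archi_boundP; apply: sumr_ge0.
  by move=> [m _ /(_ j)]; rewrite eqxx.
have mid : measurable_fun setT (fun x : T' => x : torus) by apply/measurable_fun_tnthP.
by move=> E mE; have := mid measurableT E mE; rewrite setTI.
Qed.

Lemma Iq_cind E : measurable E -> Iq mu q (cind E) = mu E.
Proof.
move=> mE; rewrite IqE (eq_integral (fun x => (\1_E x)%:E)).
  by rewrite integral_indic // setIT.
move=> x _; rewrite /cind normc_real indicE; case: (x \in E).
  by rewrite ger0_norm // powR1.
by rewrite normr0 powR0 // gt_eqF.
Qed.

Lemma fejer_cvg_sum (I : Type) (s : seq I) (F : I -> torus -> R[i]) :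
  (forall i, cmeas (F i)) -> (forall i, (Iq mu q (F i) < +oo)%E) ->
  (forall i, fejer_cvg (F i)) -> fejer_cvg (fun x => \sum_(i <- s) F i x).
Proof.
move=> mF iF cF; elim: s => [|i s IH].
  have i1 : (Iq mu q (fun=> 1%R) < +oo)%E by rewrite Iq_cst ltry.
  have := fejer_cvgZ 0 (cmeas_cst _ 1) i1 fejer_cvg_cst.
  by congr fejer_cvg; apply/funext => x; rewrite mul0r big_nil.
under eq_fun do rewrite big_cons.
by apply: fejer_cvgD => //; [exact: cmeas_sum|exact: Iq_sum_lty].
Qed.

Lemma cindU A B x : A `&` B = set0 -> cind (A `|` B) x = cind A x + cind B x.
Proof.
move=> AB; rewrite /cind -rmorphD /= !indicE in_setU; congr (_%:C).
have [/set_mem Ax|Ax] := boolP (x \in A); last by rewrite add0r.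
rewrite memNset ?addr0 //= => Bx.
by have : set0 x by rewrite -AB.
Qed.

(** The measurable sets with convergent Fejer means form a Dynkin class, and the boxes are
    stable under intersection. *)
Lemma fejer_cvg_cind E : measurable E -> fejer_cvg (cind E).
Proof.
have cb S : measurable S -> cmeas (cind S) /\ (Iq mu q (cind S) < +oo)%E.
  by move=> mS; split; [exact: (cbounded_cind mS).1|exact: cbounded_Iq_lty (cbounded_cind mS)].
rewrite measurable_boxes; move: E; apply: (dynkin_induction measurable_boxes).
- move=> _ _ [a ->] [b ->]; exists (fun j => Num.max (a j) (b j)).
  apply/seteqP; split => x /= h; first by move=> j; rewrite ge_max h.1 h.2.
  by split => j; have := h j; rewrite ge_max => /andP[].
- by have := fejer_cvg_cst; congr fejer_cvg; apply/funext => x; rewrite /cind indicT.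
- by move=> _ [a ->]; exact: fejer_cvg_box.
- move=> S mS cS.
  have -> : cind (~` S) = fun x => 1 + (-1) * cind S x.
    apply/funext => x; rewrite /cind !indicE in_setC; case: (x \in S) => /=.
      by rewrite mulr1 subrr.
    by rewrite mulr0 addr0.
  have [mcS iS] := cb _ mS; apply: fejer_cvgD => //.
  + exact: cmeas_cst.
  + exact: cmeasZ.
  + by rewrite Iq_cst ltry.
  + exact: IqZ_lty.
  + exact: fejer_cvg_cst.
  + exact: fejer_cvgZ.
- move=> F mF tF cF; set S := \bigcup_k F k.
  have mS : measurable S by exact: bigcupT_measurable.
  have [mcS iS] := cb _ mS.
  apply: fejer_cvg_approx => // e e0.
  pose T n := \bigcup_k F (n + k)%N.
  have mT n : measurable (T n) by exact: bigcupT_measurable.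
  have TS n : T n = F n `|` T n.+1.
    apply/seteqP; split => x.
      by move=> [[_|k _ h]]; [rewrite addn0; left|right; exists k => //; rewrite addSnnS].
    by move=> [h|[k _ h]]; [exists 0%N => //; rewrite addn0|exists k.+1 => //; rewrite -addSnnS].
  have disj n : F n `&` T n.+1 = set0.
    apply/seteqP; split => x // [h1 [k _ h2]].
    have /trivIsetP := tF => /(_ n (n.+1 + k)%N I I) h.
    by have : set0 x; [rewrite -h //; rewrite addSn ltn_eqF // ltnS leq_addr|].
  have dec n x : cind S x = \sum_(i < n) cind (F i) x + cind (T n) x.
    elim: n => [|n IH].
      by rewrite big_ord0 add0r; congr (cind _ x); rewrite /T.
    by rewrite IH big_ord_recr /= -addrA -cindU // -TS.
  have [n Tn] : exists n, (mu (T n) <= e%:E)%E.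
    have Tc : mu \o T @ \oo --> mu (\bigcap_n T n).
      apply: nonincreasing_cvg_mu => //.
      - by apply: le_lt_trans (probability_le1 _ _) _; rewrite ?ltry.
      - exact: bigcapT_measurable.
      - by apply/nonincreasing_seqP => n; apply/subsetPset; rewrite [X in _ `<=` X]TS; exact: subsetUr.
    have T0 : \bigcap_n T n = set0.
      apply/seteqP; split => x // h; have [k _] := h 0%N I; rewrite add0n => h1.
      have h2 := h k.+1 I.
      by have : set0 x by rewrite -(disj k).
    move: Tc; rewrite T0 measure0 => /fine_cvgP[fin /cvgrPdist_le/(_ _ e0)][N _ H].
    case: fin => N2 _ H2; exists (maxn N N2).
    have := H _ (leq_maxl N N2); rewrite /= sub0r normrN => h.
    rewrite -[leLHS]fineK; last exact: (H2 _ (leq_maxr N N2)).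
    by rewrite lee_fin; exact: le_trans (ler_norm _) h.
  have mg : cmeas (fun x => \sum_(i < n) cind (F i) x).
    by apply: cmeas_sum => i _; case: (cb _ (mF i)).
  exists (fun x => \sum_(i < n) cind (F i) x); split => //.
  + by apply: Iq_sum_lty => // i _; case: (cb _ (mF i)).
  + by apply: fejer_cvg_sum => // i; case: (cb _ (mF i)).
  + rewrite (@eq_Iq _ _ _ _ _ _ (cind (T n))) ?Iq_cind // => x.
    by rewrite (dec n) addrAC subrr add0r.
Qed.

(** The integer part of [u], capped at [K]: summing the indicators of [K] level sets of a
    function bounded by [K] leaves an error at most [1]. *)
Definition step_count (K : nat) (u : R) : R := \sum_(k < K) (k.+1%:R <= u)%R%:R.

Lemma step_count_bound K u : 0 <= u <= K%:R -> 0 <= u - step_count K u <= 1.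
Proof.
elim: K u => [|K IH] u /andP[u0 uK].
  by rewrite /step_count big_ord0 subr0 u0 (le_trans uK).
rewrite /step_count big_ord_recr /= -/(step_count K u); have [h|h] := leP u K%:R.
  rewrite [_ <= u]leNgt (_ : u < K.+1%:R) /= ?addr0; first by apply: IH; rewrite u0.
  by apply: le_lt_trans h _; rewrite ltr_nat.
have -> : step_count K u = K%:R.
  rewrite /step_count (eq_bigr (fun=> 1)) ?sumr_const ?card_ord // => i _.
  by rewrite (le_trans _ (ltW h)) // ler_nat.
move: uK; rewrite -natr1; have [h'|h'] := leP (K%:R + 1) u => /=; lra.
Qed.

Lemma fejer_cvg_nonneg_bounded (g : torus -> R) (M : R) : measurable_fun setT g ->
  (forall x, 0 <= g x <= M) -> fejer_cvg (fun x => (g x)%:C).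
Proof.
move=> mg gM; have M0 : 0 <= M by have /andP[] := gM point; exact: le_trans.
have cg : cmeas (fun x => (g x)%:C) by exact: cmeas_real.
have bg : cbounded (fun x => (g x)%:C).
  by split => //; exists M => x; have /andP[? ?] := gM x; rewrite normc_real ger0_norm.
apply: fejer_cvg_approx => //; first exact: cbounded_Iq_lty.
move=> e e0.
have [K [K0 hK]] : exists K : nat, 0 < K%:R :> R /\ (M / K%:R) `^ q <= e.
  pose z := e `^ q^-1; have z0 : 0 < z by rewrite powR_gt0.
  exists (Num.bound (M / z)).+1; split => //.
  have -> : e = z `^ q by rewrite /z -powRrM mulVf ?powRr1 ?gt_eqF // ltW.
  apply: ge0_ler_powR; rewrite ?nnegrE ?divr_ge0 ?(ltW z0) //.
  rewrite ler_pdivrMr // mulrC -ler_pdivrMr //; apply: (@le_trans _ _ (Num.bound (M / z))%:R).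
    by apply/ltW/archi_boundP; rewrite divr_ge0 // ltW.
  by rewrite ler_nat.
pose c := M / K%:R; pose A (k : 'I_K) := [set x | k.+1%:R * c <= g x].
have mA k : measurable (A k).
  rewrite (_ : A k = setT `&` g @^-1` `[k.+1%:R * c, +oo[).
    by apply: mg => //; exact: measurable_itv.
  by apply/seteqP; split => x /=; rewrite in_itv /= andbT; tauto.
have mAc k := (cbounded_cind (mA k)).1.
have iA k := cbounded_Iq_lty mu q0 (cbounded_cind (mA k)).
exists (fun x => \sum_(k < K) c%:C * cind (A k) x); split.
- by apply: cmeas_sum => k _; exact: cmeasZ.
- by apply: Iq_sum_lty => // k _; [exact: cmeasZ|exact: IqZ_lty].
- by apply: fejer_cvg_sum => k; [exact: cmeasZ|exact: IqZ_lty|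
    apply: fejer_cvgZ => //; exact: fejer_cvg_cind].
- have c0 : 0 <= c by rewrite divr_ge0 // ltW.
  apply: (@le_trans _ _ (c `^ q)%:E); last by rewrite lee_fin.
  apply: Iq_bounded => //.
    by apply: cmeasB => //; apply: cmeas_sum => k _; exact: cmeasZ.
  move=> x; have /andP[g0 gxM] := gM x.
  have -> : \sum_(k < K) c%:C * cind (A k) x =
      (c * \sum_(k < K) (k.+1%:R * c <= g x)%R%:R)%:C.
    rewrite mulr_sumr rmorph_sum; apply: eq_bigr => k _; rewrite -rmorphM /=.
    congr ((c * _%:R)%:C); congr nat_of_bool.
    by apply/idP/idP => [/set_mem|h]; [|exact/mem_set].
  rewrite -(rmorphB (real_complex R)) [X in X <= _]normc_real; have [c00|cN0] := eqVneq c 0.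
    have M00 : M = 0.
      by apply/eqP; move/eqP: c00; rewrite /c mulf_eq0 invr_eq0 (gt_eqF K0) orbF.
    rewrite c00 mul0r subr0 ger0_norm //; rewrite M00 in gxM; exact: gxM.
  have {c0}cp : 0 < c by rewrite lt_neqAle eq_sym cN0.
  have := @step_count_bound K (g x / c); rewrite divr_ge0 ?(ltW cp) //=.
  have -> : g x / c <= K%:R.
    by rewrite ler_pdivrMr // /c mulrCA divff ?mulr1 // gt_eqF.
  move=> /(_ isT) /andP[s0 s1].
  have -> : \sum_(k < K) (k.+1%:R * c <= g x)%R%:R = step_count K (g x / c).
    by apply: eq_bigr => k _; rewrite ler_pdivlMr.
  rewrite (_ : g x = c * (g x / c)); last by rewrite mulrC divfK.
  rewrite -[in c * (g x / c) / c]mulrA.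
  rewrite (_ : c * (g x / c / c) = g x / c); last by rewrite mulrC divfK.
  by rewrite -mulrBr ger0_norm ?mulr_ge0 ?(ltW cp) // ler_piMr ?(ltW cp).
Qed.

(** From indicators to step functions, from these to bounded nonnegative functions, from
    these by truncation to nonnegative functions, and from these to the real and imaginary
    parts of [f] and their positive parts. *)
Theorem fejer_cvgP f : cmeas f -> (Iq mu q f < +oo)%E -> fejer_cvg f.
Proof.
have pos (g : torus -> R) : measurable_fun setT g -> (forall x, 0 <= g x) ->
    (Iq mu q (fun x => (g x)%:C) < +oo)%E -> fejer_cvg (fun x => (g x)%:C).
  move=> mg g0 gq; have mgc := cmeas_real mg.
  apply: fejer_cvg_approx => // e e0.
  pose h (n : nat) x := Num.min (g x) n%:R.
  have mh n : measurable_fun setT (h n) by apply: measurable_minr => //; exact: measurable_cst.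
  have h0 n x : 0 <= h n x <= n%:R by rewrite /h le_min g0 ler0n /= ge_min lexx orbT.
  have gh n x : 0 <= g x - h n x <= g x.
    rewrite subr_ge0 /h ge_min lexx /= lerBlDr lerDl.
    by have /andP[] := h0 n x.
  pose F n x := (normc ((g x)%:C - (h n x)%:C) `^ q)%:E.
  have mF n : measurable_fun setT (F n).
    by apply/measurable_EFinP/measurable_normc_powR; apply: cmeasB => //; exact: cmeas_real.
  have F0 : {ae mu, forall x, setT x -> F ^~ x @ \oo --> (cst 0%E : _ -> \bar R) x}.
    apply: nearW => x _; apply: cvg_near_cst; near=> n.
    rewrite /F /h min_l ?subrr ?ComplexField.Normc.normc0 ?powR0 // ?gt_eqF //.
    by near: n; exact: nbhs_infty_ger.
  have ig : mu.-integrable setT (fun x => (normc (g x)%:C `^ q)%:E).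
    apply/integrableP; split; first by apply/measurable_EFinP; exact: measurable_normc_powR.
    under eq_integral do rewrite gee0_abs ?lee_fin ?powR_ge0 //.
    by rewrite -IqE.
  have Fg : {ae mu, forall x n, setT x -> (`|F n x| <= (normc (g x)%:C `^ q)%:E)%E}.
    apply: nearW => x n _; rewrite gee0_abs ?lee_fin ?powR_ge0 //.
    have /andP[a b] := gh n x.
    apply: ge0_ler_powR; rewrite ?nnegrE ?normc_ge0 // -(rmorphB (real_complex R)) !normc_real /=.
    by rewrite !ger0_norm.
  have [_ _] := dominated_convergence measurableT mF (measurable_cst _) F0 ig Fg.
  rewrite /cst integral0 => /fine_cvgP[fin /cvgrPdist_le/(_ _ e0)][N1 _ H1].
  case: fin => N2 _ H2; pose n := maxn N1 N2.
  have := H1 n (leq_maxl _ _); rewrite /= sub0r normrN => hn.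
  have bh : cbounded (fun x => (h n x)%:C).
    split; first exact: cmeas_real.
    by exists n%:R => x; have /andP[? ?] := h0 n x; rewrite normc_real ger0_norm.
  exists (fun x => (h n x)%:C); split.
  - exact: bh.1.
  - exact: cbounded_Iq_lty.
  - exact: fejer_cvg_nonneg_bounded (h0 n).
  - rewrite IqE -[leLHS]fineK; last exact: (H2 n (leq_maxr _ _)).
    by rewrite lee_fin; exact: le_trans (ler_norm _) hn.
move=> mf fq.
have le_real (g : torus -> R) : (forall x, `|g x| <= normc (f x)) -> measurable_fun setT g ->
    (Iq mu q (fun x => (g x)%:C) < +oo)%E.
  move=> gf mg; apply: le_lt_trans fq; apply: le_Iq => //; first exact: cmeas_real.
  by move=> x; rewrite normc_real.
pose P1 x := Num.max (cRe (f x)) 0; pose N1 x := Num.max (- cRe (f x)) 0.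
pose P2 x := Num.max (cIm (f x)) 0; pose N2 x := Num.max (- cIm (f x)) 0.
have [mP1 mN1 mP2 mN2] : [/\ measurable_fun setT P1, measurable_fun setT N1,
    measurable_fun setT P2 & measurable_fun setT N2].
  by split; apply: measurable_maxr => //; try exact: measurable_cst;
    [exact: mf.1|apply: measurable_funN; exact: mf.1|exact: mf.2|apply: measurable_funN; exact: mf.2].
have maxle (u v : R) : `|u| <= v -> `|Num.max u 0| <= v.
  by move=> uv; case: (leP u 0) => h //; rewrite normr0; apply: le_trans uv.
have i1 : (Iq mu q (fun x => (P1 x)%:C) < +oo)%E.
  by apply: le_real => // x; apply: maxle; exact: Re_le_normc.
have i2 : (Iq mu q (fun x => (N1 x)%:C) < +oo)%E.
  by apply: le_real => // x; apply: maxle; rewrite normrN; exact: Re_le_normc.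
have i3 : (Iq mu q (fun x => (P2 x)%:C) < +oo)%E.
  by apply: le_real => // x; apply: maxle; exact: Im_le_normc.
have i4 : (Iq mu q (fun x => (N2 x)%:C) < +oo)%E.
  by apply: le_real => // x; apply: maxle; rewrite normrN; exact: Im_le_normc.
have c1 := cmeas_real mP1; have c2 := cmeas_real mN1.
have c3 := cmeas_real mP2; have c4 := cmeas_real mN2.
have max0 (u : R) : 0 <= Num.max u 0 by rewrite le_max lexx orbT.
have -> : f = fun x => ((P1 x)%:C + (-1) * (N1 x)%:C) + 'i%C * ((P2 x)%:C + (-1) * (N2 x)%:C).
  have pn (u : R) : Num.max u 0 - Num.max (- u) 0 = u.
    by rewrite !maxEle oppr_le0; case: leP => h; case: leP => h'; lra.
  apply/funext => x; apply: complex_eqP; rewrite !ReImE /=.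
    have := pn (cRe (f x)); rewrite -/(P1 x) -/(N1 x); lra.
  have := pn (cIm (f x)); rewrite -/(P2 x) -/(N2 x); lra.
have m1 := cmeasD c1 (cmeasZ (-1) c2); have m2 := cmeasD c3 (cmeasZ (-1) c4).
have j1 := IqD_lty q1' c1 (cmeasZ (-1) c2) i1 (IqZ_lty (-1) c2 i2).
have j2 := IqD_lty q1' c3 (cmeasZ (-1) c4) i3 (IqZ_lty (-1) c4 i4).
apply: fejer_cvgD => //; [exact: cmeasZ|exact: IqZ_lty| |].
  apply: fejer_cvgD => //; [exact: cmeasZ|exact: IqZ_lty| |].
    by apply: pos => // x; exact: max0.
  by apply: fejer_cvgZ => //; apply: pos => // x; exact: max0.
apply: fejer_cvgZ => //; apply: fejer_cvgD => //; [exact: cmeasZ|exact: IqZ_lty| |].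
  by apply: pos => // x; exact: max0.
by apply: fejer_cvgZ => //; apply: pos => // x; exact: max0.
Unshelve. all: by end_near.
Qed.

End fejer_convergence_torus.

(** * The theorem of M. Riesz on the circle *)

Section riesz.
Variable R : realType.
Local Notation torus := (torus R 1).
Local Notation mu := (haar R 1).
Implicit Types (u v h : torus -> R) (p : {poly R[i]}).

(** M. Riesz's inequality is proved for trigonometric polynomials, where all integrands are
    bounded and integrals are real numbers. *)
Definition rbounded h := measurable_fun setT h /\ exists M, forall x, `|h x| <= M.
Definition Ex h : R := (\int[mu]_x h x)%R.

Let integrable_rb h : rbounded h -> mu.-integrable setT (EFin \o h).
Proof.
move=> [mh [M hM]]; apply: measurable_bounded_integrable => //.
  by rewrite ltey_eq fin_num_measure.
by exists M; split; [exact: num_real|move=> z Mz x _; exact: le_trans (hM x) (ltW Mz)].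
Qed.

Lemma rboundedD u v : rbounded u -> rbounded v -> rbounded (fun x => u x + v x).
Proof.
move=> [mu1 [M uM]] [mv [N vN]]; split; first exact: measurable_funD.
by exists (M + N) => x; apply: le_trans (ler_normD _ _) _; apply: lerD.
Qed.

Lemma rboundedM u v : rbounded u -> rbounded v -> rbounded (fun x => u x * v x).
Proof.
move=> [mu1 [M uM]] [mv [N vN]]; split; first exact: measurable_funM.
by exists (M * N) => x; rewrite normrM ler_pM.
Qed.

Lemma rbounded_cst (a : R) : rbounded (fun=> a).
Proof. by split; [exact: measurable_cst|exists `|a|]. Qed.

Lemma rboundedX u n : rbounded u -> rbounded (fun x => u x ^+ n).
Proof.
move=> bu; elim: n => [|n IH]; first exact: rbounded_cst.
by under eq_fun do rewrite exprS; exact: rboundedM.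
Qed.

Lemma ExD u v : rbounded u -> rbounded v -> Ex (fun x => u x + v x) = Ex u + Ex v.
Proof. by move=> bu bv; rewrite /Ex RintegralD //; exact: integrable_rb. Qed.

Lemma ExZ a u : rbounded u -> Ex (fun x => a * u x) = a * Ex u.
Proof. by move=> bu; rewrite /Ex RintegralZl //; exact: integrable_rb. Qed.

Lemma Ex_le u v : rbounded u -> rbounded v -> (forall x, u x <= v x) -> Ex u <= Ex v.
Proof. by move=> bu bv uv; rewrite /Ex le_Rintegral //; exact: integrable_rb. Qed.

Lemma Ex_cst a : Ex (fun=> a) = a.
Proof. by rewrite /Ex /Rintegral pint_cst. Qed.

Lemma rbounded_Re (f : torus -> R[i]) : cbounded f -> rbounded (fun x => cRe (f x)).
Proof. by move=> [[mf _] [M fM]]; split => //; exists M => x; exact: le_trans (Re_le_normc _) _. Qed.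

Lemma rbounded_Im (f : torus -> R[i]) : cbounded f -> rbounded (fun x => cIm (f x)).
Proof. by move=> [[_ mf] [M fM]]; split => //; exists M => x; exact: le_trans (Im_le_normc _) _. Qed.

(** Jensen's inequality for even powers, by the tangent line at the mean. *)
Lemma Ex_pow_le u n : rbounded u -> Ex u ^+ n.*2 <= Ex (fun x => u x ^+ n.*2).
Proof.
move=> bu; set a := Ex u; set m := n.*2.
have b1 := rboundedX m bu.
have tang (x y : R) : y ^+ m + m%:R * y ^+ m.-1 * (x - y) <= x ^+ m.
  have ev (z : R) : z ^+ m = `|z| ^+ m.
    by rewrite -normrX ger0_norm // /m -mul2n exprM exprn_ge0 // sqr_ge0.
  case En : n => [|k]; first by rewrite /m En /= !expr0 !mul0r addr0.
  have m1 : 1 < m%:R :> R by rewrite ltr1n /m En doubleS.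
  have := powR_tangent m1 (normr_ge0 x) (normr_ge0 y).
  have -> : m%:R - 1 = m.-1%:R :> R by rewrite /m En doubleS /= -natr1 addrK.
  rewrite !powR_mulrn // -!ev => h.
  have hy : y ^+ m = y ^+ m.-1 * y by rewrite -exprSr /m En doubleS.
  have hxy : y ^+ m.-1 * x <= `|y| ^+ m.-1 * `|x|.
    by apply: le_trans (ler_norm _) _; rewrite normrM normrX.
  have hm : m%:R = m.-1%:R + 1 :> R by rewrite natr1 /m En doubleS.
  have : m%:R * (y ^+ m.-1 * x) <= m%:R * (`|y| ^+ m.-1 * `|x|) by rewrite ler_wpM2l.
  rewrite -mulrA mulrBr mulrBr -hy hm !mulrDl !mul1r; rewrite hm !mulrDl !mul1r in h; lra.
apply: (@le_trans _ _ (Ex (fun x => a ^+ m + (m%:R * a ^+ m.-1) * (u x + - a)))).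
  have b2 := rboundedD bu (rbounded_cst (- a)).
  rewrite ExD; [|exact: rbounded_cst|exact: rboundedM (rbounded_cst _) b2].
  by rewrite Ex_cst ExZ // ExD ?Ex_cst //; [rewrite subrr mulr0 addr0|exact: rbounded_cst].
apply: Ex_le => //.
apply: rboundedD; first exact: rbounded_cst.
by apply: rboundedM; [exact: rbounded_cst|apply: rboundedD => //; exact: rbounded_cst].
Qed.

(** The coordinate of the circle; an analytic trigonometric polynomial is [p.[e x]]. *)
Definition e (x : torus) : R[i] := circ (tnth x ord0).

Lemma eX k x : e x ^+ k = character (fun=> k%:Z) x.
Proof. by rewrite characterE big_ord1 /e -circM_natl -pmulrn. Qed.

Lemma horner_eE p x : p.[e x] = \sum_(k < size p) p`_k * character (fun=> k%:Z) x.
Proof. by rewrite horner_coef; apply: eq_bigr => k _; rewrite eX. Qed.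

Lemma cbounded_horner p : cbounded (fun x => p.[e x]).
Proof.
under eq_fun do rewrite horner_eE.
by apply: cbounded_sum => k _; apply: cboundedZ; exact: cbounded_character.
Qed.

(** The mean value property of analytic functions. *)
Lemma cint_horner p : cint mu (fun x => p.[e x]) = p`_0.
Proof.
have cb k : cintegrable mu (character k) by apply: cbounded_cintegrable; exact: cbounded_character.
under eq_cint do rewrite horner_eE.
rewrite cint_sum => [|k _]; last exact: cintegrableZ.
under eq_bigr do rewrite cintZ // cint_character.
have E (k : 'I_(size p)) : [forall j : 'I_1, k%:Z == 0] = (k == 0%N :> nat).
  by apply/forallP/eqP => [/(_ ord0)/eqP[]//|->].
under eq_bigr do rewrite E.
have [p0|p0] := eqVneq (size p) 0%N.
  by rewrite p0 big_ord0 nth_default // p0.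
rewrite -(big_mkord xpredT (fun k => p`_k * (k == 0%N)%:R)).
rewrite (big_cat_nat (n := 1)) ?lt0n //= big_nat1 eqxx mulr1.
rewrite big_nat_cond big1 ?addr0 // => k /andP[/andP[k0 _] _].
by rewrite gtn_eqF // mulr0.
Qed.

(** The exponent doubles at each step. With [u + i v = p.[e]], the polynomial
    [i (p ^ 2 - p_0 ^ 2)] is again analytic, vanishes at frequency [0], and has real part
    [- 2 u v] and imaginary part [u ^ 2 - v ^ 2 - c]. The bound at the exponent [2 m] controls
    [u ^ 2 - v ^ 2] by [u v], and Young's inequality absorbs the [v] of the product into the
    left-hand side. For the exponent [2], [p ^ 2] has real part [u ^ 2 - v ^ 2] and mean
    [p_0 ^ 2 >= 0]. *)
Lemma conjugate_bound (k : nat) : exists2 B : R, 0 < B & forall p, cIm p`_0 = 0 ->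
  Ex (fun x => cIm p.[e x] ^+ (2 ^ k).*2) <= B * Ex (fun x => cRe p.[e x] ^+ (2 ^ k).*2).
Proof.
have mean p : Ex (fun x => cRe p.[e x]) = cRe p`_0 by rewrite -cint_horner cintE.
elim: k => [|k [B B0 IH]].
  exists 1 => // p p0; rewrite mul1r expn0 -subr_ge0.
  have := mean (p ^+ 2); rewrite expr2 coef0M Re_mul p0 mulr0 subr0.
  under [X in Ex X]eq_fun do rewrite hornerM Re_mul -!expr2.
  have bu := rboundedX 2 (rbounded_Re (cbounded_horner p)).
  have bv := rboundedX 2 (rbounded_Im (cbounded_horner p)).
  have bv' := rboundedM (rbounded_cst (-1)) bv.
  rewrite (_ : (fun x => _) = fun x => cRe p.[e x] ^+ 2 + (-1) * cIm p.[e x] ^+ 2); last first.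
    by apply/funext => x; rewrite mulN1r.
  by rewrite ExD // ExZ // mulN1r => ->; rewrite -expr2 sqr_ge0.
set m := (2 ^ k)%N in IH *.
have Em : (2 ^ k.+1).*2 = (2 * m.*2)%N by rewrite expnS -!mul2n.
pose D : R := 3 ^+ m.*2; pose F : R := D * (B * 2 ^+ m.*2).
have D0 : 0 < D by rewrite exprn_gt0.
have F0 : 0 < F by rewrite !mulr_gt0 // exprn_gt0.
exists (4 * D + F ^+ 2); first by rewrite addr_gt0 ?mulr_gt0 ?exprn_gt0.
move=> p p0; rewrite Em.
pose u x := cRe p.[e x]; pose v x := cIm p.[e x]; pose c := cRe p`_0 ^+ 2.
have bu : rbounded u by apply: rbounded_Re; exact: cbounded_horner.
have bv : rbounded v by apply: rbounded_Im; exact: cbounded_horner.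
have hc : c ^+ m.*2 <= Ex (fun x => u x ^+ (2 * m.*2)).
  rewrite /c -mean -exprM; have := @Ex_pow_le u m.*2 bu.
  by rewrite -mul2n.
have := IH ('i%C *: (p ^+ 2 - (p`_0 ^+ 2)%:P)).
rewrite coefZ coefB coefC eqxx expr2 coef0M -expr2 subrr mulr0 => /(_ erefl).
have E1 x : cIm ('i%C *: (p ^+ 2 - (p`_0 ^+ 2)%:P)).[e x] = u x ^+ 2 - v x ^+ 2 - c.
  rewrite hornerZ hornerD hornerN hornerC expr2 hornerM !ReImE /=.
  by rewrite p0 /u /v /c; ring.
have E2 x : cRe ('i%C *: (p ^+ 2 - (p`_0 ^+ 2)%:P)).[e x] = - (2 * (u x * v x)).
  rewrite hornerZ hornerD hornerN hornerC expr2 hornerM !ReImE /=.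
  by rewrite p0 /u /v; ring.
under [X in Ex X <= _]eq_fun do rewrite E1.
under [X in _ <= _ * Ex X]eq_fun do rewrite E2.
set w := fun x => u x ^+ 2 - v x ^+ 2 - c => hw.
have ev (z : R) : 0 <= z ^+ m.*2 by rewrite -mul2n exprM exprn_ge0 // sqr_ge0.
have bw : rbounded w.
  apply: rboundedD; last exact: rbounded_cst.
  apply: rboundedD; first exact: rboundedX.
  by under eq_fun do rewrite -mulN1r; apply: rboundedM; [exact: rbounded_cst|exact: rboundedX].
have b2 := rboundedX m.*2 bw.
have bu2 := rboundedX (2 * m.*2) bu; have bv2 := rboundedX (2 * m.*2) bv.
have conv3 (a b z : R) : (a + b + z) ^+ m.*2 <= D * (a ^+ m.*2 + b ^+ m.*2 + z ^+ m.*2).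
  have evn (y : R) : y ^+ m.*2 = `|y| ^+ m.*2 by rewrite -normrX ger0_norm.
  pose M := Num.max `|a| (Num.max `|b| `|z|).
  have M0 : 0 <= M by rewrite le_max normr_ge0.
  apply: (@le_trans _ _ ((3 * M) ^+ m.*2)).
    rewrite evn; apply: lerXn2r; rewrite ?nnegrE ?mulr_ge0 //.
    apply: le_trans (ler_normD _ _) _; apply: le_trans (lerD (ler_normD _ _) (lexx _)) _.
    have : `|a| <= M by rewrite le_max lexx.
    have : `|b| <= M by rewrite !le_max lexx orbT.
    have : `|z| <= M by rewrite !le_max lexx !orbT.
    lra.
  rewrite exprMn /D ler_pM2l // !(evn a) !(evn b) !(evn z).
  have [na nb nz] : [/\ 0 <= `|a| ^+ m.*2, 0 <= `|b| ^+ m.*2 & 0 <= `|z| ^+ m.*2].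
    by rewrite !exprn_ge0.
  rewrite /M; case: (leP `|a| _) => _; [case: (leP `|b| _) => _|]; lra.
have hv : Ex (fun x => v x ^+ (2 * m.*2)) <=
    D * (Ex (fun x => u x ^+ (2 * m.*2)) + c ^+ m.*2 + Ex (fun x => w x ^+ m.*2)).
  have b3 := rboundedD (rboundedD bu2 (rbounded_cst (c ^+ m.*2))) b2.
  rewrite -[c ^+ _]Ex_cst -ExD //; last exact: rbounded_cst.
  rewrite -ExD //; last by apply: rboundedD => //; exact: rbounded_cst.
  rewrite -ExZ //; apply: Ex_le => //; first exact: rboundedM (rbounded_cst _) _.
  have evN (z : R) : (- z) ^+ m.*2 = z ^+ m.*2 by rewrite -mul2n !exprM sqrrN.
  move=> x; have := conv3 (u x ^+ 2) (- c) (- w x); rewrite !evN.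
  have -> : u x ^+ 2 + - c + - w x = v x ^+ 2 by rewrite /w; ring.
  by rewrite -!exprM.
pose t x := u x * v x.
have bt : rbounded t by exact: rboundedM.
have bt2 := rboundedX m.*2 bt.
have huv : F * Ex (fun x => t x ^+ m.*2) <=
    2^-1 * Ex (fun x => v x ^+ (2 * m.*2)) + 2^-1 * F ^+ 2 * Ex (fun x => u x ^+ (2 * m.*2)).
  have b4 := rboundedM (rbounded_cst 2^-1) bv2.
  have b5 := rboundedM (rbounded_cst (2^-1 * F ^+ 2)) bu2.
  rewrite -!ExZ // -ExD //; apply: Ex_le.
  - exact: rboundedM (rbounded_cst _) _.
  - exact: rboundedD.
  - move=> x; rewrite /t mulnC !exprM exprMn.
    set a := u x ^+ m.*2; set b := v x ^+ m.*2.
    by have := sqr_ge0 (F * a - b); nra.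
have hw2 : Ex (fun x => w x ^+ m.*2) <= B * 2 ^+ m.*2 * Ex (fun x => t x ^+ m.*2).
  apply: le_trans hw _; rewrite -mulrA ler_pM2l // -ExZ //.
  rewrite le_eqVlt; apply/orP; left; apply/eqP; congr Ex; apply/funext => x.
  by rewrite -[in RHS]exprMn -mul2n !exprM sqrrN.
set U := Ex (fun x => u x ^+ (2 * m.*2)) in hc hv huv *.
set V := Ex (fun x => v x ^+ (2 * m.*2)) in hv huv *.
set W := Ex (fun x => w x ^+ m.*2) in hv hw2.
set T := Ex (fun x => t x ^+ m.*2) in huv hw2.
have h1 : V <= D * (U + U + B * 2 ^+ m.*2 * T).
  by apply: le_trans hv _; rewrite ler_pM2l // lerD // lerD2l.
have h2 : D * (B * 2 ^+ m.*2 * T) = F * T by rewrite /F mulrA.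
rewrite mulrDr h2 in h1; rewrite mulrDr in h1; rewrite mulrDl; lra.
Qed.

Notation analytic n := (tconv (@analytic_weight R n)).

(** The kernel [A] of the nonnegative frequencies and its conjugate cover every frequency
    of the Fejer kernel once, except for [0], which they cover twice. *)
Lemma trig_ker_analytic n (t : R) :
  trig_ker (@analytic_weight R n) t + conjc (trig_ker (@analytic_weight R n) t) =
  trig_ker (@fejer_weight R n) t + 1.
Proof.
pose w (i l : 'I_n.+1) : R[i] := (@analytic_weight R n (i, l))%:C.
pose c (i l : 'I_n.+1) : R[i] := circ ((i%:Z - l%:Z)%:~R * t).
have E1 : trig_ker (@analytic_weight R n) t = \sum_i \sum_l w i l * c i l.
  by rewrite pair_bigA; apply: eq_bigr => -[].
have E2 : trig_ker (@fejer_weight R n) t = \sum_i \sum_l (n.+1%:R^-1)%:C * c i l.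
  by rewrite pair_bigA; apply: eq_bigr => -[].
have E3 : conjc (trig_ker (@analytic_weight R n) t) = \sum_i \sum_l w l i * c i l.
  rewrite E1 exchange_big (rmorph_sum (@conjc R)); apply: eq_bigr => i _.
  rewrite (rmorph_sum (@conjc R)); apply: eq_bigr => l _.
  have cM (a : R) (b : R[i]) : conjc (a%:C * b) = a%:C * conjc b.
    by case: b => x y /=; simpc.
  transitivity (w l i * conjc (c l i)); first exact: cM.
  rewrite -circN; congr (_ * circ _).
  by rewrite -mulNr -mulrNz opprB.
rewrite {1}E1 E3 E2 -big_split /=.
have -> : 1 = \sum_(i < n.+1) (n.+1%:R^-1)%:C :> R[i].
  by rewrite sumr_const card_ord -(rmorphMn (real_complex R)) /= -(mulr_natr n.+1%:R^-1) mulVf.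
rewrite -big_split /=; apply: eq_bigr => i _; rewrite -big_split /= (bigD1 i) //= [in RHS](bigD1 i) //=.
rewrite /w /analytic_weight /= leqnn mul1r /c subrr mul0r circ0 !mulr1 -!addrA; congr (_ + _).
rewrite addrC; congr (_ + _); apply: eq_bigr => l li.
rewrite -mulrDl -rmorphD /= -mulrDl; congr (_%:C * _).
have [il|il] := ltnP i l; first by rewrite (ltnW il) add0r mul1r.
by rewrite [(i <= l)%N]leqNgt ltn_neqAle il andbT li addr0 mul1r.
Qed.

Lemma weight_analytic d n (s : {ffun 'I_d -> 'I_n.+1 * 'I_n.+1}) :
  weight (@analytic_weight R n) s != 0 -> forall j, ((s j).2 <= (s j).1)%N.
Proof.
move=> h j; apply: contraNT h; rewrite -ltnNge => lt.
by rewrite /weight realc_prod (bigD1 j) //= /analytic_weight leqNgt lt /= !mul0r eqxx.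
Qed.

Lemma tconv_poly n (f : torus -> R[i]) : cintegrable mu f ->
  exists p, forall x, analytic n f x = p.[e x].
Proof.
move=> cf; exists (\sum_s (weight (@analytic_weight R n) s * fourier f (freq s)) *:
  'X^((s ord0).1 - (s ord0).2)%N) => x.
rewrite tconvE // horner_sum; apply: eq_bigr => s _.
have [w0|w0] := eqVneq (weight (@analytic_weight R n) s) 0.
  by rewrite w0 !mul0r scale0r horner0.
rewrite hornerZ hornerXn eX; congr (_ * character _ x); apply/funext => j.
by rewrite /freq (ord1 j) subzn // weight_analytic.
Qed.

Lemma Iq_even M (v : torus -> R) : rbounded v -> ~~ odd M ->
  Iq mu M%:R (fun x => (v x)%:C) = (Ex (fun x => v x ^+ M))%:E.
Proof.
move=> bv oM; rewrite IqE /Ex /Rintegral fineK; last first.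
  by apply: integrable_fin_num => //; apply: integrable_rb; exact: rboundedX.
apply: eq_integral => x _; rewrite normc_real powR_mulrn // -normrX ger0_norm //.
by rewrite -(odd_double_half M) (negbTE oM) add0n -mul2n exprM exprn_ge0 // sqr_ge0.
Qed.

Lemma cbounded_torus_ker d n (w : 'I_n * 'I_n -> R) (x : Defs.torus R d) :
  cbounded (torus_ker w x).
Proof.
apply: cbounded_prod => j _.
exact: (@cbounded_tnth R d (fun t => trig_ker w (tnth x j - t)) j (cbounded_trig_ker w _)).
Qed.

(** For real [f], twice the analytic part minus the mean has the Fejer mean of [f] as its
    real part: its imaginary part is the conjugate function. *)
Lemma analytic_conjugate n (f : torus -> R[i]) x : cintegrable mu f ->
  (forall y, conjc (f y) = f y) ->
  analytic n f x + conjc (analytic n f x) = fejer n f x + cint mu f.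
Proof.
move=> cf rf; rewrite /fejer /tconv.
have ci w : cintegrable mu (fun y => torus_ker (w : 'I_n.+1 * 'I_n.+1 -> R) x y * f y).
  by apply: cintegrableM => //; exact: cbounded_torus_ker.
rewrite -(cintJ (ci _)) -(cintD (ci _) (cintegrableJ (ci _))) -(cintD (ci _) cf).
apply: eq_cint => y; rewrite conjM rf -mulrDl -[X in _ = _ + X]mul1r -mulrDl.
by congr (_ * _); rewrite /torus_ker !big_ord1 -trig_ker_analytic.
Qed.

Lemma tconv_poly_real n (f : torus -> R[i]) : cintegrable mu f -> cIm (cint mu f) = 0 ->
  exists2 p : {poly R[i]}, cIm p`_0 = 0 & forall x, analytic n f x = p.[e x].
Proof.
move=> cf rf; have [p hp] := tconv_poly n cf; exists p => //.
rewrite -cint_horner -(eq_cint mu hp).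
have -> : cint mu (analytic n f) = fourier (analytic n f) (fun=> 0).
  rewrite fourierE; apply: eq_cint => y.
  by rewrite characterE big1 ?conjc1 ?mulr1 // => j _; rewrite mul0r circ0.
rewrite fourier_tconv // Im_sum big1 // => s _; case: forallP => [s0|_]; last by rewrite mulr0.
rewrite mulr1 Im_mul (_ : cIm (weight _ s) = 0) // mul0r addr0.
have -> : fourier f (freq s) = cint mu f.
  rewrite fourierE; apply: eq_cint => y.
  by rewrite characterE big1 ?conjc1 ?mulr1 // => j _; rewrite (eqP (s0 j)) mul0r circ0.
by rewrite rf mulr0.
Qed.

Lemma cint_real (f : torus -> R[i]) : (forall y, conjc (f y) = f y) -> cIm (cint mu f) = 0.
Proof.
move=> rf; rewrite cintE /=.
have f0 y : cIm (f y) = 0.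
  by have := congr1 cIm (rf y); case: (f y) => a b /= h; lra.
rewrite /Rintegral; under eq_integral do rewrite f0.
by rewrite integral0.
Qed.

(** The conjugate function is bounded by [conjugate_bound], and the analytic part is half
    the sum of the Fejer mean, the mean and [i] times the conjugate function. *)
Lemma riesz_real k : exists2 K : R, 0 <= K & forall n (f : torus -> R[i]), cmeas f ->
  (Iq mu (2 ^ k).*2%:R f < +oo)%E -> (forall y, conjc (f y) = f y) ->
  (Iq mu (2 ^ k).*2%:R (analytic n f) <= K%:E * Iq mu (2 ^ k).*2%:R f)%E.
Proof.
have [B B0 hB] := conjugate_bound k; set N := (2 ^ k).*2 in hB *.
have q1 : 1 < N%:R :> R.
  by rewrite ltr1n /N -[1%N]/(0.*2.+1) ltn_Sdouble expn_gt0.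
have q0 : 0 <= N%:R :> R by [].
have oN : ~~ odd N by rewrite /N odd_double.
set C : R := 2 `^ (N%:R - 1); have C0 : 0 <= C by exact: powR_ge0.
exists (C * (C * 2 + B)); first by rewrite mulr_ge0 // addr_ge0 ?mulr_ge0 // ltW.
move=> n f mf If rf; have cf := Iq_lty_cintegrable (ltW q1) mf If.
have [p p0 hp] := tconv_poly_real n cf (cint_real rf).
set c := cint mu f.
pose g : {poly R[i]} := p + p - c%:P.
have c0 : cIm c = 0 := cint_real rf.
have g0 : cIm g`_0 = 0 by rewrite /g coefB coefD coefC eqxx !Im_add Im_opp p0 c0 addr0 subr0.
pose u x : R := cRe g.[e x]; pose v x : R := cIm g.[e x].
have cg := cbounded_horner g.
have bu : rbounded u := rbounded_Re cg; have bv : rbounded v := rbounded_Im cg.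
have uE x : u x = cRe (fejer n f x).
  have := congr1 cRe (analytic_conjugate n x cf rf).
  have rj (z : R[i]) : cRe (conjc z) = cRe z by case: z.
  rewrite !Re_add rj hp => h; rewrite /u /g !hornerE Re_add Re_opp Re_add h.
  by rewrite -/c addrK.
have muC : cmeas (fun x => (u x)%:C) by apply: cmeas_real; case: bu.
have mvC : cmeas (fun x => (v x)%:C) by apply: cmeas_real; case: bv.
have Iu : (Iq mu N%:R (fun x => (u x)%:C) <= Iq mu N%:R f)%E.
  apply: (le_trans _ (@Iq_fejer_le R 1 n _ _ q1 mf If)).
  apply: le_Iq => // [|x]; first exact: (cmeas_fejer q1).
  by rewrite normc_real uE; exact: Re_le_normc.
have Iv : (Iq mu N%:R (fun x => (v x)%:C) <= B%:E * Iq mu N%:R f)%E.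
  rewrite (Iq_even bv oN); apply: (@le_trans _ _ (B%:E * Iq mu N%:R (fun x => (u x)%:C))%E).
    by rewrite (Iq_even bu oN) -EFinM lee_fin; exact: hB.
  by apply: lee_wpmul2l => //; rewrite lee_fin ltW.
have Ic : (Iq mu N%:R (fun=> c) <= Iq mu N%:R f)%E by rewrite Iq_cst; exact: normc_cint_powR_le.
have mi : cmeas (fun x => 'i%C * (v x)%:C) by exact: cmeasZ.
have Iiv : Iq mu N%:R (fun x => 'i%C * (v x)%:C) = Iq mu N%:R (fun x => (v x)%:C).
  by apply: eq_Iq => x; exact: normc_iM.
have mc : cmeas (fun _ : torus => c) by exact: cmeas_cst.
have le1 : (Iq mu N%:R (analytic n f) <=
    Iq mu N%:R (fun x => (c + (u x)%:C) + 'i%C * (v x)%:C)%R)%E.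
  apply: le_Iq => // [||x].
  - by case: (cbounded_tconv (analytic_weight R (n:=n)) cf).
  - exact: cmeasD (cmeasD mc muC) mi.
  - have -> : c + (u x)%:C + 'i%C * (v x)%:C = analytic n f x + analytic n f x.
      rewrite -addrA -[X in c + X = _](complexE g.[e x]) hp.
      by rewrite /g hornerD hornerN hornerD hornerC addrC subrK.
    by rewrite -mulr2n normcMn mulr2n lerDl normc_ge0.
apply: (le_trans le1); apply: (le_trans (IqD_le2 _ (ltW q1) (cmeasD mc muC) mi)).
rewrite Iiv -/C.
have ci : (Iq mu N%:R (fun x => c + (u x)%:C)%R <= C%:E * (Iq mu N%:R f + Iq mu N%:R f))%E.
  apply: (le_trans (IqD_le2 _ (ltW q1) mc muC)); rewrite -/C.
  by apply: lee_wpmul2l; rewrite ?lee_fin //; exact: leeD.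
apply: (@le_trans _ _ (C%:E * (C%:E * (Iq mu N%:R f + Iq mu N%:R f) + B%:E * Iq mu N%:R f))%E).
  by apply: lee_wpmul2l; rewrite ?lee_fin //; exact: leeD.
rewrite -(Iq_fineK If) -!(EFinD, EFinM) lee_fin; lra.
Qed.

Lemma riesz_even k : exists2 K : R, 0 <= K & forall n (f : torus -> R[i]), cmeas f ->
  (Iq mu (2 ^ k).*2%:R f < +oo)%E ->
  (Iq mu (2 ^ k).*2%:R (analytic n f) <= K%:E * Iq mu (2 ^ k).*2%:R f)%E.
Proof.
have [K K0 hK] := riesz_real k; set N := (2 ^ k).*2 in hK *.
have q1 : 1 < N%:R :> R.
  by rewrite ltr1n /N -[1%N]/(0.*2.+1) ltn_Sdouble expn_gt0.
have q0 : 0 <= N%:R :> R by [].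
set C : R := 2 `^ (N%:R - 1); have C0 : 0 <= C by exact: powR_ge0.
exists (C * (K + K)) => [|n f mf If]; first by rewrite mulr_ge0 // addr_ge0.
pose f1 x := (cRe (f x))%:C; pose f2 x := (cIm (f x))%:C.
have [m1 m2] : cmeas f1 /\ cmeas f2 by case: mf => m1 m2; split; exact: cmeas_real.
have I1 : (Iq mu N%:R f1 <= Iq mu N%:R f)%E.
  by apply: le_Iq => // x; rewrite normc_real; exact: Re_le_normc.
have I2 : (Iq mu N%:R f2 <= Iq mu N%:R f)%E.
  by apply: le_Iq => // x; rewrite normc_real; exact: Im_le_normc.
have c1 := Iq_lty_cintegrable (ltW q1) m1 (le_lt_trans I1 If).
have c2 := Iq_lty_cintegrable (ltW q1) m2 (le_lt_trans I2 If).
have ma g : cintegrable mu g -> cmeas (analytic n g).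
  by move=> cg; case: (cbounded_tconv (analytic_weight R (n:=n)) cg).
have hE x : analytic n f x = analytic n f1 x + 'i%C * analytic n f2 x.
  rewrite -tconvZ // -tconvD //; last exact: cintegrableZ.
  by congr (tconv _ _ x); apply/funext => y; rewrite -[RHS]complexE.
rewrite (@eq_Iq _ _ _ _ _ _ (fun x => analytic n f1 x + 'i%C * analytic n f2 x)); last by move=> x; rewrite hE.
apply: (le_trans (IqD_le2 _ (ltW q1) (ma _ c1) (cmeasZ _ (ma _ c2)))); rewrite -/C.
have -> : Iq mu N%:R (fun x => 'i%C * analytic n f2 x) = Iq mu N%:R (analytic n f2).
  by apply: eq_Iq => x; exact: normc_iM.
rewrite EFinM -muleA; apply: lee_wpmul2l; first by rewrite lee_fin.
rewrite EFinD ge0_muleDl ?lee_fin //; apply: leeD.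
- apply: (le_trans (hK n f1 m1 (le_lt_trans I1 If) _)) => [y|]; first by rewrite /f1 conjc_real.
  by apply: lee_wpmul2l => //; rewrite lee_fin.
- apply: (le_trans (hK n f2 m2 (le_lt_trans I2 If) _)) => [y|]; first by rewrite /f2 conjc_real.
  by apply: lee_wpmul2l => //; rewrite lee_fin.
Qed.

Lemma riesz_even_exp (q : R) : exists k, q < (2 ^ k).*2%:R.
Proof.
have [m qm] : exists m : nat, q < m%:R.
  exists (Num.truncn `|q|).+1; apply: (le_lt_trans (ler_norm q)).
  exact: truncnS_gt.
exists m; apply: (lt_le_trans qm); rewrite ler_nat.
by apply: (leq_trans (ltnW (ltn_expl m (ltnSn 1)))); rewrite -addnn leq_addr.
Qed.

Lemma cmeas_analytic n (f : torus -> R[i]) : cintegrable mu f -> cmeas (analytic n f).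
Proof. by move=> cf; case: (cbounded_tconv (@analytic_weight R n) cf). Qed.

(** Interpolation between [2] and an even exponent above [q]. *)
Lemma riesz_ge2 (q : R) : 2 <= q -> exists2 K : R, 1 <= K &
  forall n (f : torus -> R[i]), cmeas f -> (Iq mu q f < +oo)%E ->
  (Iq mu q (analytic n f) <= K%:E * Iq mu q f)%E.
Proof.
move=> q2; have [K2 K20 h2] := riesz_even 0.
have {}h2 : forall n (f : torus -> R[i]), cmeas f -> (Iq mu 2 f < +oo)%E ->
  (Iq mu 2 (analytic n f) <= K2%:E * Iq mu 2 f)%E by exact: h2.
have [->|q2'] := eqVneq q 2.
  exists (1 + K2) => [|n f mf If]; first by rewrite lerDl.
  apply: (le_trans (h2 n f mf If)); apply: lee_wpmul2r; first exact: Iq_ge0.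
  by rewrite lee_fin lerDr.
have {q2'}q2 : 2 < q by rewrite lt_neqAle eq_sym q2'.
have [k qk] := riesz_even_exp q; have [K3 K30 h3] := riesz_even k.
have i12 : (1 : R) <= 2 by rewrite ler1n.
have c0 := interp_bound_gt0 q2 qk; set c := interp_bound 2 q _ in c0.
exists (1 + c * (K2 + K3)) => [|n f mf If].
  by rewrite lerDl mulr_ge0 ?addr_ge0 // ltW.
apply: (le_trans (@marcinkiewicz _ _ _ _ _ mu mu 2 q _ (analytic n) K2 K3 i12 q2 qk K20 K30 _ _ _ f mf If)).
- move=> g mg Ig; split; last exact: h2.
  exact: cmeas_analytic (Iq_lty_cintegrable i12 mg Ig).
- exact: h3.
- move=> g1 g2 m1 m2 I1 I2; apply: aeW => x _.
  by apply: tconvD; exact: (Iq_lty_cintegrable i12).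
- apply: lee_wpmul2r; first exact: Iq_ge0.
  by rewrite lee_fin lerDr.
Qed.

Lemma analytic_adjoint n (f g : torus -> R[i]) : cintegrable mu f -> cintegrable mu g ->
  cint mu (fun x => analytic n f x * conjc (g x)) = cint mu (fun x => f x * conjc (analytic n g x)).
Proof.
move=> cf cg; set w := @analytic_weight R n.
have E1 x : analytic n f x * conjc (g x) =
    \sum_s weight w s * fourier f (freq s) * conjc (g x * conjc (character (freq s) x)).
  rewrite tconvE // mulr_suml; apply: eq_bigr => s _.
  by rewrite -/w conjM conjcK -!mulrA [conjc (g x) * _]mulrC.
have E2 x : f x * conjc (analytic n g x) =
    \sum_s weight w s * conjc (fourier g (freq s)) * (f x * conjc (character (freq s) x)).
  rewrite tconvE // (rmorph_sum (@conjc R)) mulr_sumr; apply: eq_bigr => s _.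
  have wr : conjc (weight w s) = weight w s by rewrite /weight conjc_real.
  transitivity (f x * (weight w s * conjc (fourier g (freq s)) * conjc (character (freq s) x))).
    congr (_ * _); apply: etrans (conjM _ _) _; congr (_ * _).
    by apply: etrans (conjM _ _) _; congr (_ * _); exact: wr.
  by rewrite mulrCA.
have ch (h : torus -> R[i]) k : cintegrable mu h ->
    cintegrable mu (fun x => h x * conjc (character k x)).
  exact: cintegrable_fourier.
rewrite (eq_cint mu E1) (eq_cint mu E2) !cint_sum; last 2 first.
- by move=> s _; apply: cintegrableZ; exact: ch.
- by move=> s _; apply: cintegrableZ; apply: cintegrableJ; exact: ch.
apply: eq_bigr => s _; rewrite !cintZ; [|exact: ch|by apply: cintegrableJ; exact: ch].
by rewrite cintJ; [rewrite -!fourierE -!mulrA [fourier f _ * _]mulrC|exact: ch].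
Qed.

(** The analytic projection is self-adjoint, so a bound at the dual exponent passes to [q]:
    test against [G = |h| ^ (q - 2) h], for which the pairing with [h] is [I_q h] and the dual
    integral of [G] is [I_q h] too. *)
Lemma riesz_dual (q K : R) : 1 < q -> 0 < K ->
  (forall n (f : torus -> R[i]), cmeas f -> (Iq mu (q / (q - 1)) f < +oo)%E ->
    (Iq mu (q / (q - 1)) (analytic n f) <= K%:E * Iq mu (q / (q - 1)) f)%E) ->
  forall n (f : torus -> R[i]), cmeas f -> (Iq mu q f < +oo)%E ->
  (Iq mu q (analytic n f) <= (K `^ (q - 1))%:E * Iq mu q f)%E.
Proof.
move=> q1 K0 hK n f mf If; set r := q / (q - 1) in hK.
have q10 : 0 < q - 1 by rewrite subr_gt0.
have q00 : 0 < q by exact: lt_trans q1.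
have r0 : 0 < r by rewrite divr_gt0.
have r1 : 1 < r by rewrite ltr_pdivlMr // mul1r ltrBlDr ltrDl.
have cf := Iq_lty_cintegrable (ltW q1) mf If.
pose h := analytic n f; have bh : cbounded h := cbounded_tconv _ cf.
have mh : cmeas h by case: bh.
pose G x := (normc (h x) `^ (q - 2))%:C * h x.
have nG x : normc (G x) = normc (h x) `^ (q - 1).
  rewrite /G ComplexField.Normc.normcM normc_real ger0_norm ?powR_ge0 //.
  have [->|h0] := eqVneq (normc (h x)) 0.
    by rewrite mulr0 powR0 // gt_eqF.
  rewrite -[X in _ * X]powRr1 ?normc_ge0 // -powRD; last by rewrite h0 implybT.
  by congr (_ `^ _); ring.
have mG : cmeas G by apply: cmeasM => //; apply: cmeas_real; exact: measurable_normc_powR.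
have bG : cbounded G.
  split=> //; case: bh => _ [M hM]; exists (M `^ (q - 1)) => x; rewrite nG.
  have n0 := normc_ge0 (h x).
  by apply: ge0_ler_powR; rewrite ?nnegrE ?(ltW q10) // (le_trans n0).
have IG : Iq mu r G = Iq mu q h.
  rewrite !IqE; apply: eq_integral => x _.
  by rewrite nG -powRrM mulrC divfK // gt_eqF.
have Ihf : (Iq mu q h < +oo)%E := cbounded_Iq_lty mu (ltW q00) bh.
have cG := cbounded_cintegrable mu bG.
have hG x : h x * conjc (G x) = (normc (h x) `^ q)%:C.
  have -> : conjc (G x) = (normc (h x) `^ (q - 2))%:C * conjc (h x).
    by rewrite /G conjM conjc_real.
  rewrite mulrCA mulCJ -(rmorphM (real_complex R)) /=; congr (_%:C).
  have [->|h0] := eqVneq (normc (h x)) 0.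
    by rewrite expr0n mulr0 powR0 // gt_eqF.
  rewrite -powR_mulrn ?normc_ge0 // -powRD; last by rewrite h0 implybT.
  by congr (_ `^ _); ring.
have mAG := cmeas_analytic n cG; have mJ := cmeasJ mAG.
have cfJ : cintegrable mu (fun x => f x * conjc (analytic n G x)).
  have := cintegrableM (cboundedJ (cbounded_tconv (@analytic_weight R n) cG)) cf.
  by under eq_fun do rewrite mulrC.
have [[F hF] [H hH]] : (exists F, Iq mu q f = F%:E) /\ (exists H, Iq mu q h = H%:E).
  by split; [exists (fine (Iq mu q f))|exists (fine (Iq mu q h))]; rewrite Iq_fineK.
have H0 : 0 <= H by rewrite -lee_fin -hH Iq_ge0.
have F0 : 0 <= F by rewrite -lee_fin -hF Iq_ge0.
have HS : H <= normc (cint mu (fun x => f x * conjc (analytic n G x))).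
  have Reh : cRe (cint mu (fun x => (normc (h x) `^ q)%:C)) = H.
    by rewrite cintE -[H]/(fine H%:E) -hH IqE.
  rewrite -analytic_adjoint // (eq_cint mu hG) -Reh.
  exact: le_trans (ler_norm _) (Re_le_normc _).
have IJ : (Iq mu r (fun x => conjc (analytic n G x)) <= (K * H)%:E)%E.
  rewrite (@eq_Iq _ _ _ _ _ _ (analytic n G)) => [|x]; last exact: normc_conj.
  by apply: le_trans (hK n G mG _) _; rewrite IG // hH EFinM.
rewrite -/h hH hF -EFinM lee_fin.
have [->|Hn] := eqVneq H 0; first by rewrite mulr_ge0 ?powR_ge0.
have Hp : 0 < H by rewrite lt_neqAle eq_sym Hn.
have := hoelder_cint q1 (mulr_gt0 K0 Hp) cfJ mf mJ IJ; rewrite hF -EFinM lee_fin => hS.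
have Hq : H `^ q = H `^ (q - 1) * H.
  by rewrite -{3}(powRr1 H0) -powRD ?subrK // Hn implybT.
have : H `^ q <= (K * H) `^ (q - 1) * F.
  apply: le_trans hS; apply: ge0_ler_powR; rewrite ?nnegrE ?normc_ge0 //; exact: ltW.
have -> : (K * H) `^ (q - 1) * F = H `^ (q - 1) * (K `^ (q - 1) * F).
  by rewrite (powRM _ (ltW K0) H0) [_ * H `^ _]mulrC mulrA.
by rewrite Hq ler_pM2l // powR_gt0.
Qed.

(** M. Riesz's theorem on the circle, with a constant that does not depend on the degree
    [n] of the Fejer mean. *)
Theorem riesz_bound (q : R) : 1 < q -> exists2 K : R, 1 <= K &
  forall n (f : torus -> R[i]), cmeas f -> (Iq mu q f < +oo)%E ->
  (Iq mu q (analytic n f) <= K%:E * Iq mu q f)%E.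
Proof.
move=> q1; have [q2|q2] := leP 2 q; first exact: riesz_ge2.
have q10 : 0 < q - 1 by rewrite subr_gt0.
have r2 : 2 <= q / (q - 1).
  by rewrite ler_pdivlMr //; move: q1 q2; lra.
have [K K1 hK] := riesz_ge2 r2.
exists (K `^ (q - 1)); last exact: (riesz_dual q1 (lt_le_trans ltr01 K1) hK).
by rewrite -[X in X <= _](powRr0 K); apply: ler_powR => //; exact: ltW.
Qed.
End riesz.

(** * The analytic projection on the torus, by tensor products *)

Notation analytic n := (tconv (@analytic_weight _ n)).

(** The operators that can be tensored and bounded. Their kernel is a finite sum of products
    of [tau i] and conjugate characters. *)
Definition finite_rank (R : realType) d (I : finType) (k : I -> 'I_d -> int)
    (tau : I -> torus R d -> R[i]) (f : torus R d -> R[i]) (x : torus R d) : R[i] :=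
  \sum_i fourier f (k i) * tau i x.

Lemma character0 (R : realType) d (x : torus R d) : character (fun=> 0) x = 1.
Proof. by rewrite characterE big1 // => j _; rewrite mul0r circ0. Qed.

Section slices.
Variables (R : realType) (d e : nat).
Local Notation mu := (haar R d).
Local Notation nu := (haar R e).
Implicit Types (f : torus R (d + e) -> R[i]).

(** A Fourier coefficient in the last [e] variables, as a function of the first [d]. *)
Definition slice (l : 'I_e -> int) f (x : torus R d) : R[i] :=
  fourier (fun y => f (tcat (x, y))) l.

Lemma cintegrable_tcat_character f k l : cintegrable (haar R (d + e)) f ->
  cintegrable (mu \x nu)%E (fun z => f (tcat z) * (conjc (character k z.1) * conjc (character l z.2))).
Proof.
move=> cf; have ct := cintegrable_tcat cf.
have b1 : cbounded (fun z : torus R d * torus R e => conjc (character k z.1)).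
  have [m [M hM]] := cboundedJ (@cbounded_character R d k).
  by split; [exact: (cmeas_comp measurable_fst m)|exists M].
have b2 : cbounded (fun z : torus R d * torus R e => conjc (character l z.2)).
  have [m [M hM]] := cboundedJ (@cbounded_character R e l).
  by split; [exact: (cmeas_comp measurable_snd m)|exists M].
have := cintegrableM (cboundedM b1 b2) ct.
by under eq_fun do rewrite mulrC.
Qed.

Lemma cmeas_slice f l : cintegrable (haar R (d + e)) f -> cmeas (slice l f).
Proof.
move=> cf; have := cint_pair_meas (cintegrable_tcat_character (fun=> 0) l cf).
congr cmeas; apply/funext => x; rewrite /slice fourierE; apply: eq_cint => y.
transitivity (f (tcat (x, y)) * (conjc (character (fun=> 0) x) * conjc (character l y))) => //.
by rewrite character0 conjc1 mul1r.
Qed.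

Lemma ae_slice_lty q f : cmeas f -> (Iq (haar R (d + e)) q f < +oo)%E ->
  {ae mu, forall x, (Iq nu q (fun y => f (tcat (x, y))) < +oo)%E}.
Proof.
move=> mf If; apply: (ae_Iq_lty (f := f \o @tcat R d e)); first exact: cmeas_tcat.
by rewrite -Iq_tcat.
Qed.

Lemma cmeas_tcat_pair f x : cmeas f -> cmeas (fun y => f (tcat (x, y)) : R[i]).
Proof. by move=> mf; exact: (cmeas_pairl x (cmeas_tcat mf)). Qed.

Lemma cint_slice f k l : cintegrable (haar R (d + e)) f ->
  cint (mu \x nu)%E (fun z => f (tcat z) * (conjc (character k z.1) * conjc (character l z.2)))
  = fourier (slice l f) k.
Proof.
move=> cf; rewrite cint_prod; last exact: cintegrable_tcat_character.
rewrite fourierE; apply: cint_ae.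
- exact: (cint_pair_meas (cintegrable_tcat_character k l cf)).
- by apply: cmeasM; [exact: cmeas_slice|apply: cmeasJ; exact: cmeas_character].
have [mf If] := cf.
apply: filterS (ae_slice_lty mf If) => x Ix _.
have cx : cintegrable nu (fun y => f (tcat (x, y))) by split => //; exact: cmeas_tcat_pair.
transitivity (cint nu (fun y => conjc (character k x) *
    (f (tcat (x, y)) * conjc (character l y)))).
  by apply: eq_cint => y; exact: mulrCA.
by rewrite cintZ; [rewrite mulrC /slice fourierE|exact: cintegrable_fourier].
Qed.

Lemma fourier_slice f m : cintegrable (haar R (d + e)) f ->
  fourier f m = fourier (slice (fun j => m (rshift d j)) f) (fun i => m (lshift e i)).
Proof.
move=> cf; rewrite -cint_slice // fourierE cint_tcat; last first.
  by case: (cintegrable_fourier m cf).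
by apply: eq_cint => z; congr (_ * _); rewrite -conjM -character_tcat.
Qed.

(** A Fourier coefficient is at most the [L^q] norm of the section, for almost every section. *)
Lemma Iq_slice q f l : 1 < q -> cmeas f -> (Iq (haar R (d + e)) q f < +oo)%E ->
  (Iq mu q (slice l f) <= Iq (haar R (d + e)) q f)%E.
Proof.
move=> q1 mf If; have cf := Iq_lty_cintegrable (ltW q1) mf If.
rewrite (Iq_tcat _ mf) Iq_prod1; last exact: cmeas_tcat.
rewrite IqE; apply: ae_ge0_le_integral => //.
- by move=> x _; rewrite lee_fin powR_ge0.
- by apply/measurable_EFinP; apply: measurable_normc_powR; exact: cmeas_slice.
- by move=> x _; exact: Iq_ge0.
- exact: (measurable_Iq_pair1 nu q (cmeas_tcat mf)).
- apply: filterS (ae_slice_lty mf If) => x Ix _.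
  have mx := cmeas_tcat_pair x mf; have cx := Iq_lty_cintegrable (ltW q1) mx Ix.
  rewrite /slice fourierE; apply: (le_trans (normc_cint_powR_le q1 (cintegrable_fourier l cx))).
  rewrite (@eq_Iq _ _ _ _ _ _ (fun y => f (tcat (x, y)))) // => y.
  by rewrite ComplexField.Normc.normcM characterJ normc_character mulr1.
Qed.

(** The tensor product of two finite-rank operators is the second, applied in the last [e]
    variables for fixed [x], followed by the first, applied in the first [d] variables for
    fixed [y]. The two hypotheses bound these two steps, slice by slice; the bounds integrate
    to the product bound. The hypotheses only concern the slices that occur, which lets the
    operators be bounded on a subspace alone. *)
Lemma tensor_bound q K1 K2 f (I J : finType) (k : I -> 'I_d -> int) (l : J -> 'I_e -> int)
    (tau : I -> torus R d -> R[i]) (sig : J -> torus R e -> R[i]) :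
  1 < q -> 0 <= K1 -> 0 <= K2 -> cmeas f -> (Iq (haar R (d + e)) q f < +oo)%E ->
  (forall i, cmeas (tau i)) -> (forall j, cmeas (sig j)) ->
  {ae mu, forall x, (Iq nu q (finite_rank l sig (fun y => f (tcat (x, y)))) <=
                     K2%:E * Iq nu q (fun y => f (tcat (x, y))))%E} ->
  (forall y, (Iq mu q (finite_rank k tau (fun x => finite_rank l sig (fun y => f (tcat (x, y))) y)) <=
              K1%:E * Iq mu q (fun x => finite_rank l sig (fun y => f (tcat (x, y))) y))%E) ->
  (Iq (mu \x nu)%E q (fun z => \sum_i \sum_j
      fourier (slice (l j) f) (k i) * (tau i z.1 * sig j z.2))%R
    <= (K1 * K2)%:E * Iq (haar R (d + e)) q f)%E.
Proof.
move=> q1 K10 K20 mf If mt ms h2 h1; have cf := Iq_lty_cintegrable (ltW q1) mf If.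
pose H (z : torus R d * torus R e) := finite_rank l sig (fun y => f (tcat (z.1, y))) z.2.
have mH : cmeas H.
  apply: cmeas_sum => j _; apply: cmeasM; last exact: (cmeas_comp measurable_snd (ms j)).
  exact: (cmeas_comp measurable_fst (cmeas_slice (l j) cf)).
have HE : (Iq (mu \x nu)%E q H <= K2%:E * Iq (haar R (d + e)) q f)%E.
  have mft := cmeas_tcat mf.
  rewrite (Iq_tcat _ mf) !Iq_prod1 // -ge0_integralZl ?lee_fin //; try by
    [exact: measurable_Iq_pair1|move=> x _; exact: Iq_ge0].
  apply: ae_ge0_le_integral => //.
  - by move=> x _; exact: Iq_ge0.
  - exact: measurable_Iq_pair1.
  - by move=> x _; rewrite mule_ge0 ?Iq_ge0 ?lee_fin.
  - by apply: measurable_funeM; exact: measurable_Iq_pair1.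
  - by apply: filterS h2 => x hx _.
rewrite EFinM -muleA; apply: (@le_trans _ _ (K1%:E * Iq (mu \x nu)%E q H)%E); last first.
  by apply: lee_wpmul2l => //; rewrite lee_fin.
have mZ : cmeas (fun z : torus R d * torus R e => \sum_i \sum_j
      fourier (slice (l j) f) (k i) * (tau i z.1 * sig j z.2))%R.
  apply: cmeas_sum => i _; apply: cmeas_sum => j _; apply: cmeasZ.
  by apply: cmeasM; [exact: (cmeas_comp measurable_fst (mt i))|exact: (cmeas_comp measurable_snd (ms j))].
rewrite !Iq_prod2 // -ge0_integralZl ?lee_fin //; try by
  [exact: measurable_Iq_pair2|move=> x _; exact: Iq_ge0].
apply: ge0_le_integral => //.
- by move=> x _; exact: Iq_ge0.
- exact: (measurable_Iq_pair2 mu q mZ).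
- by apply: measurable_funeM; exact: (measurable_Iq_pair2 mu q mH).
move=> y _; apply: le_trans (h1 y); rewrite le_eqVlt; apply/orP; left; apply/eqP.
apply: eq_Iq => x /=; congr normc; apply: eq_bigr => i _.
rewrite /finite_rank fourier_sum => [|j _]; last first.
  have := cintegrableZ (sig j y) (Iq_lty_cintegrable (ltW q1) (cmeas_slice (l j) cf)
    (le_lt_trans (Iq_slice (l j) q1 mf If) If)).
  by under eq_fun do rewrite mulrC.
rewrite mulr_suml; apply: eq_bigr => j _.
have -> : fourier (fun x0 => fourier (fun y0 => f (tcat (x0, y0))) (l j) * sig j y) (k i) =
  sig j y * fourier (slice (l j) f) (k i).
  rewrite -fourierZ; last first.
    exact: (Iq_lty_cintegrable (ltW q1) (cmeas_slice (l j) cf)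
      (le_lt_trans (Iq_slice (l j) q1 mf If) If)).
  by congr fourier; apply/funext => x0; rewrite mulrC.
by rewrite mulrA [RHS]mulrC mulrCA mulrA mulrAC mulrC mulrA.
Qed.
End slices.

Section analytic_projection.
Variable R : realType.

Lemma tconv_finite_rank d n (w : 'I_n * 'I_n -> R) (f : torus R d -> R[i]) x :
  cintegrable (haar R d) f -> tconv w f x =
  finite_rank (@freq d n) (fun s x => weight w s * character (freq s) x) f x.
Proof. by move=> cf; rewrite tconvE //; apply: eq_bigr => s _; rewrite mulrCA mulrA. Qed.

(** The convolution kernel of the product torus is the product of the kernels. *)
Lemma tconv_tcat d e n (w : 'I_n * 'I_n -> R) (f : torus R (d + e) -> R[i]) z :
  cintegrable (haar R (d + e)) f -> tconv w f (tcat z) =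
  \sum_s \sum_t fourier (slice (freq t) f) (freq s) *
    ((weight w s * character (freq s) z.1) * (weight w t * character (freq t) z.2)).
Proof.
move=> cf; have [mf _] := cf; rewrite /tconv cint_tcat; last first.
  by apply: cmeasM => //; case: (cbounded_torus_ker w (tcat z)).
pose a s t : R[i] := (weight w s * character (freq s) z.1) * (weight w t * character (freq t) z.2).
rewrite (@eq_cint _ _ _ _ _ (fun y => \sum_s \sum_t a s t *
  (f (tcat y) * (conjc (character (freq s) y.1) * conjc (character (freq t) y.2))))); last first.
  move=> y; suff: torus_ker w (tcat z) (tcat y) * f (tcat y) = \sum_s \sum_t a s t *
    (f (tcat y) * (conjc (character (freq s) y.1) * conjc (character (freq t) y.2))) by [].
  rewrite torus_ker_tcat !torus_kerE big_distrlr mulr_suml; apply: eq_bigr => s _.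
  have AC (u v u' v' r s' t : R[i]) :
    u * (v * v') * (u' * (r * s')) * t = u * v * (u' * r) * (t * (v' * s')) by ring.
  by rewrite mulr_suml; apply: eq_bigr => t _; exact: AC.
rewrite cint_sum => [|s _]; last first.
  by apply: cintegrable_sum => t _; apply: cintegrableZ; exact: cintegrable_tcat_character.
apply: eq_bigr => s _; rewrite cint_sum => [|t _]; last first.
  by apply: cintegrableZ; exact: cintegrable_tcat_character.
apply: eq_bigr => t _; rewrite cintZ; last exact: cintegrable_tcat_character.
by rewrite cint_slice // mulrC.
Qed.

Lemma cmeas_weight_character d n (w : 'I_n * 'I_n -> R) (s : {ffun 'I_d -> 'I_n * 'I_n}) :
  cmeas (fun x => weight w s * character (freq s) x).
Proof. by apply: cmeasZ; exact: cmeas_character. Qed.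

Lemma analytic_torus0 n (f : torus R 0 -> R[i]) q : 1 < q -> cmeas f ->
  (Iq (haar R 0) q f < +oo)%E -> (Iq (haar R 0) q (analytic n f) <= Iq (haar R 0) q f)%E.
Proof.
move=> q1 mf If; rewrite (@eq_Iq _ _ _ _ _ _ (fun=> cint (haar R 0) f)).
  by rewrite Iq_cst; apply: normc_cint_powR_le => //; exact: Iq_lty_cintegrable (ltW q1) mf If.
by move=> x; congr normc; apply: eq_cint => y; rewrite /torus_ker big_ord0 mul1r.
Qed.

(** The projection on [1 + d] variables is the tensor product of the projections on [1] and
    on [d] variables, so the constant is multiplied by [K] in each dimension. *)
Theorem analytic_bound (q : R) : 1 < q -> exists2 K : R, 1 <= K &
  forall d n (f : torus R d -> R[i]), cmeas f -> (Iq (haar R d) q f < +oo)%E ->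
  (Iq (haar R d) q (analytic n f) <= (K ^+ d)%:E * Iq (haar R d) q f)%E.
Proof.
move=> q1; have [K K1 hK] := riesz_bound q1; exists K => //.
have K0 : 0 < K by exact: lt_le_trans K1.
elim=> [n f mf If|d IH n f mf If]; first by rewrite expr0 mul1e; exact: analytic_torus0.
have q0 : 0 <= q by rewrite ltW // (lt_trans _ q1).
pose g : torus R (1 + d) -> R[i] := f.
have cg : cintegrable (haar R (1 + d)) g := Iq_lty_cintegrable (ltW q1) mf If.
rewrite -[Iq _ _ _]/(Iq (haar R (1 + d)) q (tconv (@analytic_weight R n) g)).
rewrite Iq_tcat; last by case: (cbounded_tconv (@analytic_weight R n) cg).
have gE (z : torus R 1 * torus R d) := congr1 (@normc R) (tconv_tcat (@analytic_weight R n) z cg).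
rewrite (eq_Iq _ _ gE).
rewrite exprS; 
apply: (@tensor_bound R 1 d q K (K ^+ d) g _ _ (@freq 1 n.+1) (@freq d n.+1)
  (fun s x => weight (@analytic_weight R n) s * character (freq s) x)
  (fun s x => weight (@analytic_weight R n) s * character (freq s) x) q1 (ltW K0) _ mf If).
- by rewrite exprn_ge0 // ltW.
- by move=> s; exact: cmeas_weight_character.
- by move=> s; exact: cmeas_weight_character.
- apply: filterS (@ae_slice_lty R 1 d q g mf If) => x Ix.
  have mx := @cmeas_tcat_pair R 1 d g x mf; have cx := Iq_lty_cintegrable (ltW q1) mx Ix.
  have xE y := congr1 (@normc R) (tconv_finite_rank (@analytic_weight R n) y cx).
  rewrite -(eq_Iq _ _ xE).
  exact: IH.
- move=> y; set h := (X in finite_rank _ _ X).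
  have mh : cmeas h.
    apply: cmeas_sum => j _; have := cmeasZ (weight (@analytic_weight R n) j * character (freq j) y)
      (cmeas_slice (freq j) cg).
    by under eq_fun do rewrite mulrC.
  (* if the integral is infinite, the bound holds because [K > 0] *)
  have [Ih|] := ltP (Iq (haar R 1) q h) +oo%E.
    have ch := Iq_lty_cintegrable (ltW q1) mh Ih.
    have hE z := congr1 (@normc R) (tconv_finite_rank (@analytic_weight R n) z ch).
    rewrite -(eq_Iq _ _ hE).
    exact: hK.
  by rewrite leye_eq => /eqP ->; rewrite mulry gtr0_sg // mul1e leey.
Qed.
End analytic_projection.

(** * Hardy functions *)

Section hardy_functions.
Variables (R : realType) (d : nat).
Local Notation torus := (torus R d).
Local Notation mu := (haar R d).
Implicit Types (f g : torus -> R[i]) (q : R).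

(** Membership in the Hardy space in terms of [Iq], which spares the roots of the norm. *)
Definition hardyI q f := [/\ cmeas f, (Iq mu q f < +oo)%E &
  forall k, (exists j, k j < 0) -> fourier f k = 0].

Lemma CLnormE q f : 0 < q -> CLnorm q%:E f = (Iq mu q f `^ q^-1)%E.
Proof.
move=> q0; have -> : Iq mu q f = (CLnorm q%:E f `^ q)%E.
  rewrite /CLnorm powR_Lnorm ?gt_eqF // IqE; apply: eq_integral => x _.
  by rewrite abse_EFin poweR_EFin ger0_norm ?normc_ge0.
by rewrite -poweRrM mulfV ?gt_eqF // poweRe1 // /CLnorm Lnorm_ge0.
Qed.

Lemma poweR_le (x y : \bar R) (r : R) : 0 < r -> (0 <= x)%E -> (0 <= y)%E ->
  (x `^ r <= y `^ r)%E = (x <= y)%E.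
Proof.
have mono (s : R) (u v : \bar R) : 0 < s -> (0 <= u)%E -> (0 <= v)%E -> (u <= v)%E ->
    (u `^ s <= v `^ s)%E.
  move=> s0 u0 v0 uv.
  by apply: gt0_ler_poweR; rewrite ?(ltW s0) // in_itv /= ?u0 ?v0 leey.
move=> r0 x0 y0; apply/idP/idP; last exact: mono.
move=> /(mono r^-1 _ _ _ (poweR_ge0 _ _) (poweR_ge0 _ _)).
by rewrite -!poweRrM mulfV ?gt_eqF // !poweRe1 //; apply; rewrite invr_gt0.
Qed.

Lemma CLnorm_le q f (B : R) : 0 < q -> 0 <= B ->
  (CLnorm q%:E f <= (B `^ q^-1)%:E)%E = (Iq mu q f <= B%:E)%E.
Proof.
by move=> q0 B0; rewrite CLnormE // -poweR_EFin poweR_le ?invr_gt0 ?Iq_ge0 ?lee_fin.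
Qed.

Lemma CLnorm_le1 q f : 0 < q -> (CLnorm q%:E f <= 1)%E = (Iq mu q f <= 1)%E.
Proof. by move=> q0; have := CLnorm_le f q0 ler01; rewrite powR1. Qed.

Lemma hardyP q f : 0 < q -> hardy q%:E f <-> hardyI q f.
Proof.
move=> q0; have E : (CLnorm q%:E f < +oo)%E = (Iq mu q f < +oo)%E.
  rewrite CLnormE //; apply/idP/idP; last exact: poweR_lty.
  by apply: lty_poweRy; rewrite invr_eq0 gt_eqF.
by split=> -[mf If hf]; split=> //; rewrite ?E // -?E.
Qed.

Lemma hardyI_mono r q f : 0 <= r -> r <= q -> hardyI q f -> hardyI r f.
Proof. by move=> r0 rq [mf If hf]; split => //; apply: Iq_mono_lty If. Qed.

Lemma hardyI_cintegrable q f : 1 <= q -> hardyI q f -> cintegrable mu f.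
Proof. by move=> q1 [mf If _]; exact: Iq_lty_cintegrable If. Qed.

Lemma hardyI0 q : 0 < q -> hardyI q (fun=> 0).
Proof.
move=> q0; split=> [||k _]; first exact: cmeas_cst.
  by rewrite Iq_cst ltry.
rewrite fourierE; under eq_cint do rewrite mul0r.
exact: cint_cst.
Qed.

Lemma hardyID q f g : 1 <= q -> hardyI q f -> hardyI q g -> hardyI q (fun x => f x + g x).
Proof.
move=> q1 hf hg; have cf := hardyI_cintegrable q1 hf; have cg := hardyI_cintegrable q1 hg.
case: hf hg => mf If hf [mg Ig hg]; split; [exact: cmeasD|exact: IqD_lty|move=> k kn].
by rewrite fourierD // hf // hg // addr0.
Qed.

Lemma hardyIZ q a f : 1 <= q -> hardyI q f -> hardyI q (fun x => a * f x).
Proof.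
move=> q1 hf; have cf := hardyI_cintegrable q1 hf.
case: hf => mf If hf; split; [exact: cmeasZ|exact: IqZ_lty|move=> k kn].
by rewrite fourierZ // hf // mulr0.
Qed.

Lemma hardyI_sum q (I : Type) (s : seq I) (F : I -> torus -> R[i]) : 1 <= q ->
  (forall i, hardyI q (F i)) -> hardyI q (fun x => \sum_(i <- s) F i x).
Proof.
move=> q1 hF; have q0 : 0 < q by exact: lt_le_trans q1.
elim: s => [|i s IH].
  by under eq_fun do rewrite big_nil; exact: hardyI0.
by under eq_fun do rewrite big_cons; exact: hardyID.
Qed.

Lemma hardyI_character q k : 0 < q -> (forall j, 0 <= k j) -> hardyI q (character k).
Proof.
move=> q0 k0; split; [exact: cmeas_character|exact: (cbounded_Iq_lty _ (ltW q0) (@cbounded_character R d k))|].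
move=> l [j lj]; rewrite fourier_character; case: forallP => // /(_ j) /eqP kl.
by move: (k0 j); rewrite kl leNgt lj.
Qed.

Lemma hardyI_tconv q n (w : 'I_n * 'I_n -> R) f : 1 <= q -> hardyI q f -> hardyI q (tconv w f).
Proof.
move=> q1 hf; have cf := hardyI_cintegrable q1 hf; have cb := cbounded_tconv w cf.
split; [by case: cb|by apply: cbounded_Iq_lty => //; rewrite ltW // (lt_le_trans ltr01 q1)|].
move=> k kn; rewrite fourier_tconv //; apply: big1 => s _.
case: forallP => [sk|_]; last by rewrite mulr0.
case: hf => _ _ -> //; first by rewrite mulr0 mul0r.
by case: kn => j kj; exists j; rewrite (eqP (sk j)).
Qed.

Lemma hardyI_analytic q n f : 0 <= q -> cintegrable mu f -> hardyI q (analytic n f).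
Proof.
move=> q0 cf; have cb := cbounded_tconv (@analytic_weight R n) cf.
split; [by case: cb|exact: cbounded_Iq_lty|move=> k [j kj]].
rewrite fourier_tconv //; apply: big1 => s _.
case: forallP => [/(_ j)/eqP sk|_]; last by rewrite mulr0.
have [->|w0] := eqVneq (weight (@analytic_weight R n) s) 0; first by rewrite !mul0r.
by move: kj; rewrite -sk /freq ltNge subr_ge0 lez_nat (weight_analytic w0).
Qed.

(** A Hardy function has no Fourier coefficients where the two weights differ. *)
Lemma fejer_analytic n f x : hardyI 1 f -> analytic n f x = fejer n f x.
Proof.
move=> hf; have cf := hardyI_cintegrable (lexx _) hf.
rewrite /fejer !tconvE //; apply: eq_bigr => s _; congr (_ * _).
have [s0|] := boolP [forall j, 0 <= freq s j].
  congr (_ * _); rewrite /weight; congr (_%:C); apply: eq_bigr => j _.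
  move/forallP: s0 => /(_ j); rewrite /freq subr_ge0 lez_nat /analytic_weight => ->.
  by rewrite mul1r.
rewrite negb_forall => /existsP[j]; rewrite -ltNge => sj.
by case: hf => _ _ -> //; [rewrite !mulr0|exists j].
Qed.
End hardy_functions.

(** * Witnesses: finite-rank operators and the interpolation constant *)

Section finite_rank_operators.
Variables (R : realType) (d : nat).
Local Notation torus := (torus R d).
Local Notation mu := (haar R d).
Implicit Types (f g : torus -> R[i]) (q : R).

Definition Iq_contraction q (T : (torus -> R[i]) -> torus -> R[i]) :=
  forall f, hardyI q f -> (Iq mu q (T f) <= Iq mu q f)%E.

Lemma hardyI_finite_rank r q (I : finType) (k : I -> 'I_d -> int) tau f : 1 <= r -> r <= q ->
  (forall i, hardyI q (tau i)) -> hardyI r (finite_rank k tau f).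
Proof.
move=> r1 rq ht; apply: hardyI_sum => // i; apply: hardyIZ => //.
by apply: hardyI_mono (ht i) => //; exact: le_trans r1.
Qed.

Lemma finite_rankD (I : finType) (k : I -> 'I_d -> int) tau f g x :
  cintegrable mu f -> cintegrable mu g ->
  finite_rank k tau (fun y => f y + g y) x = finite_rank k tau f x + finite_rank k tau g x.
Proof.
move=> cf cg; rewrite -big_split; apply: eq_bigr => i _.
by rewrite fourierD // mulrDl.
Qed.

Lemma finite_rankZ (I : finType) (k : I -> 'I_d -> int) tau a f x : cintegrable mu f ->
  finite_rank k tau (fun y => a * f y) x = a * finite_rank k tau f x.
Proof.
move=> cf; rewrite mulr_sumr; apply: eq_bigr => i _.
by rewrite fourierZ // mulrA.
Qed.

Lemma finite_rank_ae (I : finType) (k : I -> 'I_d -> int) (tau : I -> torus -> R[i]) f g :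
  cmeas f -> cmeas g -> f = g %[ae mu] -> finite_rank k tau f = finite_rank k tau g.
Proof.
move=> mf mg fg; apply/funext => x; apply: eq_bigr => i _.
by rewrite (fourier_ae _ mf mg fg).
Qed.

(** A contraction maps Fejer approximations to approximations. *)
Lemma finite_rank_fejer_cvg q (I : finType) (k : I -> 'I_d -> int) tau f : 1 < q ->
  Iq_contraction q (finite_rank k tau) -> hardyI q f -> forall e : R, 0 < e ->
  exists n, (Iq mu q (fun x => finite_rank k tau f x - finite_rank k tau (fejer n f) x)%R <= e%:E)%E.
Proof.
move=> q1 ht hf e e0; have [mf If _] := hf; have [N hN] := fejer_cvgP q1 mf If e0.
exists N; have hF : hardyI q (fejer N f) by apply: hardyI_tconv => //; exact: ltW.
have hm : hardyI q (fun x => fejer N f x + -1 * f x).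
  by apply: hardyID => //; [exact: ltW|apply: hardyIZ => //; exact: ltW].
apply: le_trans (hN N (leqnn N)); rewrite -IqN.
have := ht _ hm; congr (_ <= _)%E; last by apply: eq_Iq => x; rewrite mulN1r.
have cf := hardyI_cintegrable (ltW q1) hf; have cF := hardyI_cintegrable (ltW q1) hF.
apply: eq_Iq => x; rewrite finite_rankD //; last exact: cintegrableZ.
by rewrite finite_rankZ // mulN1r opprB addrC.
Qed.
End finite_rank_operators.

Section witnesses.
Variables (R : realType) (p1 p p2 : R).
Hypotheses (hp1 : 1 < p1) (hp1p : p1 < p) (hpp2 : p < p2).

(** [A] stands for the [p]-th power of an operator norm. The functions [tau i] are taken in
    the smallest of the three spaces, so that the operator acts on all of them. *)
Definition witness d (A : R) := exists (I : finType) (k : I -> 'I_d -> int)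
    (tau : I -> torus R d -> R[i]) (f : torus R d -> R[i]),
  [/\ forall i, hardyI p2 (tau i),
      Iq_contraction p1 (finite_rank k tau) /\ Iq_contraction p2 (finite_rank k tau),
      hardyI p f, (Iq (haar R d) p f <= 1)%E &
      (A%:E <= Iq (haar R d) p (finite_rank k tau f))%E].

Let hp : 1 < p. Proof. exact: lt_trans hp1p. Qed.
Let hp2 : 1 < p2. Proof. exact: lt_trans hpp2. Qed.
Let p1_gt0 : 0 < p1. Proof. exact: lt_trans ltr01 hp1. Qed.
Let p_gt0 : 0 < p. Proof. exact: lt_trans ltr01 hp. Qed.
Let p2_gt0 : 0 < p2. Proof. exact: lt_trans ltr01 hp2. Qed.
Let p1p2 : p1 <= p2. Proof. exact: ltW (lt_trans hp1p hpp2). Qed.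

Lemma hardy_contraction_finite_rank d q (I : finType) (k : I -> 'I_d -> int) tau :
  1 < q -> q <= p2 -> (forall i, hardyI p2 (tau i)) -> Iq_contraction q (finite_rank k tau) ->
  @hardy_contraction R d q%:E (finite_rank k tau).
Proof.
move=> q1 q2 ht hc; have q0 : 0 < q by exact: lt_trans q1.
split=> [f _|]; first by apply/hardyP => //; apply: hardyI_finite_rank ht => //; exact: ltW.
apply: ge_ereal_sup => _ [f [/(hardyP _ q0) hf f1] <-].
by rewrite CLnorm_le1 //; apply: le_trans (hc f hf) _; rewrite -CLnorm_le1.
Qed.

(** A finite-rank operator is admissible in the supremum that defines the interpolation
    constant. *)
Lemma witness_le d A : 0 <= A -> witness d A ->
  ((A `^ p^-1)%:E <= interp_const R d p1%:E p%:E p2%:E)%E.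
Proof.
move=> A0 [I [k [tau [f [ht [c1 c2] hf f1 hA]]]]].
apply: (@le_trans _ _ (opnorm p%:E (finite_rank k tau))); last first.
  apply: ereal_sup_ubound; exists (finite_rank k tau) => //; split.
  - split=> [g _|g h /(hardyP _ p1_gt0)[mg _ _] /(hardyP _ p1_gt0)[mh _ _] gh|
        g h /(hardyP _ p1_gt0) hg /(hardyP _ p1_gt0) hh|a g /(hardyP _ p1_gt0) hg].
    + by apply/hardyP => //; apply: hardyI_finite_rank ht => //; exact: ltW.
    + by rewrite (finite_rank_ae _ _ mg mh gh); exact: ae_eq_refl.
    + apply: aeW => x _; apply: finite_rankD; exact: hardyI_cintegrable (ltW hp1) _.
    + apply: aeW => x _; apply: finite_rankZ; exact: hardyI_cintegrable (ltW hp1) hg.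
  - exact: hardy_contraction_finite_rank.
  - exact: hardy_contraction_finite_rank.
apply: (@le_trans _ _ (CLnorm p%:E (finite_rank k tau f))).
  by rewrite CLnormE // -poweR_EFin poweR_le ?invr_gt0 ?lee_fin ?Iq_ge0.
apply: ereal_sup_ubound; exists f => //; split; first exact/hardyP.
by rewrite CLnorm_le1.
Qed.

(** Preceded by the analytic projection, the operator acts on all of [L^p1] and [L^p2], with
    bounds [K1 ^ d] and [K2 ^ d], and Marcinkiewicz interpolation applies with a constant that
    does not depend on [d]. On Hardy functions the projection is a Fejer mean, which disappears
    in the limit by [Iq_closed]. *)
Lemma witness_bound : exists2 K : R, 1 <= K & exists2 C : R, 0 < C &
  forall d A, witness d A -> A <= C * K ^+ d.
Proof.
have [K1 K11 h1] := analytic_bound hp1; have [K2 K21 h2] := analytic_bound hp2.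
have K10 : 0 <= K1 by exact: le_trans K11.
have K20 : 0 <= K2 by exact: le_trans K21.
have C0 : 0 < interp_bound p1 p p2 by exact: interp_bound_gt0.
exists (K1 + K2); first by rewrite (le_trans K11) // lerDl.
exists (interp_bound p1 p p2 * 2) => [|d A [I [k [tau [f [ht [c1 c2] hf f1 hA]]]]]].
  by rewrite mulr_gt0.
have B0 : 0 <= interp_bound p1 p p2 * (K1 ^+ d + K2 ^+ d).
  by rewrite mulr_ge0 ?(ltW C0) // addr_ge0 ?exprn_ge0.
apply: (@le_trans _ _ (interp_bound p1 p p2 * (K1 ^+ d + K2 ^+ d))); last first.
  rewrite -mulrA ler_wpM2l ?(ltW C0) // mulr_natl mulr2n.
  by rewrite lerD // lerXn2r ?nnegrE ?addr_ge0 // ?lerDl ?lerDr.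
have hf1 : hardyI p1 f by apply: hardyI_mono hf => //; exact: ltW.
have mfr g : cmeas (finite_rank k tau g) by case: (hardyI_finite_rank k g (ltW hp1) p1p2 ht).
have hn n : (Iq (haar R d) p (finite_rank k tau (fejer n f)) <=
    (interp_bound p1 p p2 * (K1 ^+ d + K2 ^+ d))%:E)%E.
  have -> : fejer n f = analytic n f.
    by apply/funext => x; rewrite fejer_analytic //; apply: hardyI_mono hf1 => //; exact: ltW.
  have [mf If _] := hf.
  apply: (@le_trans _ _ ((interp_bound p1 p p2 * (K1 ^+ d + K2 ^+ d))%:E * Iq (haar R d) p f)%E).
    apply: (@marcinkiewicz _ _ _ _ R (haar R d) (haar R d) p1 p p2
      (fun g => finite_rank k tau (analytic n g))) => //.
    - exact: ltW.
    - by rewrite exprn_ge0.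
    - by rewrite exprn_ge0.
    - move=> g mg Ig; split=> //; apply: le_trans (h1 d n g mg Ig).
      apply: c1; apply: hardyI_analytic; first exact: ltW.
      exact: Iq_lty_cintegrable (ltW hp1) mg Ig.
    - move=> g mg Ig; apply: le_trans (h2 d n g mg Ig).
      apply: c2; apply: hardyI_analytic; first exact: ltW.
      exact: Iq_lty_cintegrable (ltW hp2) mg Ig.
    - move=> g h mg mh Ig Ih; apply: aeW => x _.
      have cg := Iq_lty_cintegrable (ltW hp1) mg Ig.
      have ch := Iq_lty_cintegrable (ltW hp1) mh Ih.
      rewrite -finite_rankD; try by apply: cbounded_cintegrable; exact: cbounded_tconv.
      by congr (finite_rank _ _ _ x); apply/funext => y; exact: tconvD.
  by rewrite -[leRHS]mule1; apply: lee_wpmul2l; rewrite ?lee_fin.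
rewrite -lee_fin; apply: (le_trans hA); apply: (Iq_closed (r := p1)) => //.
- exact: ltW.
- exact: ltW.
move=> e e0; have [n hne] := finite_rank_fejer_cvg hp1 c1 hf1 e0.
by exists (finite_rank k tau (fejer n f)).
Qed.

(** The operator norm only sees the unit ball; the general case follows by homogeneity. The
    scaling is by a number slightly larger than [Iq f], which also covers [Iq f = 0]. *)
Lemma Iq_contraction_hardy d q T : 1 < q -> @hardy_contraction R d q%:E T ->
  (forall a f, hardyI q f -> T (fun x => a * f x) = (fun x => a * T f x) %[ae haar R d]) ->
  Iq_contraction q T.
Proof.
move=> q1 [hT nT] homT f hf; have q0 : 0 < q by exact: lt_trans q1.
have [mf If _] := hf; have hTf : hardyI q (T f) by apply/hardyP => //; apply: hT; exact/hardyP.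
have mTf : cmeas (T f) by case: hTf.
rewrite -(Iq_fineK If); apply/lee_addgt0Pr => e e0.
have r0 : 0 <= fine (Iq (haar R d) q f) by rewrite fine_ge0 // Iq_ge0.
rewrite -EFinD; set t := fine _ + e; have t0 : 0 < t by rewrite ltr_wpDl.
set a : R := t `^ (- q^-1).
have a0 : 0 < a by exact: powR_gt0.
have aq : normc (a%:C : R[i]) `^ q = t^-1.
  rewrite normc_real gtr0_norm // -powRrM mulNr mulVf ?gt_eqF // powRN powRr1 //; exact: ltW.
have haf : hardyI q (fun x => a%:C * f x) by apply: hardyIZ => //; exact: ltW.
have Iaf : (Iq (haar R d) q (fun x => a%:C * f x)%R <= 1)%E.
  rewrite IqZ // aq -(Iq_fineK If) -EFinM lee_fin ler_pdivrMl // mulr1.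
  by rewrite lerDl ltW.
have : (Iq (haar R d) q (T (fun x => a%:C * f x)%R) <= 1)%E.
  rewrite -CLnorm_le1 //; apply: le_trans nT; apply: ereal_sup_ubound.
  by exists (fun x => a%:C * f x) => //; split; [exact/hardyP|rewrite CLnorm_le1].
have mTaf : cmeas (T (fun x => a%:C * f x)).
  by have /(hardyP _ q0)[] := hT _ ((hardyP _ q0).2 haf).
rewrite (Iq_ae q mTaf (cmeasZ _ mTf) (homT a%:C f hf)) IqZ // aq.
rewrite -(@lee_pmul2l _ t%:E) ?lte_fin // muleA -EFinM mulfV ?gt_eqF // mul1e mule1.
exact.
Qed.

Section fejer_truncation.
Variables (d : nat) (T : (torus R d -> R[i]) -> torus R d -> R[i]).
Hypotheses (linT : hardy_linear p1%:E T) (cT1 : hardy_contraction p1%:E T)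
  (cT2 : hardy_contraction p2%:E T).
Local Notation mu := (haar R d).

Let homT a f : hardyI p1 f -> T (fun x => a * f x) = (fun x => a * T f x) %[ae mu].
Proof. by case: linT => _ _ _ h hf; apply: h; exact/hardyP. Qed.
Let addT f g : hardyI p1 f -> hardyI p1 g ->
  T (fun x => f x + g x) = (fun x => T f x + T g x) %[ae mu].
Proof. by case: linT => _ _ h _ hf hg; apply: h; exact/hardyP. Qed.
Let h21 (f : torus R d -> R[i]) : hardyI p2 f -> hardyI p1 f.
Proof. by apply: hardyI_mono => //; exact: ltW. Qed.
Let hT1 f : hardyI p1 f -> hardyI p1 (T f).
Proof. by move=> hf; apply/hardyP => //; case: cT1 => h _; apply: h; exact/hardyP. Qed.
Let hT2 f : hardyI p2 f -> hardyI p2 (T f).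
Proof. by move=> hf; apply/hardyP => //; case: cT2 => h _; apply: h; exact/hardyP. Qed.
Let con1 : Iq_contraction p1 T.
Proof. exact: Iq_contraction_hardy. Qed.
Let con2 : Iq_contraction p2 T.
Proof. by apply: Iq_contraction_hardy => // a f /h21; exact: homT. Qed.

Lemma hardy_linear_sum (I : Type) (s : seq I) (a : I -> R[i]) (F : I -> torus R d -> R[i]) :
  (forall i, hardyI p1 (F i)) ->
  T (fun x => \sum_(i <- s) a i * F i x) = (fun x => \sum_(i <- s) a i * T (F i) x) %[ae mu].
Proof.
move=> hF; have ha i : hardyI p1 (fun x => a i * F i x) by apply: hardyIZ => //; exact: ltW.
elim: s => [|i s IH].
  have h0 : @hardyI R d p1 (fun=> 0) by exact: hardyI0.
  have E : (fun x : torus R d => \sum_(i <- [::]) a i * F i x) = (fun x => 0 * (fun=> 0 : R[i]) x).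
    by apply/funext => x; rewrite big_nil mul0r.
  rewrite E; apply: filterS (homT 0 h0) => x hx Dx.
  by rewrite (hx Dx) mul0r big_nil.
have hs : hardyI p1 (fun x => \sum_(i <- s) a i * F i x) by apply: hardyI_sum => //; exact: ltW.
have -> : (fun x => \sum_(j <- i :: s) a j * F j x) =
    (fun x => a i * F i x + \sum_(j <- s) a j * F j x).
  by apply/funext => x; rewrite big_cons.
apply: filterS3 (addT (ha i) hs) (homT (a i) (hF i)) IH => x h1 h2 h3 Dx.
by rewrite (h1 Dx) (h2 Dx) (h3 Dx) big_cons.
Qed.

(** The value of [T] composed with the Fejer mean at the character of frequency [freq s].
    Frequencies outside the cone, where [T] means nothing, are given the value [0]; Hardy
    functions have no coefficients there. *)
Definition fejer_coef n (s : {ffun 'I_d -> 'I_n.+1 * 'I_n.+1}) (x : torus R d) : R[i] :=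
  if [forall j, 0 <= freq s j]
  then weight (@fejer_weight R n) s * T (character (freq s)) x else 0.

Lemma hardyI_fejer_coef n s : hardyI p2 (@fejer_coef n s).
Proof.
rewrite /fejer_coef; case: forallP => [s0|_]; last exact: hardyI0.
apply: hardyIZ; first exact: ltW.
by apply: hT2; apply: hardyI_character.
Qed.

Lemma finite_rank_fejer_coef n g : hardyI p1 g ->
  finite_rank (@freq d n.+1) (@fejer_coef n) g = T (fejer n g) %[ae mu].
Proof.
move=> hg; have cg := hardyI_cintegrable (ltW hp1) hg.
pose s' (s : {ffun 'I_d -> 'I_n.+1 * 'I_n.+1}) := [forall j, 0 <= freq s j].
pose F s (x : torus R d) : R[i] := if s' s then character (freq s) x else 0.
pose a s := weight (@fejer_weight R n) s * fourier g (freq s).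
have hF s : hardyI p1 (F s).
  rewrite /F /s'; case: forallP => [s0|_]; last exact: hardyI0.
  exact: hardyI_character.
have -> : fejer n g = fun x => \sum_s a s * F s x.
  apply/funext => x; rewrite /fejer tconvE //; apply: eq_bigr => s _; rewrite /F.
  case: ifPn => // ; rewrite negb_forall => /existsP[j]; rewrite -ltNge => sj.
  by case: hg => _ _ hg0; rewrite /a hg0 ?mulr0 ?mul0r //; exists j.
apply: filterS (hardy_linear_sum (index_enum _) a hF) => x hx Dx.
rewrite (hx Dx); apply: eq_bigr => s _; rewrite /fejer_coef /a /F -/(s' s).
case: ifPn => [_|]; first by rewrite mulrA [fourier g _ * _]mulrC.
rewrite negb_forall => /existsP[j]; rewrite -ltNge => sj.
by case: hg => _ _ hg0; rewrite hg0 ?mulr0 ?mul0r //; exists j.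
Qed.

Lemma Iq_finite_rank_fejer_coef n q g : hardyI p1 g ->
  Iq mu q (finite_rank (@freq d n.+1) (@fejer_coef n) g) = Iq mu q (T (fejer n g)).
Proof.
move=> hg; apply: Iq_ae (finite_rank_fejer_coef n hg).
  by case: (hardyI_finite_rank (@freq d n.+1) g (ltW hp1) p1p2 (@hardyI_fejer_coef n)).
by have [] : hardyI p1 (T (fejer n g)) by apply: hT1; apply: hardyI_tconv => //; exact: ltW.
Qed.

Lemma Iq_contraction_fejer_coef n : Iq_contraction p1 (finite_rank (@freq d n.+1) (@fejer_coef n)) /\
  Iq_contraction p2 (finite_rank (@freq d n.+1) (@fejer_coef n)).
Proof.
split=> f hf; have [mf If _] := hf.
  rewrite Iq_finite_rank_fejer_coef //; apply: le_trans (Iq_fejer_le n hp1 mf If).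
  by apply: con1; apply: hardyI_tconv => //; exact: ltW.
rewrite Iq_finite_rank_fejer_coef; last exact: h21.
apply: le_trans (Iq_fejer_le n hp2 mf If).
by apply: con2; apply: hardyI_tconv => //; exact: ltW.
Qed.

(** If the Fejer truncations of [T] all stayed below [A] at [f], then so would their limit
    [T f], by [Iq_closed]; hence one of them is a witness. *)
Lemma witness_operator A f : 0 <= A -> hardyI p f -> (Iq mu p f <= 1)%E ->
  (A%:E < Iq mu p (T f))%E -> witness d A.
Proof.
move=> A0 hf f1; rewrite ltNge; apply: contraNP => nW.
have hf1 : hardyI p1 f by apply: hardyI_mono hf => //; exact: ltW.
have hn n : (Iq mu p (T (fejer n f)) <= A%:E)%E.
  rewrite leNgt; apply/negP => lt; apply: nW.
  exists {ffun 'I_d -> 'I_n.+1 * 'I_n.+1}, (@freq d n.+1), (@fejer_coef n), f.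
  split=> //; [exact: hardyI_fejer_coef|exact: Iq_contraction_fejer_coef|].
  by rewrite Iq_finite_rank_fejer_coef // ltW.
have hTf := hT1 hf1; have [mTf _ _] := hTf.
apply: (Iq_closed (r := p1)) => //; [exact: ltW|exact: ltW|move=> e e0].
have [mf If _] := hf1; have [N hN] := fejer_cvgP hp1 mf If e0.
have hF : hardyI p1 (fejer N f) by apply: hardyI_tconv => //; exact: ltW.
have hmf : hardyI p1 (fun x => -1 * fejer N f x) by apply: hardyIZ => //; exact: ltW.
have hTF := hT1 hF; exists (T (fejer N f)); first by case: hTF.
split=> //; apply: le_trans (hN N (leqnn N)); rewrite -[X in (_ <= X)%E]IqN.
have hD : hardyI p1 (fun x => f x + -1 * fejer N f x) by apply: hardyID => //; exact: ltW.
have -> : Iq mu p1 (fun x => T f x - T (fejer N f) x) = Iq mu p1 (T (fun x => f x + -1 * fejer N f x)).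
  apply: Iq_ae; [|by case: (hT1 hD)|].
    by case: hTF => mTF _ _; exact: cmeasB.
  apply: filterS2 (addT hf1 hmf) (homT (-1) hF) => x h1 h2 Dx.
  by rewrite (h1 Dx) (h2 Dx) mulN1r.
apply: (le_trans (con1 hD)); rewrite (@eq_Iq _ _ _ _ _ _ (fun x => - (fejer N f x - f x))) // => x.
by rewrite mulN1r opprB.
Qed.
End fejer_truncation.

Lemma witness_gt d A : 0 <= A ->
  ((A `^ p^-1)%:E < interp_const R d p1%:E p%:E p2%:E)%E -> witness d A.
Proof.
move=> A0 /ereal_sup_gt[_ [T [linT c1 c2] <-]] /ereal_sup_gt[_ [f [/(hardyP _ p_gt0) hf f1] <-]].
rewrite ltNge CLnorm_le // -ltNge => hA.
by apply: (witness_operator linT c1 c2 A0 hf) => //; rewrite -CLnorm_le1.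
Qed.
End witnesses.

(** * Tensor products of witnesses *)

Section tensor.
Variables (R : realType) (d e : nat).
Local Notation mu := (haar R d).
Local Notation nu := (haar R e).
Implicit Types (f : torus R (d + e) -> R[i]) (q : R).

Definition torus_left (x : torus R (d + e)) : torus R d := [tuple tnth x (lshift e i) | i < d].
Definition torus_right (x : torus R (d + e)) : torus R e := [tuple tnth x (rshift d i) | i < e].

Lemma torus_left_tcat z : torus_left (tcat z) = z.1.
Proof. by apply: eq_from_tnth => i; rewrite tnth_mktuple tnth_tcatl. Qed.

Lemma torus_right_tcat z : torus_right (tcat z) = z.2.
Proof. by apply: eq_from_tnth => i; rewrite tnth_mktuple tnth_tcatr. Qed.

Lemma measurable_torus_left : measurable_fun setT torus_left.
Proof.
apply/measurable_fun_tnthP => i.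
have -> : (@tnth _ _ ^~ i) \o torus_left = (fun x => tnth x (lshift e i)).
  by apply/funext => x; exact: tnth_mktuple.
exact: measurable_tnth.
Qed.

Lemma measurable_torus_right : measurable_fun setT torus_right.
Proof.
apply/measurable_fun_tnthP => i.
have -> : (@tnth _ _ ^~ i) \o torus_right = (fun x => tnth x (rshift d i)).
  by apply/funext => x; exact: tnth_mktuple.
exact: measurable_tnth.
Qed.

(** The frequency of the product of two characters in separate variables. *)
Definition join_freq (k : 'I_d -> int) (l : 'I_e -> int) (j : 'I_(d + e)) : int :=
  match fintype.split j with inl i => k i | inr i => l i end.

Lemma join_freql k l i : join_freq k l (lshift e i) = k i.
Proof. by rewrite /join_freq -[lshift e i]/(unsplit (inl i)) unsplitK. Qed.

Lemma join_freqr k l i : join_freq k l (rshift d i) = l i.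
Proof. by rewrite /join_freq -[rshift d i]/(unsplit (inr i)) unsplitK. Qed.

Lemma join_freq_lshift k l : (fun i => join_freq k l (lshift e i)) = k.
Proof. by apply/funext => i; rewrite join_freql. Qed.

Lemma join_freq_rshift k l : (fun i => join_freq k l (rshift d i)) = l.
Proof. by apply/funext => i; rewrite join_freqr. Qed.

Definition tensor_fun (u : torus R d -> R[i]) (v : torus R e -> R[i]) x : R[i] :=
  u (torus_left x) * v (torus_right x).

Lemma tensor_fun_tcat u v z : tensor_fun u v (tcat z) = u z.1 * v z.2.
Proof. by rewrite /tensor_fun torus_left_tcat torus_right_tcat. Qed.

Lemma cmeas_tensor_fun u v : cmeas u -> cmeas v -> cmeas (tensor_fun u v).
Proof.
move=> mcu mv; apply: cmeasM.
  exact: (cmeas_comp measurable_torus_left mcu).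
exact: (cmeas_comp measurable_torus_right mv).
Qed.

Lemma Iq_tensor_fun q u v : cmeas u -> cmeas v ->
  Iq (haar R (d + e)) q (tensor_fun u v) = (Iq mu q u * Iq nu q v)%E.
Proof.
move=> mcu mv; rewrite Iq_tcat; last exact: cmeas_tensor_fun.
rewrite -(Iq_prodM mu nu q mcu mv); apply: eq_Iq => z.
by congr normc; exact: tensor_fun_tcat.
Qed.

Lemma fourier_tensor_fun u v m : cintegrable mu u -> cintegrable nu v ->
  fourier (tensor_fun u v) m =
  fourier u (fun i => m (lshift e i)) * fourier v (fun i => m (rshift d i)).
Proof.
move=> cu cv; have [mcu _] := cu; have [mv _] := cv.
rewrite [LHS]fourierE cint_tcat; last first.
  by apply: cmeasM; [exact: cmeas_tensor_fun|apply: cmeasJ; exact: cmeas_character].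
rewrite !fourierE -cint_prodM; try exact: cintegrable_fourier.
apply: eq_cint => z.
suff: tensor_fun u v (tcat z) * conjc (character m (tcat z)) =
  u z.1 * conjc (character (fun i => m (lshift e i)) z.1) *
  (v z.2 * conjc (character (fun i => m (rshift d i)) z.2)) by [].
by rewrite tensor_fun_tcat character_tcat conjM mulrACA.
Qed.

Lemma hardyI_tensor_fun q u v : 1 <= q -> hardyI q u -> hardyI q v -> hardyI q (tensor_fun u v).
Proof.
move=> q1 hu hv; have cu := hardyI_cintegrable q1 hu; have cv := hardyI_cintegrable q1 hv.
case: hu hv => mcu Iu hu [mv Iv hv]; split; first exact: cmeas_tensor_fun.
  by rewrite Iq_tensor_fun // -(Iq_fineK Iu) -(Iq_fineK Iv) -EFinM ltry.
move=> m [j mj]; rewrite fourier_tensor_fun //.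
case: (fintype.splitP j) => i ij.
  rewrite hu ?mul0r //; exists i; congr (_ < _): mj; congr m; exact: val_inj.
rewrite hv ?mulr0 //; exists i; congr (_ < _): mj; congr m; exact: val_inj.
Qed.

Lemma finite_rank_tensor_fun (I J : finType) (k : I -> 'I_d -> int) (l : J -> 'I_e -> int)
    (tau : I -> torus R d -> R[i]) (sig : J -> torus R e -> R[i]) f z :
  cintegrable (haar R (d + e)) f ->
  finite_rank (fun ij : I * J => join_freq (k ij.1) (l ij.2)) (fun ij => tensor_fun (tau ij.1) (sig ij.2)) f (tcat z)
  = \sum_i \sum_j fourier (slice (l j) f) (k i) * (tau i z.1 * sig j z.2).
Proof.
move=> cf; rewrite /finite_rank pair_bigA; apply: eq_bigr => -[i j] _ /=.
by rewrite tensor_fun_tcat fourier_slice // join_freq_lshift join_freq_rshift.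
Qed.

(** Uniqueness of Fourier coefficients, as all Fejer means vanish. *)
Lemma fourier0_ae n q (g : torus R n -> R[i]) : 1 < q -> cmeas g -> (Iq (haar R n) q g < +oo)%E ->
  (forall k, fourier g k = 0) -> g = (fun=> 0) %[ae haar R n].
Proof.
move=> q1 mg Ig g0; have cg := Iq_lty_cintegrable (ltW q1) mg Ig.
have I0 : Iq (haar R n) q g = 0%E.
  apply/eqP; rewrite eq_le Iq_ge0 andbT; apply/lee_addgt0Pr => a a0; rewrite add0e.
  have [N /(_ N (leqnn N))] := fejer_cvgP q1 mg Ig a0.
  congr (_ <= _)%E; rewrite -IqN; apply: eq_Iq => x; congr normc.
  rewrite /fejer tconvE // big1 => [|s _]; last by rewrite g0 mulr0 mul0r.
  by rewrite sub0r opprK.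
have mN := measurable_normc_powR q mg.
have mE : measurable_fun setT (fun x => (normc (g x) `^ q)%:E) by exact/measurable_EFinP.
have h0 := (ae_eq_integral_abs (haar R n) measurableT mE).1.
have {}h0 : ae_eq (haar R n) setT (fun x => (normc (g x) `^ q)%:E) (cst 0%E).
  apply: h0; rewrite -I0 IqE; apply: eq_integral => x _.
  by rewrite abse_EFin ger0_norm ?powR_ge0.
apply: filterS h0 => x hx Dx; have [] := hx Dx.
move=> /eqP; rewrite powR_eq0 => /andP[/eqP h _].
exact: ComplexField.Normc.eq0_normc.
Qed.

Lemma fourier_slice_join_freq f k l : cintegrable (haar R (d + e)) f ->
  fourier (slice l f) k = fourier f (join_freq k l).
Proof.
by move=> cf; rewrite fourier_slice // join_freq_lshift join_freq_rshift.
Qed.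

Lemma hardyI_slice q f l : 1 < q -> hardyI q f -> hardyI q (slice l f).
Proof.
move=> q1 hf; have cf := hardyI_cintegrable (ltW q1) hf; case: hf => mf If hf.
split; [exact: cmeas_slice|exact: le_lt_trans (Iq_slice l q1 mf If) If|].
by move=> k [j kj]; rewrite fourier_slice_join_freq // hf //; exists (lshift e j); rewrite join_freql.
Qed.

(** All Fourier coefficients of this slice are coefficients of [f] outside the cone. *)
Lemma slice_neg q f l : 1 < q -> hardyI q f -> (exists j, l j < 0) ->
  slice l f = (fun=> 0) %[ae mu].
Proof.
move=> q1 hf [j lj]; have cf := hardyI_cintegrable (ltW q1) hf.
have [ms Is _] := hardyI_slice l q1 hf; case: hf => mf If hf.
apply: (fourier0_ae q1 ms Is) => k; rewrite fourier_slice_join_freq // hf //.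
by exists (rshift d j); rewrite join_freqr.
Qed.

(** There are countably many frequencies, so the exceptional sets of [slice_neg] can be
    united. *)
Lemma ae_hardyI_section q f : 1 < q -> hardyI q f ->
  {ae mu, forall x, hardyI q (fun y => f (tcat (x, y)))}.
Proof.
move=> q1 hf; have [mf If _] := hf.
pose P (n : nat) (x : torus R d) : Prop := match unpickle n with
  | Some l => (exists j, (l : {ffun 'I_e -> int}) j < 0) -> slice l f x = 0
  | None => True end.
have hP : {ae mu, forall x, forall n, P n x}.
  apply: ae_foralln => n; rewrite /P; case: unpickle => [l|]; last exact: aeW.
  have [ln|ln] := pselect (exists j, l j < 0); last by apply: aeW => x h; case: ln.
  by apply: filterS (slice_neg q1 hf ln) => x hx _; exact: hx.
apply: filterS2 (ae_slice_lty mf If) hP => x Ix Px; split=> //; first exact: cmeas_tcat_pair.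
move=> l [j lj]; have := Px (pickle (finfun l)); rewrite /P pickleK.
have -> : fun_of_fin (finfun l) = l by apply/funext => i; rewrite ffunE.
by apply; exists j.
Qed.

(** The slices to which [tensor_bound] applies the two operators are Hardy functions: the
    sections of [f] almost surely, and the combinations of the slices [slice (l j) f] always. *)
Lemma Iq_contraction_tensor q (I J : finType) (k : I -> 'I_d -> int) (l : J -> 'I_e -> int)
    (tau : I -> torus R d -> R[i]) (sig : J -> torus R e -> R[i]) :
  1 < q -> (forall i, cmeas (tau i)) -> (forall j, cmeas (sig j)) ->
  Iq_contraction q (finite_rank k tau) -> Iq_contraction q (finite_rank l sig) ->
  Iq_contraction q (finite_rank (fun ij : I * J => join_freq (k ij.1) (l ij.2))
    (fun ij => tensor_fun (tau ij.1) (sig ij.2))).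
Proof.
move=> q1 mt ms ct cs f hf; have cf := hardyI_cintegrable (ltW q1) hf; have [mf If _] := hf.
rewrite [X in (X <= _)%E]Iq_tcat; last first.
  by apply: cmeas_sum => i _; apply: cmeasZ; exact: cmeas_tensor_fun.
rewrite (eq_Iq _ _ (fun z => congr1 (@normc R) (finite_rank_tensor_fun k l tau sig z cf))).
have := @tensor_bound R d e q 1 1 f I J k l tau sig q1 ler01 ler01 mf If mt ms.
rewrite mulr1 mul1e; apply.
  by apply: filterS (ae_hardyI_section q1 hf) => x hx; rewrite mul1e; exact: cs.
move=> y; rewrite mul1e; apply: ct.
apply: hardyI_sum => [|j]; first exact: ltW.
have := hardyIZ (sig j y) (ltW q1) (hardyI_slice (l j) q1 hf).
by under eq_fun do rewrite mulrC.
Qed.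

(** Tensor products multiply norms from below as well: test on the product of the two test
    functions. *)
Lemma witness_tensor (p1 p p2 A B : R) : 1 < p1 -> p1 < p -> p < p2 -> 0 <= A -> 0 <= B ->
  witness p1 p p2 d A -> witness p1 p p2 e B -> witness p1 p p2 (d + e) (A * B).
Proof.
move=> h1 h1p h2p A0 B0.
have hp : 1 < p by exact: lt_trans h1p. have hp2 : 1 < p2 by exact: lt_trans h2p.
move=> [I [k [tau [f [ht [c1 c2] hf f1 hA]]]]] [J [l [sig [g [hs [c1' c2'] hg g1 hB]]]]].
have mt i : cmeas (tau i) by case: (ht i).
have ms j : cmeas (sig j) by case: (hs j).
exists (I * J)%type, (fun ij => join_freq (k ij.1) (l ij.2)),
  (fun ij => tensor_fun (tau ij.1) (sig ij.2)), (tensor_fun f g).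
have [mf If _] := hf; have [mg Ig _] := hg.
have cf := hardyI_cintegrable (ltW hp) hf; have cg := hardyI_cintegrable (ltW hp) hg.
split.
- by move=> ij; apply: hardyI_tensor_fun => //; exact: ltW.
- by split; exact: Iq_contraction_tensor.
- by apply: hardyI_tensor_fun => //; exact: ltW.
- rewrite Iq_tensor_fun // -[leRHS]mule1; exact: lee_pmul (Iq_ge0 _ _ _) (Iq_ge0 _ _ _) f1 g1.
set T := finite_rank _ _.
have -> : T (tensor_fun f g) = tensor_fun (finite_rank k tau f) (finite_rank l sig g).
  apply/funext => x; rewrite /tensor_fun /finite_rank big_distrlr pair_bigA; apply: eq_bigr => -[i j] _ /=.
  by rewrite fourier_tensor_fun // mulrACA join_freq_lshift join_freq_rshift.
rewrite Iq_tensor_fun; [|by apply: cmeas_sum => i _; exact: cmeasZ..].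
by rewrite EFinM; apply: lee_pmul; rewrite ?lee_fin.
Qed.
End tensor.

(** * Moduli of analytic polynomials *)

Section log_power.
Variable R : realType.
Implicit Types (w z : R[i]) (r x y : R).

Lemma ln1D_ge r : -1 < r -> r / (1 + r) <= ln (1 + r).
Proof.
move=> r1; have h : 0 < 1 + r by rewrite -ltrBlDl sub0r.
have -> : ln (1 + r) = - ln (1 + - (r / (1 + r))).
  rewrite (_ : 1 + - (r / (1 + r)) = (1 + r)^-1) ?lnV ?opprK //.
  by field; rewrite gt_eqF.
rewrite lerNr; apply: le_ln1Dx.
by rewrite ltrN2 ltr_pdivrMr // mul1r ltrDr.
Qed.

Lemma ln_normc z : 0 < normc z -> ln (normc z) = ln (cRe z ^+ 2 + cIm z ^+ 2) / 2.
Proof.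
by move=> z0; rewrite -normc_sqr expr2 lnM ?posrE //; field.
Qed.

(** [ln |1 + w / N|] is half of [ln (1 + r)] with [r = 2 Re w / N + O (1 / N ^ 2)], and
    [r - 2 r ^ 2 <= ln (1 + r) <= r] for [|r| <= 1 / 2]. *)
Lemma log_power_approx (W eta : R) : 0 <= W -> 0 < eta ->
  exists2 N : nat, (0 < N)%N & forall w, normc w <= W ->
  0 < normc (1 + w * (N%:R^-1)%:C) /\
  `|N%:R * ln (normc (1 + w * (N%:R^-1)%:C)) - cRe w| <= eta.
Proof.
move=> W0 eta0; set B := 2 * W + W ^+ 2; have B0 : 0 <= B by rewrite addr_ge0 ?mulr_ge0 ?sqr_ge0.
have [N hN] : exists N : nat, 2 * B + B ^+ 2 / eta + W ^+ 2 / eta + 1 < N%:R.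
  by exists (Num.truncn (2 * B + B ^+ 2 / eta + W ^+ 2 / eta + 1)).+1; exact: truncnS_gt.
have c1 : 0 <= B ^+ 2 / eta by rewrite divr_ge0 ?sqr_ge0 // ltW.
have c2 : 0 <= W ^+ 2 / eta by rewrite divr_ge0 ?sqr_ge0 // ltW.
have N0 : 0 < N%:R :> R by lra.
exists N => [|w wW]; first by rewrite -(ltr_nat R).
set y : R := N%:R^-1; have y0 : 0 < y by rewrite invr_gt0.
have Ny : N%:R = y^-1 :> R by rewrite invrK.
have yB : y * B <= 1 / 2 by rewrite ler_pdivrMl //; lra.
have yB2 : y * B ^+ 2 <= eta.
  by rewrite ler_pdivrMl // -ler_pdivrMr //; lra.
have yW2 : y * W ^+ 2 <= eta.
  by rewrite ler_pdivrMl // -ler_pdivrMr //; lra.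
have y1 : y <= 1 by rewrite invf_le1 //; lra.
set a := cRe w; set b := cIm w.
have ab : a ^+ 2 + b ^+ 2 <= W ^+ 2.
  by rewrite -normc_sqr lerXn2r ?nnegrE ?normc_ge0.
have aW : `|a| <= W by exact: le_trans (Re_le_normc w) wW.
pose r := 2 * a * y + (a ^+ 2 + b ^+ 2) * y ^+ 2.
have ab0 : 0 <= a ^+ 2 + b ^+ 2 by rewrite addr_ge0 ?sqr_ge0.
have rB : `|r| <= y * B.
  rewrite /r /B; apply: le_trans (ler_normD _ _) _.
  rewrite (ger0_norm (mulr_ge0 ab0 (sqr_ge0 y))) !normrM (ger0_norm (ltW y0)) normr_nat.
  have : (a ^+ 2 + b ^+ 2) * y ^+ 2 <= W ^+ 2 * y.
    apply: ler_pM => //; first exact: sqr_ge0.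
    by rewrite expr2 ler_piMl // ltW.
  have := ler_wpM2r (ltW y0) aW; lra.
have sq : normc (1 + w * y%:C) ^+ 2 = 1 + r.
  rewrite normc_sqr; have -> : cRe (1 + w * y%:C) = 1 + a * y.
    by rewrite Re_add Re_mul /= mulr0 subr0.
  have -> : cIm (1 + w * y%:C) = b * y by rewrite Im_add Im_mul /= mulr0 !add0r.
  by rewrite /r; ring.
have r12 : `|r| <= 1 / 2 by exact: le_trans yB.
move: (r12); rewrite ler_norml => /andP[rl ru].
have n0 : 0 < normc (1 + w * y%:C).
  by rewrite lt_neqAle normc_ge0 andbT; apply/eqP => h; move: sq; rewrite -h expr0n /=; lra.
split=> //; rewrite Ny ln_normc // -normc_sqr sq.
have lu : ln (1 + r) <= r by apply: le_ln1Dx; lra.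
have ll : r - 2 * r ^+ 2 <= ln (1 + r).
  apply: le_trans (ln1D_ge _); last by lra.
  rewrite -subr_ge0 (_ : _ - _ = r ^+ 2 * (1 + 2 * r) / (1 + r)); last by field; lra.
  have g1 : 0 <= 1 + 2 * r by lra.
  have g2 : 0 <= 1 + r by lra.
  exact: (divr_ge0 (mulr_ge0 (sqr_ge0 r) g1) g2).
have -> : y^-1 * (ln (1 + r) / 2) - a = y^-1 * ((ln (1 + r) - 2 * a * y) / 2).
  by field; rewrite gt_eqF.
have r2 : r ^+ 2 <= y * eta.
  have := ler_pM (normr_ge0 r) (normr_ge0 r) rB rB; rewrite -normrM -expr2 ger0_norm ?sqr_ge0 //.
  by have := ler_wpM2l (ltW y0) yB2; rewrite !expr2; lra.
rewrite ler_norml; apply/andP; split.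
  rewrite ler_pdivlMl //.
  have : 0 <= (a ^+ 2 + b ^+ 2) * y ^+ 2 by rewrite mulr_ge0 ?sqr_ge0.
  rewrite /r in ll r2 *; lra.
rewrite ler_pdivrMl //.
have : (a ^+ 2 + b ^+ 2) * y ^+ 2 <= y * eta.
  rewrite expr2 mulrA mulrC ler_pM2l //; apply: le_trans yW2.
  by rewrite mulrC; apply: ler_wpM2l => //; exact: ltW.
rewrite /r in lu *; have := mulr_ge0 (ltW y0) (ltW eta0); lra.
Qed.
End log_power.

Section logarithm_series.
Variable R : realType.
Implicit Types (a c : R) (z w : R[i]).

(** The coefficients of the power series of [ln (1 + a z)]. *)
Definition log_coef (a : R) (k : nat) : R := (-1) ^+ k * a ^+ k.+1 / k.+1%:R.

Definition log_series n a : {poly R[i]} := \sum_(k < n) (log_coef a k)%:C *: 'X^(k.+1).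

Lemma log_series_Re n a z : cRe (log_series n a).[z] =
  (\sum_(k < n) ((-1) ^+ k / k.+1%:R * cRe (z ^+ k.+1)) *: 'X^(k.+1)).[a].
Proof.
rewrite !horner_sum Re_sum; apply: eq_bigr => k _.
rewrite !hornerZ !hornerXn cReZ /log_coef; ring.
Qed.

Lemma normc1D_ge a z : normc z = 1 -> 0 <= a -> 1 - a <= normc (1 + a%:C * z).
Proof.
move=> z1 a0; have := normcB_le 1 (- (a%:C * z)); rewrite opprK.
rewrite normcN ComplexField.Normc.normcM z1 normc_real mulr1 ger0_norm //.
by have -> : normc (1 : R[i]) = 1 := etrans (normc_real 1) (normr1 _).
Qed.

(** The difference is the real part of [z (- a z) ^ n / (1 + a z)], the remainder of a
    geometric series. *)
Lemma geom_remainder_le n a z : normc z = 1 -> 0 <= a <= 1 / 2 ->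
  `|(cRe z + a) / (1 + 2 * cRe z * a + a ^+ 2)
    - \sum_(k < n) (- a) ^+ k * cRe (z ^+ k.+1)| <= 2 * (1 / 2) ^+ n.
Proof.
move=> z1 /andP[a0 a2]; set c := cRe z; set D := 1 + 2 * c * a + a ^+ 2.
pose u : R[i] := 1 + a%:C * z; pose s : R[i] := (- a)%:C * z.
have zs : c ^+ 2 + cIm z ^+ 2 = 1 by rewrite -normc_sqr z1 expr1n.
have uD : normc u ^+ 2 = D.
  rewrite normc_sqr; have -> : cRe u = 1 + a * c by rewrite Re_add cReZ.
  have -> : cIm u = a * cIm z by rewrite Im_add Im_mul /= mul0r addr0 add0r.
  by rewrite /D; have := congr1 ( *%R (a ^+ 2)) zs; rewrite !expr2; lra.
have u2 : 1 / 2 <= normc u by have := normc1D_ge z1 a0; rewrite -/u; lra.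
have D0 : 0 < D by rewrite -uD exprn_gt0 //; lra.
have gs : u * \sum_(k < n) s ^+ k = 1 - s ^+ n.
  have := subrX1 s n; rewrite /u (_ : 1 + a%:C * z = - (s - 1)); last first.
    by rewrite /s rmorphN /= mulNr opprB opprK addrC.
  by move=> h; rewrite mulNr -h opprB.
have S1 : \sum_(k < n) (- a) ^+ k * cRe (z ^+ k.+1) = cRe (z * \sum_(k < n) s ^+ k).
  rewrite mulr_sumr Re_sum; apply: eq_bigr => k _.
  by rewrite /s exprMn -rmorphXn /= mulrCA -exprS cReZ.
pose r := z * conjc u * s ^+ n.
have E1 : D * cRe (z * \sum_(k < n) s ^+ k) = (c + a) - cRe r.
  rewrite -cReZ -uD -(mulCJ u) [u * _]mulrC.
  have -> : conjc u * u * (z * \sum_(k < n) s ^+ k) = z * conjc u * (u * \sum_(k < n) s ^+ k) by ring.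
  rewrite gs mulrBr mulr1 Re_add Re_opp -/r; congr (_ - _).
  have -> : conjc u = 1 + a%:C * conjc z.
    by rewrite /u; apply: complex_eqP; case: (z) => x y; simpc.
  rewrite mulrDr mulr1 Re_add mulrCA cReZ mulCJ z1 expr1n /= mulr1 //.
rewrite S1 (_ : _ - _ = cRe r / D); last first.
  have D1 : D != 0 by rewrite gt_eqF.
  by apply: (mulfI D1); rewrite mulrBr E1; field.
have nr : `|cRe r| <= normc u * a ^+ n.
  apply: le_trans (Re_le_normc _) _; rewrite /r !ComplexField.Normc.normcM z1 mul1r normcX.
  rewrite /s ComplexField.Normc.normcM z1 mulr1 normc_real normrN ger0_norm //.
  by have -> : normc (conjc u) = normc u by case: (u) => x y /=; rewrite sqrrN.
rewrite normrM normfV (gtr0_norm D0) ler_pdivrMr // -uD expr2.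
apply: (le_trans nr); rewrite -[2 * _ * _]mulrA.
have an : a ^+ n <= (1 / 2) ^+ n by rewrite lerXn2r ?nnegrE.
have := ler_pM (exprn_ge0 n a0) (normc_ge0 u) an (lexx (normc u)).
have h0 : 0 <= (1 / 2 : R) ^+ n * normc u by rewrite mulr_ge0 ?normc_ge0 ?exprn_ge0.
have := ler_wpM2l h0 u2; lra.
Qed.

(** Both sides vanish at [a = 0], and the derivative of their difference in [a] is the
    remainder of [geom_remainder_le]. Working along [a] avoids the complex logarithm. *)
Lemma log_series_approx n a z : normc z = 1 -> 0 <= a <= 1 / 2 ->
  `|cRe (log_series n a).[z] - ln (normc (1 + a%:C * z))| <= (1 / 2) ^+ n.
Proof.
move=> z1 a12; have /andP[a0 a2] := a12; set c := cRe z.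
pose P : {poly R} := 1 + (2 * c) *: 'X + 'X^2.
pose Q : {poly R} := \sum_(k < n) ((-1) ^+ k / k.+1%:R * cRe (z ^+ k.+1)) *: 'X^(k.+1).
have zs : c ^+ 2 + cIm z ^+ 2 = 1 by rewrite -normc_sqr z1 expr1n.
have PE t : P.[t] = 1 + 2 * c * t + t ^+ 2 by rewrite /P !hornerE.
have P0 t : 0 <= t <= 1 / 2 -> 0 < P.[t].
  move=> /andP[t0 t2]; rewrite PE.
  have c1 : -1 <= c by have := sqr_ge0 (cIm z); nra.
  nra.
have uP t : normc (1 + t%:C * z) ^+ 2 = P.[t].
  rewrite normc_sqr PE Re_add Im_add cReZ (Im_mul t%:C) /= mul0r addr0 add0r.
  by have := congr1 ( *%R (t ^+ 2)) zs; rewrite !expr2; lra.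
have up : 0 < normc (1 + a%:C * z).
  rewrite lt_neqAle normc_ge0 andbT; apply/eqP => h; have := P0 a a12.
  by rewrite -uP -h expr0n /= ltxx.
rewrite ln_normc // -normc_sqr uP log_series_Re -/Q.
pose phi t := ln P.[t] / 2 - Q.[t].
pose dphi t := P^`().[t] / P.[t] / 2 - Q^`().[t].
have dph (t : R) : 0 <= t <= 1 / 2 -> is_derive t 1 phi (dphi t).
  move=> t12; have -> : phi = (2^-1 *: (@ln R \o horner P) - horner Q).
    by apply/funext => y; rewrite /phi mulrC.
  have := is_deriveB (is_deriveZ 2^-1 (is_derive1_comp (is_derive1_ln (P0 t t12))
    (is_derive_poly P t))) (is_derive_poly Q t).
  have -> : 2^-1 *: (P.[t]^-1 * P^`().[t]) - Q^`().[t] = dphi t.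
    by rewrite /dphi -[_ *: _]/(2^-1 * _) mulrC [P.[t]^-1 * _]mulrC.
  exact.
have dphE t : dphi t = (c + t) / P.[t] - \sum_(k < n) (- t) ^+ k * cRe (z ^+ k.+1).
  rewrite /dphi; congr (_ - _).
    rewrite /P !derivD derivZ derivX derivXn derivC !hornerE.
    transitivity ((2 * c + t + t) / (1 + 2 * c * t + t ^+ 2) / 2) => //.
    by rewrite mulrAC; congr (_ / _); field.
  rewrite /Q raddf_sum horner_sum; apply: eq_bigr => k _.
  transitivity ((((-1) ^+ k / k.+1%:R * cRe (z ^+ k.+1)) *: 'X^(k.+1))^`().[t]) => //.
  rewrite derivZ derivXn hornerZ hornerMn hornerXn -[k.+1.-1]/(nat_of_ord k).
  rewrite -mulr_natr [in RHS]exprNn.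
  by field; rewrite nat1r pnatr_eq0.
have phi0 : phi 0 = 0.
  rewrite /phi PE mulr0 expr0n /= !addr0 ln1 mul0r sub0r /Q horner_sum big1 ?oppr0 // => k _.
  by rewrite hornerZ hornerXn expr0n /= mulr0.
have [||x xa] := @MVT_segment R phi dphi 0 a a0.
- by move=> x /[!in_itv]/= /andP[x0 xa]; apply: dph; lra.
- apply: derivable_within_continuous => x /[!in_itv]/= /andP[x0 xa].
  have xx : 0 <= x <= 1 / 2 by lra.
  by have [] := dph x xx.
rewrite phi0 subr0 subr0 => E.
rewrite distrC -[ln _ / 2 - _]/(phi a) E normrM (ger0_norm a0) dphE PE.
have x12 : 0 <= x <= 1 / 2 by move: xa; rewrite in_itv /= => /andP[]; lra.
have := ler_pM (normr_ge0 _) a0 (geom_remainder_le n z1 x12) a2; rewrite -/c; lra.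
Qed.
End logarithm_series.

Section outer_polynomials.
Variable R : realType.
Implicit Types (a s : R) (z : R[i]).

Lemma geometric_small (x eta : R) : 0 < eta -> exists n : nat, x * (1 / 2) ^+ n.+1 <= eta.
Proof.
move=> eta0; pose n := Num.truncn `|x / eta|.
have hn : x / eta < n.+1%:R by exact: le_lt_trans (ler_norm _) (truncnS_gt _).
exists n; have h2 : (n.+1%:R : R) <= 2 ^+ n.+1.
  by rewrite -natrX ler_nat; exact: ltnW (ltn_expl _ _).
rewrite div1r exprVn ler_pdivrMr ?exprn_gt0 // -ler_pdivrMl // mulrC.
exact: le_trans (ltW hn) h2.
Qed.

Lemma log_series_le n a z : normc z = 1 -> 0 <= a <= 1 / 2 ->
  normc (log_series n a).[z] <= n%:R.
Proof.
move=> z1 /andP[a0 a2]; rewrite horner_sum; apply: le_trans (normc_sum _ _ _) _.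
rewrite -[leRHS](_ : \sum_(k < n) 1 = _); last by rewrite sumr_const card_ord.
apply: ler_sum => k _; rewrite hornerZ hornerXn ComplexField.Normc.normcM normcX z1 expr1n mulr1.
rewrite normc_real /log_coef normrM normrM normrX normrN1 expr1n mul1r normfV normr_nat.
rewrite normrX ger0_norm // ler_pdivrMr // mul1r.
have a1 : a <= 1 by lra.
by apply: (le_trans (exprn_ile1 _ a0 a1)); rewrite ler1n.
Qed.

(** The polynomial is [(1 + s L / N) ^ N] with [L] a partial sum of the logarithmic series:
    a polynomial version of [(1 + a z) ^ s], with its first two coefficients exactly. *)
Lemma poly_modulus a s eta : 0 <= a <= 1 / 2 -> 0 < eta ->
  exists F : {poly R[i]}, [/\ F`_0 = 1, F`_1 = (s * a)%:C & forall z, normc z = 1 ->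
    0 < normc F.[z] /\ `|ln (normc F.[z]) - s * ln (normc (1 + a%:C * z))| <= eta].
Proof.
move=> a12 eta0; have eta2 : 0 < eta / 2 by rewrite divr_gt0.
have [n hn] := geometric_small `|s| eta2.
have W0 : 0 <= `|s| * n.+1%:R by rewrite mulr_ge0.
have [N N0 hN] := log_power_approx W0 eta2.
have NR : N%:R != 0 :> R by rewrite pnatr_eq0 -lt0n.
pose L := log_series n.+1 a; pose B : {poly R[i]} := 1 + (s / N%:R)%:C *: L.
have L0 : L.[0] = 0.
  by rewrite horner_sum big1 // => k _; rewrite hornerZ hornerXn expr0n /= mulr0.
have L1 : L`_1 = a%:C.
  rewrite coef_sum big_ord_recl big1 => [|k _]; last by rewrite coefZ coefXn mulr0.
  by rewrite coefZ coefXn mulr1 addr0 /log_coef expr0 mul1r expr1 divr1.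
have B0 : B.[0] = 1 by rewrite /B hornerD hornerZ L0 mulr0 hornerC addr0.
exists (B ^+ N); split.
- by rewrite -horner_coef0 horner_exp B0 expr1n.
- have -> : (B ^+ N)`_1 = (B ^+ N)^`()`_0 by rewrite coef_deriv.
  rewrite -horner_coef0 deriv_exp hornerMn hornerM horner_exp B0 expr1n mulr1.
  rewrite /B derivD derivC add0r derivZ hornerZ horner_coef0 coef_deriv L1 mulr1n.
  rewrite -mulr_natr -(rmorph_nat (real_complex R)) -!rmorphM /=; congr (_%:C).
  by field.
move=> z z1; have wW : normc (s%:C * L.[z]) <= `|s| * n.+1%:R.
  by rewrite ComplexField.Normc.normcM normc_real ler_wpM2l //; exact: log_series_le.
have [n0 h] := hN _ wW.
have BE : B.[z] = 1 + s%:C * L.[z] * (N%:R^-1)%:C.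
  by rewrite /B hornerD hornerC hornerZ rmorphM /= mulrAC.
rewrite horner_exp normcX BE; split; first exact: exprn_gt0.
rewrite lnXn // -[ln _ *+ N]mulr_natl.
have h2 := log_series_approx n.+1 z1 a12; move: h; rewrite cReZ.
rewrite -/L in h2.
set x := N%:R * _; set y := cRe _ in h2 *; set v := ln _ in h2 *.
move=> h; have h3 : `|s * y - s * v| <= eta / 2.
  by rewrite -mulrBr normrM; apply: le_trans hn; exact: ler_wpM2l.
move: h h3; rewrite !ler_norml => /andP[? ?] /andP[? ?]; apply/andP; split; lra.
Qed.
End outer_polynomials.

(** * Polynomials with plateau modulus *)

Section plateau.
Variable R : realType.
Local Notation torus := (torus R 1).
Local Notation mu := (haar R 1).

(** The size of the plateau is a free real parameter, so half-lines in the coordinate of the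
    circle serve as its complement. *)
Lemma circle_haar_ge (a : R) : 0 <= a <= 1 ->
  @circle_haar R [set t | a <= t] = (1 - a)%:E.
Proof.
move=> /andP[a0 a1].
have -> : [set t | a <= t] = `[a, +oo[%classic :> set (measurableTypeR R).
  by apply/seteqP; split=> t; rewrite /= in_itv /= andbT.
rewrite -[LHS]/(\int[lebesgue_measure]_(x in `[a, +oo[) (uniform_pdf 0 1 x)%:E)%E.
rewrite integral_uniform_pdf.
have -> : `[a, +oo[ `&` `[0, 1] = `[a, 1]%classic :> set R.
  apply/seteqP; split=> t; rewrite /= !in_itv /= ?andbT.
    by move=> [at_ /andP[_ ->]]; rewrite at_.
  by move=> /andP[at_ t1]; split=> //; rewrite t1 (le_trans a0).
rewrite (eq_integral (fun=> 1%:E)) => [|t]; last first.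
  rewrite inE /= in_itv /= => /andP[at_ t1].
  by rewrite /uniform_pdf t1 (le_trans a0 at_) subr0 invr1.
rewrite integral_cst //= lebesgue_measure_itv /= lte_fin mul1e.
have [//|] := ltP a 1; rewrite le_eqVlt => /orP[/eqP <-|]; first by rewrite subrr.
by rewrite ltNge a1.
Qed.

Lemma integral_halfline (a : R) : 0 <= a <= 1 ->
  (\int[mu]_x (normc (halfline a (tnth x ord0)))%:E = (1 - a)%:E)%E.
Proof.
move=> a01; rewrite (integral_tnth _ (cbounded_half a)) -circle_haar_ge //.
rewrite -[X in _ = _ X]setIT -integral_indic //; last first.
  have -> : [set t | a <= t] = `[a, +oo[%classic :> set (measurableTypeR R).
    by apply/seteqP; split=> t; rewrite /= in_itv /= andbT.
  exact: measurable_itv.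
apply: eq_integral => t _; rewrite /halfline normc_real ger0_norm //; congr (_%:E).
rewrite indicE; congr (_%:R); congr nat_of_bool; apply/idP/idP.
  by move=> h; apply/mem_set.
by move/set_mem.
Qed.

Lemma Re_fejer_half_ge0 n (a x : R) : 0 <= cRe (fejer_half n a x).
Proof.
rewrite /fejer_half cintE /= /Rintegral fine_ge0 //; apply: integral_ge0 => t _.
by rewrite lee_fin trig_ker_fejer cReZ mulr_ge0 ?fejer_ker_ge0 // /halfline /=.
Qed.

(** It turns the [L^1] convergence of Fejer means into that of their exponentials. *)
Lemma expR_lipschitz (a b : R) : a <= 0 -> b <= 0 -> `|expR a - expR b| <= `|a - b|.
Proof.
have h (x y : R) : x <= y -> y <= 0 -> 0 <= expR y - expR x <= y - x.
  move=> xy y0; rewrite subr_ge0 ler_expR xy /=.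
  have := expR_ge1Dx (x - y); have e1 : expR y <= 1 by rewrite -expR0 ler_expR.
  have -> : expR x = expR y * expR (x - y) by rewrite -expRD addrC subrK.
  move=> h; have := ler_wpM2l (expR_ge0 y) h.
  have : 0 <= (1 - expR y) * (y - x) by rewrite mulr_ge0 ?subr_ge0.
  lra.
move=> a0 b0; have [ab|ab] := leP a b.
  have /andP[h1 h2] := h _ _ ab b0.
  by rewrite distrC ger0_norm // distrC ger0_norm // subr_ge0.
have /andP[h1 h2] := h _ _ (ltW ab) a0.
by rewrite ger0_norm // ger0_norm // subr_ge0 ltW.
Qed.

(** Let [u] be [- M] where [m <= t] and [0] elsewhere. Its Fejer mean [v] is the real part of
    an analytic polynomial [p], and [G = (1 + p / N) ^ N] has modulus close to [exp v]. As
    [exp (q u)] has integral [m] up to [exp (- M)] and [v] is close to [u] in [L^1], the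
    integral of [|G| ^ q] is close to [m], uniformly in [q]. *)
Lemma plateau_poly (m Q eta : R) : 0 < m <= 1 -> 1 <= Q -> 0 < eta ->
  exists G : {poly R[i]}, forall q, 1 <= q <= Q ->
    (((expR (- eta) * m)%:E <= Iq mu q (fun x => G.[e x])) /\
     (Iq mu q (fun x => G.[e x]) <= (expR eta * m)%:E))%E.
Proof.
move=> /andP[m0 m1] Q1 eta0.
have Q0 : 0 < Q by exact: lt_le_trans Q1.
set y := expR (eta / 2); have y1 : 1 < y by rewrite -expR0 ltr_expR divr_gt0.
have y0 : 0 < y by exact: expR_gt0.
have yi : y^-1 < 1 by rewrite invf_lt1.
have yi0 : 0 < y^-1 by rewrite invr_gt0.
(* the total error allowed: [m - kap = m / y] and [m + kap <= m * y], with a factor [y] to spare *)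
pose kap := (1 - y^-1) * m; have k0 : 0 < kap by rewrite mulr_gt0 // subr_gt0.
have k1 : kap <= 1 by rewrite mulr_ile1 ?subr_ge0 ?(ltW yi) ?(ltW m0) // lerBlDl lerDr ltW.
pose M := - ln (kap / 2).
have EM : expR (- M) = kap / 2 by rewrite /M opprK lnK // posrE divr_gt0.
have M0 : 0 < M by rewrite /M oppr_gt0 ln_lt0 // divr_gt0 //=; lra.
pose eps := kap / (2 * (Q * M)).
have QM0 : 0 < Q * M by exact: mulr_gt0.
have eps0 : 0 < eps by rewrite divr_gt0 // mulr_gt0.
have [n /(_ n (leqnn n)) hn] := fejer_half_cvg m eps0.
pose f := cind (box (fun _ : 'I_1 => m)).
have cf : cintegrable mu f.
  by apply: cbounded_cintegrable; apply: cbounded_cind; exact: measurable_box.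
have rf x : conjc (f x) = f x by rewrite /f /cind conjc_real.
have [P hP] := tconv_poly n cf; set c := cint mu f.
pose p : {poly R[i]} := (- M)%:C *: (P + P - c%:P).
pose t0 (x : torus) : R := tnth x ord0.
have fE x : fejer n f x = fejer_half n m (t0 x) by rewrite fejer_box big_ord1.
pose v x := - M * cRe (fejer_half n m (t0 x)).
have pv x : cRe p.[e x] = v x.
  rewrite /p hornerZ cReZ /v -fE; congr (_ * _).
  have := congr1 cRe (analytic_conjugate n x cf rf).
  have rj (z : R[i]) : cRe (conjc z) = cRe z by case: z.
  rewrite !Re_add rj hP => h; rewrite !hornerE Re_add Re_opp Re_add h.
  by rewrite -/c addrK.
have eta1 : 0 < eta / (2 * Q) by rewrite divr_gt0 // mulr_gt0.
have [_ [W hW]] := cbounded_horner p.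
have W0 : 0 <= W by apply: le_trans (hW point); exact: normc_ge0.
have [N N0 hN] := log_power_approx W0 eta1.
pose B : {poly R[i]} := 1 + (N%:R^-1)%:C *: p; exists (B ^+ N) => q /andP[q1 qQ].
have q0 : 0 < q by exact: lt_le_trans q1.
have BE x : B.[e x] = 1 + p.[e x] * (N%:R^-1)%:C by rewrite /B hornerD hornerC hornerZ mulrC.
pose hs x : R := normc (halfline m (t0 x)).
have hsE x : hs x = (m <= t0 x)%R%:R by rewrite /hs /halfline normc_real ger0_norm.
pose d x : R := normc (fejer_half n m (t0 x) - halfline m (t0 x)).
pose g x : R := normc ((B ^+ N).[e x]) `^ q.
have gE x : expR (q * v x) * y^-1 <= g x <= expR (q * v x) * y.
  have := hN _ (hW x); rewrite -BE pv => -[n0 h].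
  have -> : g x = expR (q * (N%:R * ln (normc B.[e x]))).
    rewrite /g horner_exp normcX /powR (gt_eqF (exprn_gt0 N n0)) lnXn //.
    by rewrite -[ln _ *+ N]mulr_natl.
  rewrite /y -expRN -!expRD !ler_expR.
  have : `|q * (N%:R * ln (normc B.[e x]) - v x)| <= eta / 2.
    rewrite normrM (gtr0_norm q0); apply: (@le_trans _ _ (Q * (eta / (2 * Q)))).
      by apply: ler_pM => //; exact: ltW.
    by rewrite le_eqVlt; apply/orP; left; apply/eqP; field; rewrite gt_eqF.
  by rewrite ler_norml => /andP[? ?]; apply/andP; split; lra.
have d0 x : 0 <= d x by exact: normc_ge0.
have vu x : `|expR (q * v x) - expR (q * (- M * hs x))| <= Q * M * d x.
  apply: le_trans (expR_lipschitz _ _) _.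
  - by rewrite /v mulNr mulrN oppr_le0 !mulr_ge0 ?Re_fejer_half_ge0 // ltW.
  - by rewrite mulNr mulrN oppr_le0 !mulr_ge0 ?normc_ge0 // ltW.
  rewrite -mulrBr normrM (gtr0_norm q0) /v -mulrBr normrM normrN (gtr0_norm M0) mulrA.
  apply: ler_pM => //; first by rewrite mulr_ge0 // ltW.
    by rewrite ler_pM2r.
  apply: le_trans (Re_le_normc _); rewrite Re_add Re_opp hsE /halfline /=.
  by rewrite lexx.
have uE x : 1 - hs x <= expR (q * (- M * hs x)) <= 1 - hs x + kap / 2.
  rewrite hsE; case: (m <= t0 x); rewrite /= ?mulr1 ?mulr0 ?expR0 ?subrr ?subr0; last first.
    by rewrite lexx lerDl divr_ge0 // ltW.
  rewrite expR_ge0 add0r -EM ler_expR mulrN lerN2 ler_peMl //; exact: ltW.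
have mt : measurable_fun setT t0 by exact: measurable_tnth.
have mhs : measurable_fun setT hs.
  by apply: measurable_normc; apply: (cmeas_tnth (f := halfline m)); case: (cbounded_half m).
have md : measurable_fun setT d.
  apply: measurable_normc; apply: (@cmeas_tnth R 1 (fun t => fejer_half n m t - halfline m t)).
  by apply: cmeasB; [exact: cmeas_fejer_half|case: (cbounded_half m)].
have mh1 : measurable_fun setT (fun x => 1 - hs x) by exact: measurable_funB.
have hs01 x : 0 <= 1 - hs x by rewrite hsE subr_ge0 lern1 leq_b1.
have mg : measurable_fun setT g by apply: measurable_normc_powR; case: (cbounded_horner (B ^+ N)).
have I1 : (\int[mu]_x (1 - hs x)%:E = m%:E)%E.
  have := pintD mu mh1 mhs hs01 (fun x => normc_ge0 _).
  under eq_integral do rewrite subrK.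
  rewrite pint_cst integral_halfline ?(ltW m0) // => h.
  by move: h; case: (\int[mu]_x _)%E => [r| |] //; rewrite -EFinD => -[h]; congr (_%:E); lra.
have I2 : (\int[mu]_x (d x)%:E <= eps%:E)%E.
  apply: le_trans hn; rewrite (@integral_tnth R 1 (fun t => fejer_half n m t - halfline m t) ord0) //.
  split; first by apply: cmeasB; [exact: cmeas_fejer_half|case: (cbounded_half m)].
  by exists 2 => t; exact: fejer_half_diff_le1.
have [J hJ] : exists J, Iq mu q (fun x => (B ^+ N).[e x]) = J%:E.
  exists (fine (Iq mu q (fun x => (B ^+ N).[e x]))); rewrite Iq_fineK //.
  by apply: cbounded_Iq_lty; [exact: ltW|exact: cbounded_horner].
have J0 : (\int[mu]_x (g x)%:E = J%:E)%E by rewrite -hJ IqE.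
have [D hD] : exists D, (\int[mu]_x (d x)%:E = D%:E)%E.
  exists (fine (\int[mu]_x (d x)%:E)); rewrite fineK // ge0_fin_numE; last first.
    by apply: integral_ge0 => x _; rewrite lee_fin.
  by apply: le_lt_trans I2 _; rewrite ltry.
have De : D <= eps by rewrite -lee_fin -hD.
have QMd0 x : 0 <= Q * M * d x by rewrite mulr_ge0 // ltW.
have mQMd : measurable_fun setT (fun x => Q * M * d x) by exact: measurable_funM.
have IQ : (\int[mu]_x (Q * M * d x)%:E = (Q * M * D)%:E)%E.
  by rewrite pintZ // ?hD // ltW.
have QMe : Q * M * D <= kap / 2.
  apply: (@le_trans _ _ (Q * M * eps)); first by apply: ler_wpM2l => //; exact: ltW.
  rewrite /eps le_eqVlt; apply/orP; left; apply/eqP.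
  by field; rewrite !gt_eqF.
have up : J <= (m + (kap / 2 + Q * M * D)) * y.
  have h0 : (\int[mu]_x (g x)%:E <= \int[mu]_x (y * ((1 - hs x) + (kap / 2 + Q * M * d x)))%:E)%E.
    apply: le_pint => // [|x|x].
    - by apply: measurable_funM => //; apply: measurable_funD => //; exact: measurable_funD.
    - exact: powR_ge0.
    - have /andP[_ g2] := gE x; apply: (le_trans g2); rewrite mulrC ler_pM2l //.
      have := vu x; have := uE x; rewrite ler_norml => /andP[? ?] /andP[? ?]; lra.
  move: h0; rewrite J0 pintZ ?(ltW y0) //; last 2 first.
  - by apply: measurable_funD => //; exact: measurable_funD.
  - by move=> x; rewrite addr_ge0 // addr_ge0 // divr_ge0 // ltW.
  rewrite pintD //; last 2 first.
  - exact: measurable_funD.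
  - by move=> x; rewrite addr_ge0 // divr_ge0 // ltW.
  have kap20 (x : torus) : 0 <= kap / 2 by rewrite divr_ge0 // ltW.
  rewrite (pintD mu (measurable_cst (kap / 2)) mQMd kap20 QMd0).
  by rewrite I1 pint_cst IQ -!EFinD -EFinM lee_fin mulrC.
have low : y^-1 * m <= J + y^-1 * (Q * M * D).
  have h0 : (\int[mu]_x (y^-1 * (1 - hs x))%:E <=
      \int[mu]_x (g x + y^-1 * (Q * M * d x))%:E)%E.
    apply: le_pint => [|||x].
    - exact: measurable_funM.
    - by apply: measurable_funD => //; exact: measurable_funM.
    - by move=> x; rewrite mulr_ge0 // ltW.
    - have /andP[g1 _] := gE x; apply: (@le_trans _ _ (y^-1 * (expR (q * v x) + Q * M * d x))).
        rewrite ler_pM2l //; have := vu x; have := uE x; rewrite ler_norml => /andP[? ?] /andP[? ?]; lra.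
      by rewrite mulrDr lerD2r mulrC.
  move: h0; rewrite pintZ ?(ltW yi0) // I1 pintD //; last 3 first.
  - exact: measurable_funM.
  - by move=> x; exact: powR_ge0.
  - by move=> x; rewrite mulr_ge0 // ltW.
  by rewrite J0 pintZ ?(ltW yi0) // IQ -!EFinM -EFinD lee_fin.
have yy : expR eta = y * y by rewrite /y -expRD; congr expR; field.
have yyi : expR (- eta) = y^-1 * y^-1 by rewrite expRN yy invfM.
rewrite hJ !lee_fin yy yyi; split.
  have : y^-1 * (Q * M * D) <= y^-1 * kap by apply: ler_wpM2l; [exact: ltW|lra].
  move: low; rewrite /kap; lra.
apply: (le_trans up); rewrite -mulrA mulrC -mulrA; apply: ler_wpM2l; first exact: ltW.
apply: (@le_trans _ _ (m + kap)); first by lra.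
rewrite /kap -[X in X + _]mul1r -mulrDl; apply: ler_wpM2r; first exact: ltW.
rewrite -subr_ge0 (_ : _ - _ = (y - 1) ^+ 2 / y); last by field; rewrite gt_eqF.
by rewrite divr_ge0 ?sqr_ge0 // ltW.
Qed.
End plateau.

(** * A functional on the Hardy spaces of the circle *)

Section functional.
Variable R : realType.
Local Notation torus := (torus R 1).
Local Notation mu := (haar R 1).
Implicit Types (f : torus -> R[i]) (F : {poly R[i]}) (q th al c eta : R).

(** A functional on the Hardy spaces of the circle whose norm on [H^q] can be computed for
    every [q]. *)
Definition two_coef (c : R) f : R[i] := fourier f (fun=> 0) + c%:C * fourier f (fun=> 1).

Lemma cbounded_e : cbounded (@e R).
Proof.
have -> : @e R = (fun x => 'X.[e x]) by apply/funext => x; rewrite hornerX.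
exact: cbounded_horner.
Qed.

Lemma eXJ (k : nat) (x : torus) : e x ^+ k = conjc (character (fun=> - k%:Z) x).
Proof.
rewrite eX; transitivity (conjc (conjc (character (fun=> k%:Z) x))); first by rewrite conjcK.
by congr conjc; exact: characterJ.
Qed.

Lemma eJX (k : nat) (x : torus) : conjc (e x) * e x ^+ k = conjc (character (fun=> 1 - k%:Z) x).
Proof.
rewrite eXJ -{1}[e x]expr1 eX -conjM; congr conjc; exact: characterM.
Qed.

Lemma fourier_horner F m : fourier (fun x => F.[e x]) (fun=> m%:Z) = F`_m.
Proof.
have fE : (fun x => F.[e x]) = (fun x => \sum_(k < (size F + m.+1)) F`_k * e x ^+ k).
  by apply/funext => x; rewrite (@horner_coef_wide _ (size F + m.+1)) // leq_addr.
rewrite fE fourier_sum => [|k _]; last first.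
  apply: cbounded_cintegrable; apply: cboundedZ.
  have -> : (fun x => e x ^+ k) = (fun x => ('X^k).[@e R x]) by apply/funext => x; rewrite hornerXn.
  exact: cbounded_horner.
have mlt : (m < size F + m.+1)%N by rewrite addnS ltnS leq_addl.
rewrite (bigD1 (Ordinal mlt)) //= big1 ?addr0 => [|k km]; rewrite fourierZ.
- under [X in fourier X]eq_fun do rewrite eX.
  by rewrite fourier_character; case: forallP => [_|[]//]; rewrite mulr1.
- apply: cbounded_cintegrable; under eq_fun do rewrite eX; exact: cbounded_character.
- under [X in fourier X]eq_fun do rewrite eX.
  rewrite fourier_character; case: forallP => [/(_ ord0)|_]; last by rewrite mulr0.
  by rewrite eqz_nat => /eqP h; move: km; rewrite -val_eqE /= h eqxx.
- apply: cbounded_cintegrable; under eq_fun do rewrite eX; exact: cbounded_character.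
Qed.

Lemma hardyI_horner q F : 0 < q -> hardyI q (fun x => F.[e x]).
Proof.
move=> q0; have bF := cbounded_horner F; split; [by case: bF|exact: cbounded_Iq_lty (ltW q0) bF|].
move=> k [j kj]; rewrite fourierE.
under eq_cint do rewrite horner_eE mulr_suml.
rewrite cint_sum => [|i _]; last first.
  apply: cintegrable_fourier; apply: cintegrableZ.
  by apply: cbounded_cintegrable; exact: cbounded_character.
apply: big1 => i _; rewrite -(fourierE (fun x => F`_i * character (fun=> i%:Z) x)) fourierZ; last first.
  by apply: cbounded_cintegrable; exact: cbounded_character.
rewrite fourier_character; case: forallP => [/(_ j)/eqP h|_]; last by rewrite mulr0.
by move: kj; rewrite -h.
Qed.

Lemma two_coef_horner c F : two_coef c (fun x => F.[e x]) = F`_0 + c%:C * F`_1.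
Proof. by rewrite /two_coef -(fourier_horner F 0) -(fourier_horner F 1). Qed.

(** Pairing a Hardy function with [(1 + al * conj e) * F] only involves its first two
    coefficients, since the frequencies of the second factor are at least [-1]. *)
Lemma cint_hardy_dual al F q f : 1 <= q -> hardyI q f ->
  cint mu (fun x => f x * ((1 + al%:C * conjc (e x)) * F.[e x])) =
  F`_0 * (fourier f (fun=> 0) + al%:C * fourier f (fun=> 1)) + F`_1 * (al%:C * fourier f (fun=> 0)).
Proof.
move=> q1 hf; have cf := hardyI_cintegrable q1 hf; have [_ _ f0] := hf.
have ci k : cintegrable mu (fun x => f x * conjc (character k x)) by exact: cintegrable_fourier.
have fE x : f x * ((1 + al%:C * conjc (e x)) * F.[e x]) = \sum_(k < (size F).+2)
    F`_k * (f x * conjc (character (fun=> - k%:Z) x) +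
            al%:C * (f x * conjc (character (fun=> 1 - k%:Z) x))).
  rewrite (@horner_coef_wide _ (size F).+2); last by rewrite !leqW.
  rewrite !mulr_sumr; apply: eq_bigr => k _; rewrite -eXJ -eJX.
  have AC (u v w E y : R[i]) : u * ((1 + v * w) * (y * E)) = y * (u * E + v * (u * (w * E))) by ring.
  exact: AC.
rewrite (eq_cint mu fE) cint_sum => [|k _]; last first.
  by apply: cintegrableZ; apply: cintegrableD => //; exact: cintegrableZ.
have cE (k : nat) : cint mu (fun x => F`_k * (f x * conjc (character (fun=> - k%:Z) x) +
            al%:C * (f x * conjc (character (fun=> 1 - k%:Z) x)))) =
    F`_k * (fourier f (fun=> - k%:Z) + al%:C * fourier f (fun=> 1 - k%:Z)).
  rewrite cintZ; last by apply: cintegrableD => //; exact: cintegrableZ.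
  by rewrite cintD //; [rewrite cintZ // !fourierE|exact: cintegrableZ].
under eq_bigr do rewrite cE.
rewrite !big_ord_recl big1 => [|k _]; last first.
  by rewrite !f0 ?mulr0 ?addr0 ?mulr0 //; exists ord0.
rewrite addr0 (f0 (fun=> - (bump 0 0)%:Z)); last by exists ord0.
by rewrite add0r addr0.
Qed.

(** Parseval's identity for [1 + al e]. *)
Lemma Iq_lin al : (\int[mu]_x (normc (1 + al%:C * e x) ^+ 2)%:E = (1 + al ^+ 2)%:E)%E.
Proof.
have ce : cintegrable mu (@e R) := cbounded_cintegrable mu cbounded_e.
have ca := cintegrableZ al%:C ce; have cj := cintegrableJ ca.
have e0 : cint mu (@e R) = 0.
  have -> : @e R = (fun x => 'X.[e x]) by apply/funext => x; rewrite hornerX.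
  by rewrite cint_horner coefX.
have hE x : (normc (1 + al%:C * e x) ^+ 2)%:C =
    (1 + al ^+ 2)%:C + (al%:C * e x + conjc (al%:C * e x)).
  have := normc_sqr (e x); rewrite normc_circ expr1n => h.
  rewrite normc_sqr; case: (e x) h => u v /= h; simpc.
  apply: complex_eqP => /=; last by ring.
  by have := congr1 ( *%R (al ^+ 2)) h; rewrite !expr2; lra.
have cc : cintegrable mu (fun=> (1 + al ^+ 2)%:C) by apply: cbounded_cintegrable; exact: cbounded_cst.
have cs : cintegrable mu (fun x => (normc (1 + al%:C * e x) ^+ 2)%:C).
  by under eq_fun do rewrite hE; apply: cintegrableD => //; exact: cintegrableD.
have : cint mu (fun x => (normc (1 + al%:C * e x) ^+ 2)%:C) = (1 + al ^+ 2)%:C.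
  rewrite (eq_cint mu hE) cintD //; last exact: cintegrableD.
  by rewrite cint_cst cintD // cintJ // cintZ // e0 mulr0 conjc0 !addr0.
rewrite cintE => /(congr1 cRe) /= <-.
by rewrite /Rintegral fineK //; apply: integrable_fin_num => //; exact: (cintegrable_Re cs).
Qed.

(** If [|h|] is almost [|1 + al e| ^ (2 / r)] then [|h| ^ r] is almost [|1 + al e| ^ 2],
    whose integral is known. *)
Lemma Iq_modulus_le al r eta (h : torus -> R[i]) : 0 < r -> 0 <= al <= 1 / 2 -> cmeas h ->
  (forall x, 0 < normc (h x) /\
    ln (normc (h x)) <= 2 / r * ln (normc (1 + al%:C * e x)) + eta) ->
  (Iq mu r h <= ((1 + al ^+ 2) * expR (r * eta))%:E)%E.
Proof.
move=> r0 /andP[a0 a2] mh hh.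
have m1 : cmeas (fun x : torus => 1 + al%:C * e x).
  by apply: cmeasD; [exact: cmeas_cst|apply: cmeasZ; case: cbounded_e].
have m2 : measurable_fun setT (fun x : torus => normc (1 + al%:C * e x) ^+ 2).
  by apply: measurable_funX; exact: measurable_normc.
rewrite mulrC EFinM -Iq_lin -pintZ //; last by move=> x; exact: sqr_ge0.
rewrite IqE; apply: le_pint => [|||x].
- exact: measurable_normc_powR.
- exact: measurable_funM.
- by move=> x; exact: powR_ge0.
have [h0 hx] := hh x; rewrite /powR (gt_eqF h0).
have n0 : 0 < normc (1 + al%:C * e x) by have := normc1D_ge (normc_circ (tnth x ord0)) a0; rewrite -/(e x); lra.
rewrite -[X in _ <= _ * X]lnK ?posrE ?exprn_gt0 // lnXn // -expRD ler_expR.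
apply: le_trans (ler_wpM2l (ltW r0) hx) _; rewrite le_eqVlt; apply/orP; left; apply/eqP.
by rewrite -mulr_natl; field; rewrite gt_eqF.
Qed.

(** The logarithm of [(1 + 2 c al / q) / (1 + al ^ 2) ^ (1 / q)] with [th = 1 / q]: the value
    of the functional at [(1 + al e) ^ (2 / q)] divided by the norm of this function. *)
Definition phi_exponent c th al : R := ln (1 + 2 * c * al * th) - ln (1 + al ^+ 2) * th.

(** Represent the functional by the kernel [(1 + al * conj e) * g], where [g] is almost
    [(1 + al e) ^ (1 - 2 / q)]; the equation for [al] says that this kernel yields the right
    ratio of the two coefficients. The kernel has modulus [|1 + al e| ^ (2 - 2 / q)], whose
    power at the dual exponent is [|1 + al e| ^ 2], so Hoelder's inequality gives the bound. *)
Lemma two_coef_upper c q al eta : 1 < q -> 0 < al <= 1 / 2 ->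
  al = c * (1 + al ^+ 2 * (1 - 2 / q)) -> 0 < eta ->
  forall f, hardyI q f -> ((normc (two_coef c f) `^ q)%:E <=
    (expR (q * (phi_exponent c q^-1 al + eta)))%:E * Iq mu q f)%E.
Proof.
move=> q1 /andP[a0 a2] ac eta0 f hf.
have a12 : 0 <= al <= 1 / 2 by rewrite (ltW a0).
have q10 : 0 < q - 1 by rewrite subr_gt0.
have q0 : 0 < q by exact: lt_trans q1.
have iq0 : 0 < q^-1 by rewrite invr_gt0.
have iq1 : q^-1 < 1 by rewrite invf_lt1.
set r := q / (q - 1); have r0 : 0 < r by rewrite divr_gt0.
have [g [g0 g1 gz]] := poly_modulus (1 - 2 / q) a12 eta0.
have [mf If _] := hf; have cf := hardyI_cintegrable (ltW q1) hf.
pose Psi x := (1 + al%:C * conjc (e x)) * g.[e x].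
have bPsi : cbounded Psi.
  have b1 : cbounded (fun x : torus => 1 + al%:C * conjc (e x)).
    apply: (@cboundedD _ _ R (fun=> 1) (fun x => al%:C * conjc (e x))); first exact: cbounded_cst.
    by apply: (@cboundedZ _ _ R al%:C (fun x => conjc (e x))); exact: (cboundedJ cbounded_e).
  exact: (cboundedM b1 (cbounded_horner g)).
set A := al ^+ 2; have A0 : 0 < A by exact: exprn_gt0.
have A1 : A <= 1 / 4.
  have := ler_pM (ltW a0) (ltW a0) a2 a2; rewrite -expr2 -/A; lra.
set D := 1 + A * (1 - 2 / q) in ac.
have D0 : 0 < D.
  have h := mulr_ge0 (ltW A0) (ltW iq0).
  have h2 : A * q^-1 <= 1 / 4 * 1 by apply: ler_pM => //; exact: ltW.
  rewrite /D mulrBr; lra.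
have P0 : 0 < (1 + A) * expR (r * eta) by rewrite mulr_gt0 ?expR_gt0 //; lra.
have nPsi x : normc (Psi x) = normc (1 + al%:C * e x) * normc g.[e x].
  rewrite /Psi ComplexField.Normc.normcM; congr (_ * _).
  by case: (e x) => u v; simpc; rewrite /= sqrrN.
have IPsi : (Iq mu r Psi <= ((1 + A) * expR (r * eta))%:E)%E.
  apply: Iq_modulus_le => // [|x]; first by case: bPsi.
  have [gp gl] := gz (e x) (normc_circ _).
  have n0 : 0 < normc (1 + al%:C * e x).
    by have := normc1D_ge (normc_circ (tnth x ord0)) (ltW a0); rewrite -/(e x); lra.
  rewrite nPsi mulr_gt0 // lnM //; split=> //.
  have -> : 2 / r = 1 + (1 - 2 / q) by rewrite /r; field; rewrite !gt_eqF.
  rewrite [_ * ln _](mulrDl 1) mul1r -addrA lerD2l.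
  by move: gl; rewrite ler_distl => /andP[_].
have := hoelder_cint q1 P0 (_ : cintegrable mu (fun x => f x * Psi x)) mf (_ : cmeas Psi) IPsi.
have cfP : cintegrable mu (fun x => f x * Psi x).
  have := cintegrableM bPsi cf; by under eq_fun do rewrite mulrC.
have mPsi : cmeas Psi by case: bPsi.
move=> /(_ cfP mPsi); rewrite (cint_hardy_dual al g (ltW q1) hf) g0 g1.
have -> : 1 * (fourier f (fun=> 0) + al%:C * fourier f (fun=> 1)) +
    ((1 - 2 / q) * al)%:C * (al%:C * fourier f (fun=> 0)) = D%:C * two_coef c f.
  have AC (u v a k : R[i]) : 1 * (u + a * v) + k * (a * u) = (1 + k * a) * u + a * v by ring.
  have aC : al%:C = c%:C * D%:C :> R[i] by rewrite [in LHS]ac (rmorphM (real_complex R)).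
  have DC : D%:C = 1 + ((1 - 2 / q) * al)%:C * al%:C :> R[i].
    rewrite -(rmorphM (real_complex R)) -[1]/((1 : R)%:C) -(rmorphD (real_complex R)).
    by congr (_%:C); rewrite /D /A; ring.
  by rewrite AC -DC aC /two_coef mulrDr [D%:C * (_ * _)]mulrA [D%:C * c%:C]mulrC.
rewrite ComplexField.Normc.normcM normc_real (gtr0_norm D0).
rewrite (powRM _ (ltW D0) (normc_ge0 (two_coef c f))) [X in (X <= _)%E]EFinM.
rewrite -(@lee_pmul2l _ ((D `^ q)^-1)%:E) ?lte_fin ?invr_gt0 ?powR_gt0 //.
rewrite !muleA -!EFinM mulVf ?gt_eqF ?powR_gt0 // mul1r => h; apply: (le_trans h).
apply: lee_wpmul2r; first exact: Iq_ge0.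
rewrite lee_fin le_eqVlt; apply/orP; left; apply/eqP.
have D1 : 1 + 2 * c * al / q = (1 + A) / D.
  have -> : c = al / D by rewrite {1}ac mulfK // gt_eqF.
  have D' : D != 0 by rewrite gt_eqF.
  have q' : q != 0 by rewrite gt_eqF.
  have -> : 1 + 2 * (al / D) * al / q = (D + 2 * A / q) / D.
    by rewrite /A; clearbody D; field; rewrite q' D'.
  by congr (_ / _); rewrite /D; field.
have A10 : 0 < 1 + A by lra.
rewrite /phi_exponent D1 ln_div ?posrE // -powRN /powR (gt_eqF D0) (gt_eqF P0) -expRD.
by congr expR; rewrite lnM ?posrE ?expR_gt0 // expRK /r; field; rewrite !gt_eqF.
Qed.

(** The test function is a polynomial close to [(1 + al e) ^ (2 / q)]. *)
Lemma two_coef_lower c q al eta : 1 < q -> 0 < al <= 1 / 2 -> 0 < c -> 0 < eta ->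
  exists F, [/\ (1 <= Iq mu q (fun x => F.[e x]))%E &
   ((expR (q * (phi_exponent c q^-1 al - eta)))%:E * Iq mu q (fun x => F.[e x]) <=
    (normc (two_coef c (fun x => F.[e x])) `^ q)%:E)%E].
Proof.
move=> q1 /andP[a0 a2] c0 eta0.
have a12 : 0 <= al <= 1 / 2 by rewrite (ltW a0).
have q0 : 0 < q by exact: lt_trans q1.
have [F [F0 F1 Fz]] := poly_modulus (2 / q) a12 eta0; exists F.
have bF := cbounded_horner F; split.
  have := normc_cint_powR_le q1 (cbounded_cintegrable mu bF).
  rewrite cint_horner F0.
  have -> : normc (1 : R[i]) = 1 := etrans (normc_real 1) (normr1 _).
  by rewrite powR1.
have IF : (Iq mu q (fun x => F.[e x]) <= ((1 + al ^+ 2) * expR (q * eta))%:E)%E.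
  apply: Iq_modulus_le => // [|x]; first by case: bF.
  have [Fp] := Fz (e x) (normc_circ _); rewrite ler_distl => /andP[_ h].
  by split.
have B0 : 0 < 1 + 2 * c * al / q by rewrite addr_gt0 // divr_gt0 // !mulr_gt0.
have A0 : 0 < 1 + al ^+ 2 by rewrite addr_gt0 // exprn_gt0.
have -> : two_coef c (fun x => F.[e x]) = (1 + 2 * c * al / q)%:C.
  rewrite two_coef_horner F0 F1 (_ : 1 + 2 * c * al / q = 1 + c * (2 / q * al)); last first.
    by field; rewrite gt_eqF.
  by apply: complex_eqP; rewrite ?Re_add ?Im_add ?cReZ ?Im_mul /=; ring.
rewrite normc_real.
rewrite gtr0_norm //; apply: (@le_trans _ _ ((expR (q * (phi_exponent c q^-1 al - eta)))%:E *
    ((1 + al ^+ 2) * expR (q * eta))%:E)%E).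
  by apply: lee_wpmul2l => //; rewrite lee_fin expR_ge0.
rewrite -EFinM lee_fin le_eqVlt; apply/orP; left; apply/eqP.
rewrite -[1 + al ^+ 2]lnK ?posrE // -!expRD /powR (gt_eqF B0); congr expR.
by rewrite /phi_exponent; field; rewrite gt_eqF.
Qed.
End functional.

(** * Strict concavity of the exponent *)

Section exponent_concavity.
Variable R : realType.
Implicit Types (x y q th : R).

(** [ln (1 + x ^ 2)] is strictly convex on [[0, 1 / 2]]. Stated with the tangent line and proved
    from [ln (1 + r) >= r / (1 + r)]: the difference is [(y - x) ^ 2] times a positive factor. *)
Lemma ln1sq_tangent x y : 0 <= x <= 1 / 2 -> 0 <= y <= 1 / 2 -> x != y ->
  ln (1 + x ^+ 2) + 2 * x / (1 + x ^+ 2) * (y - x) < ln (1 + y ^+ 2).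
Proof.
move=> /andP[x0 x2] /andP[y0 y2] xy.
have X0 : 0 < 1 + x ^+ 2 by have := sqr_ge0 x; lra.
have Y0 : 0 < 1 + y ^+ 2 by have := sqr_ge0 y; lra.
set r := (y ^+ 2 - x ^+ 2) / (1 + x ^+ 2).
have r1 : 1 + r = (1 + y ^+ 2) / (1 + x ^+ 2) by rewrite /r; field; rewrite gt_eqF.
have r1p : 0 < 1 + r by rewrite r1 divr_gt0.
have h : r / (1 + r) <= ln (1 + y ^+ 2) - ln (1 + x ^+ 2).
  by rewrite -ln_div ?posrE // -r1; apply: ln1D_ge; lra.
rewrite -ltrBrDl; apply: lt_le_trans h.
have -> : r / (1 + r) = (y ^+ 2 - x ^+ 2) / (1 + y ^+ 2).
  by rewrite r1 /r; field; rewrite !gt_eqF.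
rewrite -subr_gt0 (_ : _ - _ = (y - x) ^+ 2 * (1 - (x ^+ 2 + 2 * (x * y))) /
  ((1 + x ^+ 2) * (1 + y ^+ 2))); last by field; rewrite !gt_eqF.
have d2 : 0 < (y - x) ^+ 2.
  by rewrite lt_neqAle sqr_ge0 andbT eq_sym expf_eq0 /= subr_eq0 eq_sym.
apply: divr_gt0; last exact: mulr_gt0.
apply: mulr_gt0 => //.
have := ler_pM x0 x0 x2 x2; have := ler_pM x0 y0 x2 y2; rewrite expr2; lra.
Qed.

Lemma ln_tangent x y : 0 < x -> 0 < y -> ln y <= ln x + (y - x) / x.
Proof.
move=> x0 y0; have := @le_ln1Dx R ((y - x) / x).
have -> : 1 + (y - x) / x = y / x by field; rewrite gt_eqF.
rewrite ln_div ?posrE //.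
have : -1 < (y - x) / x by rewrite ltr_pdivlMr //; lra.
move=> h /(_ h); lra.
Qed.

(** The small root of the quadratic equation [al = c (1 + al ^ 2 (1 - 2 th))] of
    [two_coef_upper], for [c = 1 / 4]. *)
Definition opt_alpha (th : R) : R := (2 * (1 + Num.sqrt (1 - (1 - 2 * th) / 4)))^-1.

Lemma opt_alphaP th : 0 < th < 1 -> 0 < opt_alpha th <= 1 / 2 /\
  opt_alpha th = 1 / 4 * (1 + opt_alpha th ^+ 2 * (1 - 2 * th)).
Proof.
move=> /andP[t0 t1]; have r0 : 0 <= 1 - (1 - 2 * th) / 4 by lra.
have := sqr_sqrtr r0; have := sqrtr_ge0 (1 - (1 - 2 * th) / 4).
rewrite /opt_alpha; set s := Num.sqrt _ => s0 s2.
have s1 : 0 < 1 + s by lra.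
split.
  rewrite invr_gt0 mulr_gt0 //= -[leRHS]invrK lef_pV2 ?posrE ?mulr_gt0 // ?invr_gt0; lra.
have -> : 1 - 2 * th = 4 * (1 - s ^+ 2) by rewrite s2; lra.
by field; rewrite gt_eqF.
Qed.

Lemma opt_alpha_inj th th' : 0 < th < 1 -> 0 < th' < 1 -> opt_alpha th = opt_alpha th' -> th = th'.
Proof.
move=> /opt_alphaP[/andP[a0 _] E] /opt_alphaP[_ E'] h; rewrite -h in E'.
have A0 : opt_alpha th ^+ 2 != 0 by rewrite expf_eq0 /= gt_eqF.
have : opt_alpha th ^+ 2 * (1 - 2 * th) = opt_alpha th ^+ 2 * (1 - 2 * th') by lra.
by move=> /(mulfI A0); lra.
Qed.

(** The intermediate parameter is chosen so that [al * th] is the weighted mean of its end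
    values. Then the first logarithm is concave along the segment, and the second, in which
    [al] is a convex combination with weights [l1] and [l2], is strictly convex because the end
    parameters differ. *)
Lemma exponent_gap th1 th2 w1 w2 : 0 < th1 < 1 -> 0 < th2 < 1 -> th1 != th2 ->
  0 < w1 -> 0 < w2 -> w1 + w2 = 1 ->
  exists2 al, 0 < al <= 1 / 2 &
    w1 * phi_exponent (1 / 4) th1 (opt_alpha th1) + w2 * phi_exponent (1 / 4) th2 (opt_alpha th2) < phi_exponent (1 / 4) (w1 * th1 + w2 * th2) al.
Proof.
move=> t1 t2 t12 w10 w20 w12.
have [/andP[a10 a12] _] := opt_alphaP t1; have [/andP[a20 a22] _] := opt_alphaP t2.
have ne : opt_alpha th1 != opt_alpha th2 by apply: contraNneq t12 => /(opt_alpha_inj t1 t2) ->.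
move: t1 t2 a10 a12 a20 a22 ne; set x1 := opt_alpha th1; set x2 := opt_alpha th2.
move=> /andP[t10 t11] /andP[t20 t21] a10 a12 a20 a22 ne.
set th := w1 * th1 + w2 * th2; have th0 : 0 < th by rewrite addr_gt0 ?mulr_gt0.
pose l1 := w1 * th1 / th; pose l2 := w2 * th2 / th.
have l10 : 0 < l1 by rewrite divr_gt0 ?mulr_gt0.
have l20 : 0 < l2 by rewrite divr_gt0 ?mulr_gt0.
have l12 : l1 + l2 = 1 by rewrite -mulrDl divff // gt_eqF.
pose x := l1 * x1 + l2 * x2.
have xE : x * th = w1 * (x1 * th1) + w2 * (x2 * th2).
  by rewrite /x /l1 /l2; field; rewrite gt_eqF.
have x0 : 0 < x := addr_gt0 (mulr_gt0 l10 a10) (mulr_gt0 l20 a20).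
have x12 : x <= 1 / 2.
  have h1 : l1 * x1 <= l1 * (1 / 2) by rewrite ler_pM2l.
  have h2 : l2 * x2 <= l2 * (1 / 2) by rewrite ler_pM2l.
  by rewrite /x; lra.
exists x; first by rewrite x0.
have l1E : l1 = 1 - l2 by lra.
have n1 : x != x1.
  apply: contraNneq ne => h; have : l2 * (x2 - x1) = 0 by move: h; rewrite /x l1E; lra.
  by move=> /eqP; rewrite mulf_eq0 gt_eqF //= subr_eq0 eq_sym.
have n2 : x != x2.
  apply: contraNneq ne => h; have : l1 * (x1 - x2) = 0.
    have -> : l1 * (x1 - x2) = x - (l1 + l2) * x2 by rewrite /x; ring.
    by rewrite h l12 mul1r subrr.
  by move=> /eqP; rewrite mulf_eq0 gt_eqF //= subr_eq0.
have xi : 0 <= x <= 1 / 2 by rewrite ltW.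
have xi1 : 0 <= x1 <= 1 / 2 by rewrite ltW.
have xi2 : 0 <= x2 <= 1 / 2 by rewrite ltW.
have T1 := ln1sq_tangent xi xi1 n1; have T2 := ln1sq_tangent xi xi2 n2.
set H := ln (1 + x ^+ 2) in T1 T2 *; set k := 2 * x / _ in T1 T2.
have HH : H * th < w1 * (th1 * ln (1 + x1 ^+ 2)) + w2 * (th2 * ln (1 + x2 ^+ 2)).
  have u1 : (w1 * th1) * (H + k * (x1 - x)) < (w1 * th1) * ln (1 + x1 ^+ 2).
    by rewrite ltr_pM2l // mulr_gt0.
  have u2 : (w2 * th2) * (H + k * (x2 - x)) < (w2 * th2) * ln (1 + x2 ^+ 2).
    by rewrite ltr_pM2l // mulr_gt0.
  have E : (w1 * th1) * (H + k * (x1 - x)) + (w2 * th2) * (H + k * (x2 - x)) =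
    H * th + k * (w1 * (x1 * th1) + w2 * (x2 * th2) - x * th) by rewrite /th; ring.
  by rewrite xE subrr mulr0 addr0 in E; rewrite -E !mulrA; exact: ltrD.
pose b th al : R := 1 + 2 * (1 / 4) * al * th.
have b10 : 0 < b th1 x1 by rewrite /b addr_gt0 // !mulr_gt0.
have b20 : 0 < b th2 x2 by rewrite /b addr_gt0 // !mulr_gt0.
have b0 : 0 < b th x by rewrite /b addr_gt0 // !mulr_gt0.
have L1 := ln_tangent b0 b10; have L2 := ln_tangent b0 b20.
have LL : w1 * ln (b th1 x1) + w2 * ln (b th2 x2) <= ln (b th x).
  have u1 := ler_wpM2l (ltW w10) L1; have u2 := ler_wpM2l (ltW w20) L2.
  apply: (le_trans (lerD u1 u2)).
  have -> : w1 * (ln (b th x) + (b th1 x1 - b th x) / b th x) +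
      w2 * (ln (b th x) + (b th2 x2 - b th x) / b th x) =
      (w1 + w2) * ln (b th x) + (w1 * b th1 x1 + w2 * b th2 x2 - (w1 + w2) * b th x) / b th x.
    by ring.
  have -> : w1 * b th1 x1 + w2 * b th2 x2 - (w1 + w2) * b th x = 0.
    rewrite /b w12 -[2 * (1 / 4) * x * th]mulrA xE.
    have -> : w1 = 1 - w2 by lra.
    by ring.
  by rewrite w12 mul1r mul0r addr0.
rewrite /phi_exponent -/(b th1 x1) -/(b th2 x2) -/(b th x) -/H.
move: HH LL; clear; move: (ln (b th1 x1)) (ln (b th2 x2)) (ln (b th x)) H => u1 u2 u H.
move: (ln (1 + x1 ^+ 2)) (ln (1 + x2 ^+ 2)) => v1 v2; lra.
Qed.
End exponent_concavity.

(** * Failure of interpolation in dimension one *)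

Section one_dimensional_gap.
Variable R : realType.
Local Notation torus := (torus R 1).
Local Notation mu := (haar R 1).

(** Norms increase with the exponent: Jensen's inequality for [|f| ^ r]. *)
Lemma Iq_power_mean r q (f : torus -> R[i]) : 0 < r -> r < q -> cmeas f ->
  (Iq mu q f < +oo)%E -> ((fine (Iq mu r f) `^ (q / r))%:E <= Iq mu q f)%E.
Proof.
move=> r0 rq mf If; have qr1 : 1 < q / r by rewrite ltr_pdivlMr // mul1r.
have Ir := Iq_mono_lty (ltW r0) (ltW rq) mf If.
pose h x := (normc (f x) `^ r)%:C.
have mh : cmeas h by apply: cmeas_real; exact: measurable_normc_powR.
have hh s x : normc (h x) `^ s = normc (f x) `^ (r * s).
  by rewrite normc_real ger0_norm ?powR_ge0 // -powRrM.
have ch : cintegrable mu h.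
  split=> //; apply: le_lt_trans Ir; rewrite !IqE le_eqVlt; apply/orP; left; apply/eqP.
  by apply: eq_integral => x _; rewrite hh mulr1.
have := normc_cint_powR_le qr1 ch.
have -> : Iq mu (q / r) h = Iq mu q f.
  rewrite !IqE; apply: eq_integral => x _; rewrite hh; congr (_ `^ _)%:E.
  by rewrite mulrC divfK // gt_eqF.
apply: le_trans; rewrite lee_fin; apply: ge0_ler_powR.
- by apply: ltW; exact: lt_trans qr1.
- by rewrite nnegrE fine_ge0 // Iq_ge0.
- by rewrite nnegrE normc_ge0.
have <- : cRe (cint mu h) = fine (Iq mu r f) by rewrite cintE IqE.
exact: le_trans (ler_norm _) (Re_le_normc _).
Qed.

(** The norm of the functional decreases with the exponent of the space: compare a nearly
    extremal function for [q2] in the two norms. *)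
Lemma opt_exponent_le (q1 q2 : R) : 1 < q1 -> q1 < q2 ->
  phi_exponent (1 / 4) q2^-1 (opt_alpha q2^-1) <= phi_exponent (1 / 4) q1^-1 (opt_alpha q1^-1).
Proof.
move=> h1 h12; have h2 : 1 < q2 by exact: lt_trans h12.
have p1 : 0 < q1 by exact: lt_trans h1. have p2 : 0 < q2 by exact: lt_trans h2.
have t1 : 0 < q1^-1 < 1 by rewrite invr_gt0 p1 invf_lt1.
have t2 : 0 < q2^-1 < 1 by rewrite invr_gt0 p2 invf_lt1.
have [a1 e1] := opt_alphaP t1; have [a2 e2] := opt_alphaP t2.
set v1 := phi_exponent _ q1^-1 _; set v2 := phi_exponent _ q2^-1 _.
apply/ler_addgt0Pr => eta eta0; have eta2 : 0 < eta / 2 by rewrite divr_gt0.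
have c0 : 0 < 1 / 4 :> R by rewrite divr_gt0.
have [F [F1]] := two_coef_lower h2 a2 c0 eta2; rewrite -/v2.
have bF := cbounded_horner F; have [mF _] := bF.
have I2 := cbounded_Iq_lty mu (ltW p2) bF; have I1 := cbounded_Iq_lty mu (ltW p1) bF.
have := two_coef_upper h1 a1 e1 eta2 (hardyI_horner F p1); rewrite -/v1.
have := Iq_power_mean p1 h12 mF I2.
move: F1; rewrite -(Iq_fineK I1) -(Iq_fineK I2).
set i1 := fine (Iq mu q1 _); set i2 := fine (Iq mu q2 _); set n := normc _.
rewrite -!EFinM !lee_fin => i21 pm up low.
have i10 : 0 <= i1 by rewrite fine_ge0 // Iq_ge0.
have i20 : 0 < i2 by exact: lt_le_trans i21.
have qq0 : 0 <= q2 / q1 by rewrite divr_ge0 // ltW.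
have : n `^ q2 <= expR (q2 * (v1 + eta / 2)) * i2.
  have -> : n `^ q2 = (n `^ q1) `^ (q2 / q1) by rewrite -powRrM mulrC divfK // gt_eqF.
  apply: (@le_trans _ _ ((expR (q1 * (v1 + eta / 2)) * i1) `^ (q2 / q1))).
    apply: ge0_ler_powR => //; rewrite nnegrE ?powR_ge0 //.
    by rewrite mulr_ge0 ?expR_ge0.
  rewrite powRM ?expR_ge0 //.
  have -> : expR (q1 * (v1 + eta / 2)) `^ (q2 / q1) = expR (q2 * (v1 + eta / 2)).
    by rewrite /powR (gt_eqF (expR_gt0 _)) expRK; congr expR; field; rewrite gt_eqF.
  by apply: ler_wpM2l => //; exact: expR_ge0.
move=> h; have := le_trans low h; rewrite ler_pM2r // ler_expR ler_pM2l // => hv.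
lra.
Qed.

(** The parameters [gam] and [m] solve [gam * m ^ (1 / p_i) = exp (- nu_i - dl)] for [i = 1, 2]:
    the rank one operator is then a contraction at both ends, with room [dl], and at [p] it has
    norm about [exp (nu - (w1 nu1 + w2 nu2) - dl) = exp dl]. That [m <= 1] is the monotonicity
    [nu2 <= nu1]. *)
Lemma witness_gt1 (p1 p p2 : R) : 1 < p1 -> p1 < p -> p < p2 ->
  exists2 A, 1 < A & witness p1 p p2 1 A.
Proof.
move=> hp1 hp1p hpp2.
have hp : 1 < p by exact: lt_trans hp1p. have hp2 : 1 < p2 by exact: lt_trans hpp2.
have p10 : 0 < p1 by exact: lt_trans hp1. have p0 : 0 < p by exact: lt_trans hp.
have p20 : 0 < p2 by exact: lt_trans hp2.
pose th1 := p1^-1; pose th := p^-1; pose th2 := p2^-1.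
have t1 : 0 < th1 < 1 by rewrite invr_gt0 p10 invf_lt1.
have t2 : 0 < th2 < 1 by rewrite invr_gt0 p20 invf_lt1.
have t21 : th2 < th by rewrite ltf_pV2.
have tt1 : th < th1 by rewrite ltf_pV2.
have [a1 e1] := opt_alphaP t1; have [a2 e2] := opt_alphaP t2.
have t12 : 0 < th1 - th2 by rewrite subr_gt0 (lt_trans t21).
pose w1 := (th - th2) / (th1 - th2); pose w2 := (th1 - th) / (th1 - th2).
have w10 : 0 < w1 by rewrite divr_gt0 // subr_gt0.
have w20 : 0 < w2 by rewrite divr_gt0 // subr_gt0.
have t12n : th1 - th2 != 0 by rewrite gt_eqF.
have w12 : w1 + w2 = 1 by rewrite /w1 /w2; field.
have wth : w1 * th1 + w2 * th2 = th by rewrite /w1 /w2; field.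
have tne : th1 != th2 by rewrite -subr_eq0.
have [al a0] := exponent_gap t1 t2 tne w10 w20 w12; rewrite wth.
set nu1 := phi_exponent _ th1 _; set nu2 := phi_exponent _ th2 _; set nu := phi_exponent _ th _.
move=> gap; pose dl := (nu - (w1 * nu1 + w2 * nu2)) / 2.
have dl0 : 0 < dl by rewrite divr_gt0 // subr_gt0.
(* every approximation costs a factor [exp eta], and at most four of them occur *)
pose eta := dl / 4; have eta0 : 0 < eta by rewrite divr_gt0.
have nu21 : nu2 <= nu1 by apply: opt_exponent_le => //; exact: lt_trans hpp2.
pose lm := - ((nu1 - nu2) / (th1 - th2)); pose m := expR lm.
have m01 : 0 < m <= 1.
  have nu0 : 0 <= nu1 - nu2 by rewrite subr_ge0.
  by rewrite /m /lm expR_gt0 -expR0 ler_expR oppr_le0 (divr_ge0 nu0 (ltW t12)).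
pose lg := - nu1 - dl - th1 * lm; pose gam := expR lg.
have lg2 : lg = - nu2 - dl - th2 * lm by rewrite /lg /lm; field.
have lgp : lg + th * lm = - (w1 * nu1 + w2 * nu2) - dl.
  have -> : lg = w1 * lg + w2 * lg by rewrite -mulrDl w12 mul1r.
  rewrite {2}lg2 /lg -wth.
  have -> : w2 = 1 - w1 by rewrite -w12 addrC addKr.
  ring.
have [G hG] := plateau_poly m01 (ltW hp2) eta0.
pose c : R := 1 / 4; have c0 : 0 < c by rewrite divr_gt0.
pose k (b : bool) (_ : 'I_1) : int := if b then 1 else 0.
pose tau (b : bool) (x : torus) : R[i] := (if b then c else 1)%:C * (gam%:C * G.[e x]).
have finite_rankE f x : finite_rank k tau f x = (two_coef c f * gam%:C) * G.[e x].
  rewrite /finite_rank big_bool /tau /two_coef /= mulrDl mulrDl addrC.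
  have -> : fourier f (k false) = fourier f (fun=> 0) by [].
  have -> : fourier f (k true) = fourier f (fun=> 1) by [].
  by rewrite (rmorph1 (real_complex R)) mul1r -!mulrA; congr (_ + _); rewrite mulrCA.
have mG : cmeas (fun x => G.[e x]) by case: (cbounded_horner G).
have IE q f : Iq mu q (finite_rank k tau f) =
    ((normc (two_coef c f) `^ q * expR (q * lg))%:E * Iq mu q (fun x => G.[e x]))%E.
  rewrite (@eq_Iq _ _ _ _ _ _ (fun x => (two_coef c f * gam%:C) * G.[e x])); last first.
    by move=> x; rewrite finite_rankE.
  rewrite IqZ // ComplexField.Normc.normcM normc_real gtr0_norm ?expR_gt0 //.
  rewrite powRM ?normc_ge0 ?expR_ge0 //; congr ((_ * _)%:E * _)%E.
  by rewrite /powR (gt_eqF (expR_gt0 _)) expRK.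
have con q v a : 1 < q -> q <= p2 -> 0 < a <= 1 / 2 -> a = c * (1 + a ^+ 2 * (1 - 2 / q)) ->
    v = phi_exponent c q^-1 a -> lg = - v - dl - q^-1 * lm -> Iq_contraction q (finite_rank k tau).
  move=> q1 qp2 a01 ae vE lgE f hf; have q0 : 0 < q by exact: lt_trans q1.
  have q12 : 1 <= q <= p2 by rewrite ltW.
  have [_ G2] := hG q q12; rewrite IE.
  have up := two_coef_upper q1 a01 ae eta0 hf; rewrite -vE in up.
  apply: (@le_trans _ _ ((normc (two_coef c f) `^ q * expR (q * lg))%:E * (expR eta * m)%:E)%E).
    by apply: lee_wpmul2l => //; rewrite lee_fin mulr_ge0 ?powR_ge0 ?expR_ge0.
  rewrite -EFinM -mulrA EFinM.
  apply: (@le_trans _ _ ((expR (q * (v + eta)))%:E * Iq mu q f *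
      (expR (q * lg) * (expR eta * m))%:E)%E).
    by apply: lee_wpmul2r => //; rewrite lee_fin !mulr_ge0 ?expR_ge0.
  rewrite muleAC -EFinM /m -!expRD -[leRHS]mul1e.
  apply: lee_wpmul2r; first exact: Iq_ge0.
  rewrite lee_fin -expR0 ler_expR lgE.
  have -> : q * (v + eta) + (q * (- v - dl - q^-1 * lm) + (eta + lm)) = (q * eta + eta) - q * dl.
    by field; rewrite gt_eqF.
  have : eta <= q * eta by rewrite ler_peMl ?(ltW eta0) // ltW.
  have : 0 <= q * eta by rewrite mulr_ge0 // ltW.
  have -> : dl = 4 * eta by rewrite /eta; field.
  lra.
have [F [F1 hF]] := two_coef_lower hp a0 c0 eta0.
have bF := cbounded_horner F; have [mF _] := bF.
have IF := cbounded_Iq_lty mu (ltW p0) bF.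
move: F1 hF; rewrite -(Iq_fineK IF) -EFinM !lee_fin; set J := fine _ => J1 hJ.
have J0 : 0 < J by exact: lt_le_trans J1.
pose a := J `^ (- p^-1); have ap : a `^ p = J^-1.
  by rewrite /a -powRrM mulNr mulVf ?gt_eqF // powRN powRr1 // ltW.
have a00 : 0 <= a by exact: powR_ge0.
pose f x := a%:C * F.[e x].
have If : Iq mu p f = 1%E.
  by rewrite IqZ // normc_real ger0_norm // ap -(Iq_fineK IF) -EFinM mulVf // gt_eqF.
have hfF := hardyI_horner F p0.
have hf : hardyI p f by apply: hardyIZ => //; exact: ltW.
have phif : two_coef c f = a%:C * two_coef c (fun x => F.[e x]).
  have cF := cbounded_cintegrable mu bF.
  by rewrite /two_coef !fourierZ // mulrDr mulrCA.
exists (expR (p * dl / 2)).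
  by rewrite -expR0 ltr_expR divr_gt0 // mulr_gt0.
exists bool, k, tau, f; split => //.
- move=> b; apply: hardyIZ; first exact: ltW.
  by apply: hardyIZ; [exact: ltW|exact: hardyI_horner].
- split; first by apply: (con p1 nu1 (opt_alpha th1)) => //; exact: ltW (lt_trans hp1p hpp2).
  by apply: (con p2 nu2 (opt_alpha th2)).
- by rewrite If.
have ppp2 : 1 <= p <= p2 by rewrite !ltW.
have [G1 _] := hG p ppp2; rewrite IE phif ComplexField.Normc.normcM normc_real ger0_norm //.
rewrite powRM ?normc_ge0 // ap.
apply: (@le_trans _ _ ((J^-1 * (expR (p * (nu - eta)) * J) * expR (p * lg))%:E *
    (expR (- eta) * m)%:E)%E); last first.
  apply: lee_pmul => //.
  - by rewrite lee_fin !mulr_ge0 ?expR_ge0 ?invr_ge0 // ltW.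
  - by rewrite lee_fin mulr_ge0 ?expR_ge0.
  - rewrite lee_fin; apply: ler_wpM2r; first exact: expR_ge0.
    by apply: ler_wpM2l => //; rewrite invr_ge0 ltW.
rewrite -EFinM lee_fin.
have -> : J^-1 * (expR (p * (nu - eta)) * J) = expR (p * (nu - eta)) by field; rewrite gt_eqF.
rewrite /m -!expRD ler_expR.
have -> : p * (nu - eta) + p * lg + (- eta + lm) = p * (nu + (lg + th * lm)) - p * eta - eta.
  by rewrite /th; field; rewrite gt_eqF.
rewrite lgp.
have -> : nu + (- (w1 * nu1 + w2 * nu2) - dl) = dl by rewrite /dl; field.
have : eta <= p * eta by rewrite ler_peMl ?(ltW eta0) // ltW.
have : dl = 4 * eta by rewrite /eta; field.
move=> ->; rewrite (_ : p * (4 * eta) / 2 = 2 * (p * eta)); last by field.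
by rewrite [p * (4 * eta)]mulrCA; lra.
Qed.
End one_dimensional_gap.

(** * Superadditivity and exponential growth *)

Section fekete.
Variable R : realType.

(** Fekete's lemma, for a limit approached from below. *)
Lemma fekete_superadditive (a : nat -> R) (M : R) :
  (forall d e, (0 < d)%N -> (0 < e)%N -> a d + a e <= a (d + e)%N) ->
  (forall d, (0 < d)%N -> 0 <= a d <= d%:R * M) ->
  exists2 l : R, (forall d, (0 < d)%N -> a d / d%:R <= l) &
    (fun d => a d / d%:R - l) @ \oo --> (0 : R).
Proof.
move=> ha hM; pose E := [set x | exists2 d, (0 < d)%N & x = a d / d%:R].
have ubE : ubound E M.
  move=> _ [d d0 ->]; have /andP[_ h] := hM d d0.
  by rewrite ler_pdivrMr ?ltr0n // mulrC.
have supE : has_sup E by split; [exists (a 1 / 1%:R), 1%N|exists M].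
have le_sup d : (0 < d)%N -> a d / d%:R <= sup E.
  by move=> d0; apply: (sup_upper_bound supE); exists d.
have l0 : 0 <= sup E.
  have /andP[a1 _] := hM 1%N isT.
  by apply: le_trans (le_sup 1%N isT); rewrite divr1.
exists (sup E) => //; apply/cvgrPdist_le => eps eps0.
have eps2 : 0 < eps / 2 by rewrite divr_gt0.
have [_ [m m0 ->] hm] := sup_adherent eps2 supE.
have mR : 0 < m%:R :> R by rewrite ltr0n.
have iter q r : (0 < r)%N -> q%:R * a m <= a (q * m + r)%N.
  move=> r0; elim: q => [|q IH].
    by rewrite mul0r mul0n add0n; have /andP[] := hM r r0.
  rewrite -addn1 natrD mulrDl mul1r mulnDl mul1n addnAC.
  by apply: le_trans (ha _ _ _ m0); [rewrite lerD2r|rewrite addn_gt0 r0 orbT].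
exists (Num.truncn (m%:R * sup E / (eps / 2))).+1 => // n /= hn.
have n0 : (0 < n)%N by exact: leq_trans hn.
have nR : 0 < n%:R :> R by rewrite ltr0n.
have hnR : m%:R * sup E / (eps / 2) <= n%:R.
  by apply: ltW; apply: (lt_le_trans (truncnS_gt _)); rewrite ler_nat.
rewrite sub0r normrN distrC ger0_norm ?subr_ge0 ?le_sup //.
pose q := (n.-1 %/ m)%N.
(* the remainder is taken in [1 .. m], since [a 0] is unconstrained *)
have nE : n = (q * m + (n.-1 %% m).+1)%N by rewrite addnS -divn_eq prednK.
have han : q%:R * a m <= a n by rewrite [in leRHS]nE; exact: iter.
have qm : (n%:R - m%:R : R) <= q%:R * m%:R.
  rewrite lerBlDr -natrM -natrD ler_nat {1}nE leq_add2l.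
  by rewrite ltn_mod.
have /andP[am0 _] := hM m m0.
have b0 : 0 <= a m / m%:R by rewrite divr_ge0 // ltW.
have bs := le_sup m m0.
have h1 : (n%:R - m%:R) * (a m / m%:R) <= a n.
  apply: le_trans han; apply: le_trans (ler_wpM2r b0 qm) _.
  by rewrite -mulrA [m%:R * _]mulrC divfK // gt_eqF.
have h2 : m%:R * (a m / m%:R) <= n%:R * (eps / 2).
  apply: (@le_trans _ _ (m%:R * sup E)); first by rewrite ler_pM2l.
  by rewrite -ler_pdivrMr.
rewrite lerBlDr -lerBlDl ler_pdivlMr //.
have h3 : n%:R * (sup E - eps / 2) <= n%:R * (a m / m%:R) by rewrite ler_pM2l // ltW.
have -> : (sup E - eps) * n%:R = n%:R * (sup E - eps / 2) - n%:R * (eps / 2) by field.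
move: h1 h2 h3; rewrite mulrBl; lra.
Qed.
End fekete.

Section exponential_growth.
Variables (R : realType) (p1 p p2 : R).
Hypotheses (hp1 : 1 < p1) (hp1p : p1 < p) (hpp2 : p < p2).

Let hp : 1 < p. Proof. exact: lt_trans hp1p. Qed.
Let p0 : 0 < p. Proof. exact: lt_trans ltr01 hp. Qed.

Definition witnesses d : set R := [set A | 0 <= A /\ witness p1 p p2 d A].

Lemma witnesses_has_sup d : (0 < d)%N -> has_sup (witnesses d).
Proof.
move=> d0; have [A A1 hA] := witness_gt1 hp1 hp1p hpp2.
have A0 : 0 <= A by rewrite ltW // (lt_trans ltr01).
split; last first.
  have [K _ [C _ hC]] := witness_bound hp1 hp1p hpp2.
  by exists (C * K ^+ d) => B [_]; exact: hC.
case: d d0 => // d _; elim: d => [|d [B [B0 hB]]]; first by exists A.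
by exists (A * B); split; [exact: mulr_ge0|exact: (witness_tensor hp1 hp1p hpp2 A0 B0 hA hB)].
Qed.

Lemma witnesses_sup_mul d e : (0 < d)%N -> (0 < e)%N -> 1 < sup (witnesses d) ->
  sup (witnesses d) * sup (witnesses e) <= sup (witnesses (d + e)).
Proof.
move=> d0 e0 s1; have hd := witnesses_has_sup d0; have he := witnesses_has_sup e0.
have hde : has_sup (witnesses (d + e)) by apply: witnesses_has_sup; rewrite addn_gt0 d0.
have s0 : 0 < sup (witnesses d) by exact: lt_trans s1.
rewrite mulrC -ler_pdivlMr //; apply: ge_sup; first by case: he.
move=> B [B0 hB]; rewrite ler_pdivlMr //.
have [->|Bn] := eqVneq B 0.
  have [A [A0 hA]] : witnesses (d + e) !=set0 by case: hde.
  by rewrite mul0r; apply: (le_trans A0); apply: (sup_upper_bound hde).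
have Bp : 0 < B by rewrite lt_neqAle eq_sym Bn.
rewrite mulrC -ler_pdivlMr //; apply: ge_sup; first by case: hd.
move=> A [A0 hA]; rewrite ler_pdivlMr //; apply: (sup_upper_bound hde).
by split; [exact: mulr_ge0|exact: witness_tensor].
Qed.

(** Tensor powers of the operator of rank one. *)
Lemma witnesses_sup_gt1 d : (0 < d)%N -> 1 < sup (witnesses d).
Proof.
case: d => // d _; elim: d => [|d IH].
  have [A A1 hA] := witness_gt1 hp1 hp1p hpp2.
  apply: (lt_le_trans A1); apply: (sup_upper_bound (witnesses_has_sup (ltn0Sn 0))).
  by split=> //; rewrite ltW // (lt_trans ltr01).
have [A A1 hA] := witness_gt1 hp1 hp1p hpp2.
have s1 : 1 < sup (witnesses 1).
  apply: (lt_le_trans A1); apply: (sup_upper_bound (witnesses_has_sup (ltn0Sn 0))).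
  by split=> //; rewrite ltW // (lt_trans ltr01).
apply: lt_le_trans (witnesses_sup_mul (ltn0Sn 0) (ltn0Sn d) s1).
by apply: (lt_trans IH); rewrite -[ltLHS]mul1r ltr_pM2r // (lt_trans ltr01).
Qed.

(** [witness_le] bounds the constant from below and [witness_gt] from above. *)
Lemma interp_const_witnesses d : (0 < d)%N ->
  interp_const R d p1%:E p%:E p2%:E = (sup (witnesses d) `^ p^-1)%:E.
Proof.
move=> d0; have hs := witnesses_has_sup d0; have s1 := witnesses_sup_gt1 d0.
have s0 : 0 < sup (witnesses d) by exact: lt_trans s1.
have ip0 : 0 < p^-1 by rewrite invr_gt0.
apply/eqP; rewrite eq_le; apply/andP; split.
  apply/lee_addgt0Pr => e e0; rewrite leNgt -EFinD; apply/negP => h.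
  set r := _ + e in h; have r0 : 0 < r by rewrite addr_gt0 ?powR_gt0.
  have rE : (r `^ p) `^ p^-1 = r by rewrite -powRrM mulfV ?gt_eqF // powRr1 // ltW.
  have W : witness p1 p p2 d (r `^ p).
    by apply: witness_gt => //; [exact: powR_ge0|rewrite rE].
  have := sup_upper_bound hs (conj (powR_ge0 _ _) W).
  rewrite leNgt => /negP; apply.
  have -> : sup (witnesses d) = (sup (witnesses d) `^ p^-1) `^ p.
    by rewrite -powRrM mulVf ?gt_eqF // powRr1 // ltW.
  apply: gt0_ltr_powR; rewrite ?nnegrE ?powR_ge0 ?(ltW r0) //.
  by rewrite /r ltrDl.
have [A [A0 hA]] : witnesses d !=set0 by case: hs.
have ge0 : (0 <= interp_const R d p1%:E p%:E p2%:E)%E.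
  by apply: le_trans (witness_le hp1 hp1p hpp2 A0 hA); rewrite lee_fin powR_ge0.
move: ge0 (@witness_le R p1 p p2 hp1 hp1p hpp2 d).
case: (interp_const _ _ _ _ _) => [r| |] //; last by move=> _ _; rewrite leey.
rewrite lee_fin => r0 hle.
rewrite lee_fin -[leRHS](_ : (r `^ p) `^ p^-1 = r); last first.
  by rewrite -powRrM mulfV ?gt_eqF // powRr1.
apply: ge0_ler_powR; rewrite ?nnegrE ?powR_ge0 ?(ltW ip0) ?(ltW s0) //.
apply: ge_sup; first by case: hs.
move=> B [B0 hB]; have := hle B B0 hB; rewrite lee_fin => h.
rewrite -[leLHS](_ : (B `^ p^-1) `^ p = B); last first.
  by rewrite -powRrM mulVf ?gt_eqF // powRr1.
by apply: ge0_ler_powR; rewrite ?nnegrE ?powR_ge0 ?(ltW p0).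
Qed.
End exponential_growth.

Theorem theorem3p1 (R : realType) (p1 p p2 : R)
    (hp1 : 1 < p1) (hp1p : p1 < p) (hpp2 : p < p2) :
  exists2 alpha : R, 0 < alpha &
  exists2 eps : nat -> R, eps n @[n --> \oo] --> (0 : R) &
  forall d : nat, (0 < d)%N ->
    interp_const R d p1%:E p%:E p2%:E = (expR ((alpha + eps d) * d%:R))%:E.
Proof.
have hp : 1 < p by exact: lt_trans hp1p.
have p0 : 0 < p by exact: lt_trans hp.
pose s d := sup (witnesses p1 p p2 d); pose a d := ln (s d).
have s1 d : (0 < d)%N -> 1 < s d by exact: witnesses_sup_gt1.
have s0 d : (0 < d)%N -> 0 < s d by move=> /s1; exact: lt_trans.
have [K K1 [C C0 hC]] := witness_bound hp1 hp1p hpp2.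
have K0 : 0 < K by exact: lt_le_trans K1.
have sC d : (0 < d)%N -> s d <= C * K ^+ d.
  move=> d0; apply: ge_sup; first by case: (witnesses_has_sup hp1 hp1p hpp2 d0).
  by move=> A [_]; exact: hC.
have [||l hl cvl] := @fekete_superadditive R a (`|ln C| + ln K).
- move=> d e d0 e0; rewrite /a -lnM ?posrE ?s0 //.
  by rewrite ler_ln ?posrE ?mulr_gt0 ?s0 ?addn_gt0 ?d0 //; apply: witnesses_sup_mul => //; exact: s1.
- move=> d d0; rewrite ln_ge0 ?(ltW (s1 d d0)) //=.
  apply: (@le_trans _ _ (ln (C * K ^+ d))).
    by rewrite ler_ln ?posrE ?s0 ?mulr_gt0 ?exprn_gt0 //; exact: sC.
  rewrite lnM ?posrE ?exprn_gt0 // lnXn // mulrDr -[ln K *+ d]mulr_natl lerD2r.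
  apply: le_trans (ler_norm _) _; rewrite ler_peMl //.
  by rewrite ler1n.
have a1 : 0 < a 1%N by rewrite ln_gt0 // s1.
have l0 : 0 < l by apply: (lt_le_trans a1); have := hl 1%N isT; rewrite divr1.
exists (l / p); first by rewrite divr_gt0.
exists (fun n => (a n / n%:R - l) / p).
  rewrite -[X in _ --> X](mul0r p^-1); exact: (cvgM cvl (cvg_cst p^-1)).
move=> d d0; rewrite interp_const_witnesses //; congr (_%:E).
have dR : d%:R != 0 :> R by rewrite pnatr_eq0 -lt0n.
rewrite /powR gt_eqF ?(s0 d d0) //; congr expR; rewrite -/(s d) -/(a d).
by field; rewrite dR gt_eqF.
Qed.
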